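(* Let $w_0\in H^2(0,1)$ and let $w$ be the solution of the closed-loop problem described in the context, with $\alpha$, $\beta$, $E_1$ as in the context. Then there is a constant $C>0$, independent of $t$, such that for all $t>0$ $$\|w_x(t)\|^2+\mu\|w_{xx}(t)\|^2+\frac1\nu E_2(w)(t)+\beta e^{-2\alpha t}\int_0^t e^{2\alpha s}\|w_{xx}(s)\|^2\,ds\le Ce^{-2\alpha t}\Big(\|w_{0x}\|^2+\mu\|w_{0xx}\|^2+\frac1\nu E_1(w)(0)\Big)e^{C},$$ where $$E_2(w)(t)=\Big((c_0+1+w_d)+\frac{1}{9c_0}w^2(0,t)\Big)w^2(0,t)+\Big((c_1+1+w_d)+\frac{1}{9c_1}w^2(1,t)\Big)w^2(1,t).$$
   Context: Constants: $\mu>0$, $\nu>0$, $w_d\ge 0$, $c_0>0$, $c_1>0$ (fixed, as is $w_0$). $\|\cdot\|$ and $(\cdot,\cdot)$ are the norm and inner product of $L^2(0,1)$; $\|\cdot\|_m$ is the $H^m(0,1)$ norm; subscripts $x,t$ denote partial derivatives. Closed-loop problem: $w=w(x,t)$, $x\in(0,1)$, $t>0$, satisfies $$w_t-\mu w_{xxt}-\nu w_{xx}+(1+w_d)w_x+ww_x=0,\qquad w(x,0)=w_0(x),$$ with boundary feedback laws $$w_x(0,t)=\frac1\nu\Big((c_0+1+w_d)w(0,t)+\frac{2}{9c_0}w^3(0,t)\Big),\qquad w_x(1,t)=-\frac1\nu\Big((c_1+1+w_d)w(1,t)+\frac{2}{9c_1}w^3(1,t)\Big).$$ Standing well-posedness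 assumption: for $w_0\in H^2(0,1)$ there is a unique weak solution with $w(t)\in H^1(0,1)$, $w_t\in L^2(L^2)$, $\mu w_t\in L^2(H^1)$, and it satisfies $\|w(t)\|_2^2+\|w_t(t)\|^2+\mu\|w_{xt}(t)\|^2+\int_0^t(\|w_t(s)\|_1^2+\mu\|w_{xxt}(s)\|^2)\,ds\le C$. The number $\alpha$ is any real with $$0\le\alpha\le\frac12\min\Big\{\frac{\nu}{\mu+1},\ \frac{\nu}{2\mu+\nu},\ \frac{\nu(1+c_i+w_d)}{\nu+(1+c_i+w_d)\mu}\ (i=0,1)\Big\},$$ and $$\beta=\min\Big\{2\big(\nu-\alpha(\mu+1)\big),\ 1-2\alpha\frac{\mu}{\nu},\ (1+c_i+w_d)-2\alpha\Big((1+c_i+w_d)\frac{\mu}{\nu}+1\Big)\ (i=0,1)\Big\},$$ $$E_1(w)(t)=\sum_{i=0}^{1}\Big((c_i+1+w_d)+\frac{1}{3c_i}w^2(i,t)\Big)w^2(i,t).$$ *)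

(* Defs.v *)
From mathcomp Require Import all_boot all_order all_algebra.
From mathcomp Require Import all_classical all_reals all_analysis.

Set Implicit Arguments.
Unset Strict Implicit.
Unset Printing Implicit Defensive.

Import Order.TTheory GRing.Theory Num.Theory.
Import numFieldNormedType.Exports.

Local Open Scope classical_set_scope.
Local Open Scope ring_scope.

Section Sobolev.
Context {R : realType}.
Local Notation leb := (@lebesgue_measure R).

Definition L2 (f : R -> R) : Prop :=
  measurable_fun (`]0, 1[ : set R) f /\
  (\int[leb]_(x in `]0%R, 1%R[) (f x ^+ 2)%:E < +oo)%E.

Definition L2norm (f : R -> R) : R :=
  Num.sqrt (\int[leb]_(x in `]0, 1[) (f x ^+ 2)).

(* C^1 functions with compact support in the open set I *)
Definition test_fun (I : set R) (phi : R -> R) : Prop :=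
  [/\ forall x, derivable phi x 1,
      continuous (derive1 phi) &
      exists a b : R, `[a, b] `<=` I /\
        forall x, x \notin `[a, b] -> phi x = 0].

Definition weak_derivative (I : set R) (f g : R -> R) : Prop :=
  forall phi, test_fun I phi ->
    \int[leb]_(x in I) (f x * derive1 phi x) = - \int[leb]_(x in I) (g x * phi x).

(* f is in H^1(0,1) with derivative f'. An H^1 class is represented by its
   continuous representative on [0,1], so that f 0 and f 1 are its traces;
   f' is determined almost everywhere only. *)
Definition H1 (f f' : R -> R) : Prop :=
  [/\ {within `[0, 1], continuous f}, L2 f, L2 f' &
      weak_derivative `]0, 1[ f f'].

Definition H2 (f f' f'' : R -> R) : Prop := H1 f f' /\ H1 f' f''.

(* Functions of (t,x) are curried with time first: u t is the spatial profile
   at time t. *)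
Definition jointly_measurable (u : R -> R -> R) : Prop :=
  measurable_fun (`]0, +oo[ `*` `]0, 1[ : set (R * R)) (fun p => u p.1 p.2).

(* ut is the weak derivative of the L^2(0,1)-valued function u on (0,+oo):
     int u(t) phi'(t) dt = - int ut(t) phi(t) dt   in L^2(0,1)
   for scalar test functions phi; the values of the two Bochner integrals are
   computed pointwise at almost every x. *)
Definition weak_time_derivative (u ut : R -> R -> R) : Prop :=
  forall phi, test_fun `]0, +oo[ phi ->
    {ae leb, forall x, 0 < x < 1 ->
       \int[leb]_(t in `]0, +oo[) (u t x * derive1 phi t) =
       - \int[leb]_(t in `]0, +oo[) (ut t x * phi t)}.

(* u in C([0,+oo); L^2(0,1)) *)
Definition L2_continuous (u : R -> R -> R) : Prop :=
  forall t, 0 <= t ->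
    L2norm (u s \- u t) @[s --> within (fun s : R => 0 <= s) (nbhs t)] --> 0.

End Sobolev.

Section ClosedLoop.
Context {R : realType}.
Local Notation leb := (@lebesgue_measure R).

Record closed_loop_solution (mu nu wd c0 c1 : R) (w0 : R -> R)
    (w wx wxx wt wxt wxxt : R -> R -> R) : Prop := ClosedLoopSolution {
  sol_measurable :
    [/\ jointly_measurable w, jointly_measurable wx & jointly_measurable wxx] /\
    [/\ jointly_measurable wt, jointly_measurable wxt &
        jointly_measurable wxxt];
  sol_space : forall t, 0 <= t -> H2 (w t) (wx t) (wxx t);
  sol_continuous : L2_continuous w;
  sol_time : weak_time_derivative w wt;
  sol_time_space : {ae leb, forall t, 0 < t -> H2 (wt t) (wxt t) (wxxt t)};
  (* The integral is taken in the extended reals, so its finiteness is part of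
     the bound. *)
  sol_bound : exists K : R, {ae leb, forall t, 0 < t ->
    ((L2norm (w t) ^+ 2 + L2norm (wx t) ^+ 2 + L2norm (wxx t) ^+ 2
      + L2norm (wt t) ^+ 2 + mu * L2norm (wxt t) ^+ 2)%:E
     + \int[leb]_(s in `[0%R, t])
         (L2norm (wt s) ^+ 2 + L2norm (wxt s) ^+ 2
          + mu * L2norm (wxxt s) ^+ 2)%:E <= K%:E)%E};
  sol_eq : {ae leb, forall t, 0 < t -> {ae leb, forall x, 0 < x < 1 ->
    wt t x - mu * wxxt t x - nu * wxx t x + (1 + wd) * wx t x + w t x * wx t x
    = 0}};
  sol_feedback0 : forall t, 0 < t ->
    wx t 0 = nu^-1 * ((c0 + 1 + wd) * w t 0 + 2 / (9 * c0) * w t 0 ^+ 3);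
  sol_feedback1 : forall t, 0 < t ->
    wx t 1 = - nu^-1 * ((c1 + 1 + wd) * w t 1 + 2 / (9 * c1) * w t 1 ^+ 3);
  sol_init : forall x, 0 <= x <= 1 -> w 0 x = w0 x
}.

Definition alpha_max (mu nu wd c0 c1 : R) : R :=
  let r c := nu * (1 + c + wd) / (nu + (1 + c + wd) * mu) in
  2^-1 * Num.min (nu / (mu + 1))
        (Num.min (nu / (2 * mu + nu)) (Num.min (r c0) (r c1))).

Definition beta (mu nu wd c0 c1 alpha : R) : R :=
  let r c := (1 + c + wd) - 2 * alpha * ((1 + c + wd) * (mu / nu) + 1) in
  Num.min (2 * (nu - alpha * (mu + 1)))
    (Num.min (1 - 2 * alpha * (mu / nu)) (Num.min (r c0) (r c1))).

Definition E1 (wd c0 c1 : R) (v : R -> R) : R :=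
  ((c0 + 1 + wd) + 1 / (3 * c0) * v 0 ^+ 2) * v 0 ^+ 2 +
  ((c1 + 1 + wd) + 1 / (3 * c1) * v 1 ^+ 2) * v 1 ^+ 2.

Definition E2 (wd c0 c1 : R) (v : R -> R) : R :=
  ((c0 + 1 + wd) + 1 / (9 * c0) * v 0 ^+ 2) * v 0 ^+ 2 +
  ((c1 + 1 + wd) + 1 / (9 * c1) * v 1 ^+ 2) * v 1 ^+ 2.

End ClosedLoop.

(* Main.v *)
Require Import Defs.
From mathcomp Require Import all_boot all_order all_algebra.
From mathcomp Require Import all_classical all_reals all_analysis.
From mathcomp Require Import measurable_realfun ring lra.

Set Implicit Arguments.
Unset Strict Implicit.
Unset Printing Implicit Defensive.

Import Order.TTheory GRing.Theory Num.Theory.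
Import numFieldNormedType.Exports.

Local Open Scope classical_set_scope.
Local Open Scope ring_scope.

(* Multiplying the equation by [w], respectively by [- w_xx], and absorbing the
   boundary terms by means of the feedback laws gives
   [(e^(2 alpha t) F)' <= - nu e^(2 alpha t) |w_x|^2] and
   [(e^(2 alpha t) G)' <= e^(2 alpha t) (- nu / 2 |w_xx|^2 + S |w_x|^2)] for the
   energies [F = |w|^2 + mu |w_x|^2 + mu / nu E1] and
   [G = |w_x|^2 + mu |w_xx|^2 + E2 / nu]. The first bounds the integral of
   [e^(2 alpha s) |w_x|^2], hence the source term of the second; [S] is finite
   because [w] is bounded uniformly in time, and [F 0] is controlled by the initial
   data of [G] through Poincare's inequality with boundary terms.
   The norms are only known to be evolutions in the weak sense: testing the weak
   time derivative on intervals in [x] gives [u(t) = u(0) + int_0^t u_t] for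
   [u = w, w_x, w_xx] and for the boundary values, so the energies are
   absolutely continuous in time. *)

(** The feedback laws turn boundary terms into exact rates: differentiated in time, they make the
    [w_xt w] terms the rate of [mu / nu E1]; as they stand, they make the [w_t w_x] terms the rate
    of [E2 / nu]. The first multiplier still leaves the boundary dissipation [- E1], which pays for
    [2 alpha F]. The second leaves none, so [2 alpha E2 / nu] is bounded by squared traces of [w_x],
    at the cost of a little [|w_xx|^2] and a multiple of [|w_x|^2]. As the integral of this source
    is already bounded, no Gronwall argument occurs: the factor [e^C] serves only as a number at
    least 1, and [beta] is absorbed into [C] by comparison with [nu / 2]. [C] depends on the
    solution, through its uniform bound, but not on [t]. The obstacle is that the identities in time
    hold outside null sets of [x] that depend on [t], while the boundary terms are point values.
    Calculus in time is therefore done on scalar functions given by integral formulas, and traces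
    are rewritten as integrals over []0, 1[]. *)

Local Notation itg mu D f := (mu.-integrable D (EFin \o f)).

(** * Integrability of real-valued functions *)

Section real_integrable.
Context d (T : measurableType d) (R : realType).
Variable mu : {measure set T -> \bar R}.
Implicit Types (D : set T) (f g : T -> R).

Lemma itg_measurable D f : itg mu D f -> measurable_fun D f.
Proof. by move=> /measurable_int /measurable_EFinP. Qed.

Lemma itg_eq D f g : measurable D -> (forall x, D x -> f x = g x) ->
  itg mu D f -> itg mu D g.
Proof.
move=> mD fg; apply: eq_integrable => // x /set_mem Dx /=.
by rewrite fg.
Qed.

Lemma itgD D f g : measurable D -> itg mu D f -> itg mu D g ->
  itg mu D (fun x => f x + g x).
Proof. by move=> mD itf ig; have := integrableD mD itf ig. Qed.

Lemma itgB D f g : measurable D -> itg mu D f -> itg mu D g ->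
  itg mu D (fun x => f x - g x).
Proof. by move=> mD itf ig; have := integrableB mD itf ig. Qed.

Lemma itgZ D k f : measurable D -> itg mu D f -> itg mu D (fun x => k * f x).
Proof. by move=> mD itf; have := integrableZl mD k itf. Qed.

Lemma itgZr D k f : measurable D -> itg mu D f -> itg mu D (fun x => f x * k).
Proof. by move=> mD itf; have := integrableZr mD k itf. Qed.

Lemma itg_le D f g : measurable D -> measurable_fun D f ->
  (forall x, D x -> `|f x| <= g x) -> itg mu D g -> itg mu D f.
Proof.
move=> mD mf fg; apply: le_integrable => //; first exact/measurable_EFinP.
by move=> x Dx; rewrite /= lee_fin (le_trans (fg _ Dx))// ler_norm.
Qed.

Lemma itg_norm D f : measurable D -> itg mu D f -> itg mu D (fun x => `|f x|).
Proof. by move=> mD /integrable_norm. Qed.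

Lemma itgM_bounded D f g (M : R) : measurable D -> measurable_fun D g ->
  (forall x, D x -> `|g x| <= M) -> itg mu D f ->
  itg mu D (fun x => f x * g x).
Proof.
move=> mD mg gM itf.
apply: (itg_le mD (g := fun x => M * `|f x|)) => //.
- by apply: measurable_funM => //; exact: itg_measurable.
- by move=> x Dx; rewrite normrM mulrC ler_wpM2r// gM.
- by apply: itgZ => //; exact: itg_norm.
Qed.

Lemma itg_if D (P : T -> bool) f : measurable D -> measurable_fun setT P ->
  itg mu D f -> itg mu D (fun x => if P x then f x else 0).
Proof.
move=> mD mP itf.
have := @itgM_bounded D f (fun x => if P x then 1 else 0) 1 mD.
move=> /(_ _ _ itf) h; apply: (itg_eq mD _ (h _ _)).
- by move=> x _; case: (P x); rewrite ?mulr1 ?mulr0.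
- by apply: measurable_funTS; exact: measurable_fun_ifT.
- by move=> x _; case: (P x); rewrite ?normr1 ?normr0.
Qed.

Lemma itgM_sq D f g : measurable D ->
  measurable_fun D f -> measurable_fun D g ->
  itg mu D (fun x => f x ^+ 2) -> itg mu D (fun x => g x ^+ 2) ->
  itg mu D (fun x => f x * g x).
Proof.
move=> mD mf mg f2 g2.
apply: (itg_le mD (g := fun x => f x ^+ 2 + g x ^+ 2)).
- exact: measurable_funM.
- move=> x _; rewrite normrM -(real_normK (num_real (f x))).
  rewrite -(real_normK (num_real (g x))).
  by have := sqr_ge0 (`|f x| - `|g x|); nra.
- exact: itgD.
Qed.

Lemma itgD_sq D f g : measurable D ->
  measurable_fun D f -> measurable_fun D g ->
  itg mu D (fun x => f x ^+ 2) -> itg mu D (fun x => g x ^+ 2) ->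
  itg mu D (fun x => (f x + g x) ^+ 2).
Proof.
move=> mD mf mg f2 g2.
have fg := itgM_sq mD mf mg f2 g2.
have := itgD mD (itgD mD f2 g2) (itgZ 2 mD fg).
by apply: itg_eq => // x _; ring.
Qed.

Lemma itg_sq D f : measurable D -> (mu D < +oo)%E -> measurable_fun D f ->
  itg mu D (fun x => f x ^+ 2) -> itg mu D f.
Proof.
move=> mD Doo mf f2.
have i1 : itg mu D (cst 1).
  apply: measurable_bounded_integrable => //.
  by exists 1; split => // M M1 x _ /=; rewrite normr1 ltW.
apply: (itg_le mD (g := fun x => 1 + f x ^+ 2)) => //.
  move=> x _; rewrite -(real_normK (num_real (f x))).
  by have := sqr_ge0 (`|f x| - 2^-1); have := normr_ge0 (f x); nra.
exact: itgD.
Qed.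

(** Measurability of [f] is assumed separately because [mu] may fail to be complete, and then it
    does not pass across an almost everywhere equality. *)
Lemma itg_ae D f g : measurable D -> measurable_fun D f ->
  {ae mu, forall x, D x -> f x = g x} -> itg mu D g -> itg mu D f.
Proof.
move=> mD mf fg ig; have mg := itg_measurable ig.
apply/integrableP; split; first exact/measurable_EFinP.
have /integrableP[_] := ig; apply: le_lt_trans.
rewrite (@ge0_ae_eq_integral _ _ _ _ _ _ (fun x => `|(EFin \o g) x|%E))//.
- by apply/measurable_EFinP; exact: measurableT_comp.
- by apply/measurable_EFinP; exact: measurableT_comp.
- by apply: filterS fg; move=> x /= + Dx => ->.
Qed.

Lemma eq_Rint_ae D f g : measurable D -> measurable_fun D f ->
  measurable_fun D g ->
  {ae mu, forall x, D x -> f x = g x} ->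
  \int[mu]_(x in D) f x = \int[mu]_(x in D) g x.
Proof.
move=> mD mf mg fg; rewrite /Rintegral; congr fine.
apply: ae_eq_integral => //; [exact/measurable_EFinP|exact/measurable_EFinP|].
by apply: filterS fg; move=> x /= + Dx => ->.
Qed.

Lemma Rint_ae0 D f : measurable D -> measurable_fun D f ->
  {ae mu, forall x, D x -> f x = 0} -> \int[mu]_(x in D) f x = 0.
Proof.
move=> mD mf f0; rewrite (@eq_Rint_ae _ _ (cst 0))// /Rintegral.
by rewrite integral0.
Qed.

(** The comparison goes through [max f g], which dominates [f] everywhere and equals [g] almost
    everywhere. *)
Lemma le_Rint_ae D f g : measurable D -> itg mu D f -> itg mu D g ->
  {ae mu, forall x, D x -> f x <= g x} ->
  \int[mu]_(x in D) f x <= \int[mu]_(x in D) g x.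
Proof.
move=> mD itf ig fg.
have mf := itg_measurable itf; have mg := itg_measurable ig.
have im : itg mu D (fun x => Num.max (f x) (g x)).
  apply: (itg_ae mD _ _ ig); first exact: measurable_maxr.
  by apply: filterS fg; move=> x /= + Dx => /(_ Dx) /max_idPr.
apply: (@le_trans _ _ (\int[mu]_(x in D) (Num.max (f x) (g x)))).
  by apply: le_Rintegral => // x _; rewrite le_max lexx.
rewrite le_eqVlt; apply/orP; left; apply/eqP.
apply: eq_Rint_ae => //; first exact: measurable_maxr.
by apply: filterS fg; move=> x /= + Dx => /(_ Dx) /max_idPr.
Qed.

Lemma Rint_eq D f g : (forall x, D x -> f x = g x) ->
  \int[mu]_(x in D) f x = \int[mu]_(x in D) g x.
Proof. by move=> fg; apply: eq_Rintegral => x /set_mem; exact: fg. Qed.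

Lemma fin_Rint D f : measurable D -> itg mu D f ->
  (\int[mu]_(x in D) f x)%:E = (\int[mu]_(x in D) (f x)%:E)%E.
Proof. by move=> mD itf; rewrite /Rintegral fineK// integrable_fin_num. Qed.

Lemma ge0_itg D f : measurable D -> measurable_fun D f ->
  (forall x, D x -> 0 <= f x) -> (\int[mu]_(x in D) (f x)%:E < +oo)%E ->
  itg mu D f.
Proof.
move=> mD mf f0 foo; apply/integrableP; split; first exact/measurable_EFinP.
apply: le_lt_trans foo; apply: ge0_le_integral => //.
- by apply/measurable_EFinP; exact: measurableT_comp.
- exact/measurable_EFinP.
- by move=> x Dx; rewrite /= lee_fin ger0_norm// f0.
Qed.

Lemma itg_restrict D f : measurable D -> itg mu D f <-> itg mu setT (f \_ D).
Proof. by move=> mD; rewrite integrable_mkcond// restrict_EFin. Qed.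

End real_integrable.

(** * Fubini and Tonelli on rectangles *)

Section fubini_rect.
Context d1 d2 (T1 : measurableType d1) (T2 : measurableType d2) (R : realType).
Variable m1 : {sigma_finite_measure set T1 -> \bar R}.
Variable m2 : {sigma_finite_measure set T2 -> \bar R}.

(** Tonelli applies to the positive and the negative part separately, so no integrability of [g] is
    assumed; this allows the use of partial integrals before integrability is established. *)
Lemma measurable_fun_fubini_F (g : T1 * T2 -> \bar R) :
  measurable_fun setT g -> measurable_fun setT (fubini_F m2 g).
Proof.
move=> mg.
rewrite (_ : fubini_F m2 g = (fun x => \int[m2]_y g^\+ (x, y)) \-
  (fun x => \int[m2]_y g^\- (x, y)))%E; last first.
  apply/funext => x; rewrite [LHS]integralE.
  under eq_integral do rewrite funepos_comp/=.
  by under [X in (_ - X = _)%E]eq_integral do rewrite funeneg_comp/=.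
apply: emeasurable_funB.
- apply: measurable_fun_fubini_tonelli_F => //; exact: measurable_funepos.
- apply: measurable_fun_fubini_tonelli_F => //; exact: measurable_funeneg.
Qed.

Lemma measurable_Rint (f : T1 * T2 -> R) : measurable_fun setT f ->
  measurable_fun setT (fun x => \int[m2]_y f (x, y)).
Proof.
move=> /measurable_EFinP /measurable_fun_fubini_F mf.
by apply: measurableT_comp mf; exact: fine_measurable.
Qed.

Variables (A : set T1) (B : set T2).
Hypotheses (mA : measurable A) (mB : measurable B).
Variable u : T1 -> T2 -> R.

(** Extension by zero, which reduces a rectangle to the whole product space. *)
Let U := (fun p => u p.1 p.2) \_ (A `*` B).

Let mAB : measurable (A `*` B).
Proof. exact: measurableX. Qed.

Let UA x : A x -> (fun y => U (x, y)) = (u x) \_ B.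
Proof.
move=> Ax; apply/funext => y.
by rewrite /U !patchE in_setX /= mem_set.
Qed.

Let UNA x : ~ A x -> (fun y => U (x, y)) = cst 0.
Proof.
move=> Ax; apply/funext => y.
by rewrite /U !patchE in_setX /= memNset.
Qed.

Lemma Rint_patch_rect : (fun x => \int[m2]_y U (x, y)) =
  (fun x => \int[m2]_(y in B) u x y) \_ A.
Proof.
apply/funext => x; rewrite patchE; case: ifPn => [/set_mem Ax|/negP xA].
  by rewrite [RHS]Rintegral_mkcond -(UA Ax).
rewrite (UNA (fun Ax => xA (mem_set Ax))) /cst /Rintegral integral0//.
Qed.

Lemma measurable_Rint_rect :
  measurable_fun (A `*` B) (fun p => u p.1 p.2) ->
  measurable_fun A (fun x => \int[m2]_(y in B) u x y).
Proof.
move=> /(measurable_restrictT _ mAB).1 mU.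
apply/(measurable_restrictT _ mA); rewrite -Rint_patch_rect.
exact: measurable_Rint.
Qed.

Lemma measurable_int_rect :
  measurable_fun (A `*` B) (fun p => u p.1 p.2) ->
  measurable_fun A (fun x => \int[m2]_(y in B) (u x y)%:E)%E.
Proof.
move=> /(measurable_restrictT _ mAB).1 mU.
have mF := measurable_fun_fubini_F ((measurable_EFinP _ _).2 mU).
apply: eq_measurable_fun (measurable_funTS mF) => x /set_mem Ax.
rewrite [RHS]integral_mkcond /fubini_F; apply: eq_integral => y _ /=.
rewrite -/U; have /(congr1 (fun f => f y)) /= -> := UA Ax.
by rewrite !patchE; case: ifPn.
Qed.

(** Tonelli. It is the way from bounds on the spatial norm at each time to integrability in
    space-time. *)
Lemma itg_rectP : measurable_fun (A `*` B) (fun p => u p.1 p.2) ->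
  itg (m1 \x m2)%E (A `*` B) (fun p => u p.1 p.2) <->
  (\int[m1]_(x in A) \int[m2]_(y in B) `|u x y|%:E < +oo)%E.
Proof.
move=> mu.
have mU : measurable_fun setT U by exact/(measurable_restrictT _ mAB).
rewrite itg_restrict// integrable12ltyP; last exact/measurable_EFinP.
rewrite [X in _ <-> (X < _)%E]integral_mkcond.
rewrite (_ : (fun x => \int[m2]_y `|(EFin \o U) (x, y)|)%E =
  (fun x => \int[m2]_(y in B) `|u x y|%:E)%E \_ A)//.
apply/funext => x; rewrite patchE; case: ifPn => [/set_mem Ax|/negP xA].
  rewrite [RHS]integral_mkcond; apply: eq_integral => y _ /=.
  have /(congr1 (fun f => f y)) /= -> := UA Ax.
  by rewrite !patchE; case: ifPn => //; rewrite normr0.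
apply: integral0_eq => y _ /=.
have /(congr1 (fun f => f y)) /= -> := UNA (fun Ax => xA (mem_set Ax)).
by rewrite normr0.
Qed.

Hypothesis iu : itg (m1 \x m2)%E (A `*` B) (fun p => u p.1 p.2).

Let iUT : itg (m1 \x m2)%E setT U.
Proof. exact/(itg_restrict _ _ mAB). Qed.

Lemma ae_itg_section : {ae m1, forall x, A x -> itg m2 B (u x)}.
Proof.
have := ae_integrable1 iUT; apply: filterS => x /= + Ax.
by move=> h; apply/itg_restrict => //; rewrite -(UA Ax).
Qed.

Lemma itg_Rint_rect : itg m1 A (fun x => \int[m2]_(y in B) u x y).
Proof.
have mF : measurable_fun A (fun x => \int[m2]_(y in B) u x y).
  apply: measurable_Rint_rect.
  exact: itg_measurable iu.
apply/itg_restrict => //.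
rewrite -Rint_patch_rect; have h := integrable_fubini_F iUT.
apply/integrableP; split.
  apply/measurable_EFinP; apply: measurable_Rint.
  exact: itg_measurable iUT.
case/integrableP : h => mG; apply: le_lt_trans.
apply: ge0_le_integral => //.
- apply/measurable_EFinP; apply: measurableT_comp => //.
  by apply: measurable_Rint; exact: itg_measurable iUT.
- by apply: measurableT_comp.
(* Where the inner integral is infinite, [Rintegral] takes the value 0, so the bound by the extended
   integral persists. *)
- move=> x _; rewrite /fubini_F /= /Rintegral.
  by case: (\int[m2]_y (U (x, y))%:E)%E => //= *; rewrite normr0 ?leey.
Qed.

End fubini_rect.

Section fubini_swap.
Context d1 d2 (T1 : measurableType d1) (T2 : measurableType d2) (R : realType).
Variable m1 : {sigma_finite_measure set T1 -> \bar R}.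
Variable m2 : {sigma_finite_measure set T2 -> \bar R}.
Variables (A : set T1) (B : set T2).
Hypotheses (mA : measurable A) (mB : measurable B).
Variable u : T1 -> T2 -> R.

Lemma measurable_swap_rect : measurable_fun (A `*` B) (fun p => u p.1 p.2) ->
  measurable_fun (B `*` A) (fun p => u p.2 p.1).
Proof.
move=> mu.
apply: (measurable_comp (F := A `*` B) (f := fun p => u p.1 p.2) (g := (fun p => (p.2, p.1)))).
- exact: measurableX.
- by move=> _ /= [[x y] [? ?] <-].
- by [].
- by apply: measurable_funTS; exact: measurable_swap.
Qed.

Hypothesis iu : itg (m1 \x m2)%E (A `*` B) (fun p => u p.1 p.2).

Lemma itg_swap_rect : itg (m2 \x m1)%E (B `*` A) (fun p => u p.2 p.1).
Proof.
have mu := itg_measurable iu.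
apply/(itg_rectP _ _ _ _ (u := fun y x => u x y)) => //.
  exact: measurable_swap_rect.
have /(itg_restrict _ _ (measurableX mA mB)).1 h := iu.
have mU := itg_measurable h.
have /(integrable21ltyP _ _ ((measurable_EFinP _ _).2 mU)).1 := h.
apply: le_lt_trans; rewrite le_eqVlt; apply/orP; left; apply/eqP; symmetry.
rewrite [RHS]integral_mkcond; apply: eq_integral => y _.
rewrite patchE; case: ifPn => [/set_mem By|/negP yB].
  rewrite [RHS]integral_mkcond; apply: eq_integral => x _ /=.
  rewrite !patchE in_setX /= (mem_set By) andbT.
  by case: ifPn => // _; rewrite normr0.
apply: integral0_eq => x _ /=.
rewrite !patchE in_setX /= [y \in B]memNset ?andbF ?normr0// => By.
exact/yB/mem_set.
Qed.

End fubini_swap.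

Section Rfubini.
Context d1 d2 (T1 : measurableType d1) (T2 : measurableType d2) (R : realType).
Variable m1 : {sigma_finite_measure set T1 -> \bar R}.
Variable m2 : {sigma_finite_measure set T2 -> \bar R}.
Variables (A : set T1) (B : set T2).
Hypotheses (mA : measurable A) (mB : measurable B).

Let RfubiniT (f : T1 * T2 -> R) : itg (m1 \x m2)%E setT f ->
  \int[m1]_x \int[m2]_y f (x, y) = \int[m2]_y \int[m1]_x f (x, y).
Proof.
move=> itf; have mf := itg_measurable itf.
have msf : measurable_fun setT (f \o (fun p => (p.2, p.1))).
  by apply: measurableT_comp => //; exact: measurable_swap.
have : (\int[m1]_x \int[m2]_y (f (x, y))%:E)%E =
  (\int[m2]_y \int[m1]_x (f (x, y))%:E)%E by exact: Fubini itf.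
move=> /(congr1 fine); congr (_ = _).
(* The real and the extended inner integrals agree wherever the section is integrable, hence almost
   everywhere. *)
- rewrite /Rintegral; congr fine; apply: ae_eq_integral => //.
  + exact: measurable_fubini_F itf.
  + by apply/measurable_EFinP; exact: measurable_Rint.
  + have := ae_integrable1 itf; apply: filterS => x /= h _.
    by rewrite fineK// integrable_fin_num.
- have mG : measurable_fun setT (fun y => \int[m1]_x f (x, y)).
    by have := @measurable_Rint _ _ _ _ _ m1 _ msf.
  rewrite /Rintegral; congr fine; apply: ae_eq_integral => //.
  + exact: measurable_fubini_G itf.
  + exact/measurable_EFinP.
  + have := ae_integrable2 itf; apply: filterS => x /= h _.
    by rewrite fineK// integrable_fin_num.
Qed.

Lemma Rfubini (u : T1 -> T2 -> R) :
  itg (m1 \x m2)%E (A `*` B) (fun p => u p.1 p.2) ->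
  \int[m1]_(x in A) \int[m2]_(y in B) u x y =
  \int[m2]_(y in B) \int[m1]_(x in A) u x y.
Proof.
move=> iu; rewrite [LHS]Rintegral_mkcond [RHS]Rintegral_mkcond.
rewrite -Rint_patch_rect -(Rint_patch_rect m1 B A (fun y x => u x y)).
rewrite RfubiniT; last exact/(itg_restrict _ _ (measurableX mA mB)).
congr (Rintegral _ _ _); apply/funext => y; congr (Rintegral _ _ _).
by apply/funext => x; rewrite !patchE !in_setX /= andbC.
Qed.
End Rfubini.

(** * Absolutely continuous functions of one variable *)

Section absolutely_continuous.
Context {R : realType}.
Local Notation leb := (@lebesgue_measure R).
Implicit Types (F G f g : R -> R) (T : R).

Lemma lebesgue_itvoo_lty (a b : R) : (leb `]a, b[%classic < +oo)%E.
Proof.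
apply: (@le_lt_trans _ _ (lebesgue_measure ([set` `]a, b[] : set R))) => //.
by rewrite lebesgue_measure_itv /=; case: ifPn => //= _; rewrite -EFinB ltry.
Qed.

Lemma itg_cst_itvoo (a b c : R) : itg leb `]a, b[ (cst c).
Proof.
apply: measurable_bounded_integrable => //; first exact: lebesgue_itvoo_lty.
exists `|c|; split; first exact: num_real.
by move=> M cM x _ /=; exact: ltW.
Qed.

(** Absolute continuity of [F] on [[0, T]] with density [f]. The integral formula is taken as the
    definition so that sums, products and comparisons need no pointwise derivative; [f] matters only
    up to null sets. *)
Definition primitive T F f : Prop := itg leb `]0, T[ f /\
  forall t, 0 <= t <= T -> F t = F 0 + \int[leb]_(x in `]0, t[) f x.

Lemma itg_itvoo_sub (a b c d : R) f : a <= c -> d <= b ->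
  itg leb `]a, b[ f -> itg leb `]c, d[ f.
Proof.
move=> ac db; apply: integrableS => //.
by apply: subset_itv; rewrite bnd_simp.
Qed.

Lemma itg_itvcc (a b : R) f : itg leb `]a, b[ f -> itg leb `[a, b] f.
Proof.
move=> itf; have [ab|ba] := ltP a b; last first.
  move: ba; rewrite le_eqVlt => /predU1P[->|ba].
    rewrite set_itv1; apply/integrableP; split.
      exact: measurable_fun_set1.
    by rewrite integral_set1.
  by rewrite set_itv_ge ?bnd_simp -?ltNge//; exact: integrable_set0.
have mf : measurable_fun `[a, b] (EFin \o f).
  apply/measurable_EFinP; exact: measurable_fun_itv_cc (itg_measurable itf).
apply/integrableP; split => //.
have /integrableP[_] := itf; apply: le_lt_trans.
rewrite le_eqVlt; apply/orP; left; apply/eqP.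
rewrite -integral_itv_bndo_bndc//; last first.
  apply: measurableT_comp => //; apply: measurable_funS mf => //.
  by apply: subset_itvl; rewrite bnd_simp.
rewrite -integral_itv_obnd_cbnd//; last first.
  apply: measurableT_comp => //; exact: measurable_int itf.
Qed.

Lemma Rint_itvcc (a b : R) f : itg leb `]a, b[ f ->
  \int[leb]_(x in `[a, b]) f x = \int[leb]_(x in `]a, b[) f x.
Proof.
move=> itf; have itc := itg_itvcc itf.
rewrite -Rintegral_itv_bndo_bndc; last first.
  apply: integrableS itc => //.
  by apply: subset_itvl; rewrite bnd_simp.
by rewrite -Rintegral_itv_obnd_cbnd.
Qed.

Lemma Rint_itvoo0 (a : R) f : \int[leb]_(x in `]a, a[) f x = 0.
Proof. by rewrite set_itvoo0 Rintegral_set0. Qed.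

Lemma Rint_itvoo_split (a s t : R) f : a <= s -> s <= t -> itg leb `]a, t[ f ->
  \int[leb]_(x in `]a, t[) f x =
  \int[leb]_(x in `]a, s[) f x + \int[leb]_(x in `]s, t[) f x.
Proof.
rewrite le_eqVlt => /predU1P[->|as_]; first by rewrite Rint_itvoo0 add0r.
rewrite le_eqVlt => /predU1P[->|st] itf; first by rewrite Rint_itvoo0 addr0.
rewrite -(@Rintegral_itvB _ f (BRight a) (BLeft t) s)// ?bnd_simp//; last exact: ltW.
rewrite (@Rintegral_itv_bndo_bndc _ _ s); first by rewrite addrC subrK.
by apply: itg_itvoo_sub itf => //; exact: ltW.
Qed.

Lemma primitive_sub T F f s t : 0 <= s -> s <= t -> t <= T ->
  primitive T F f -> F t - F s = \int[leb]_(x in `]s, t[) f x.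
Proof.
move=> s0 st tT [itf h].
rewrite (h t) ?(le_trans s0)// (h s) ?s0 ?(le_trans st)//.
rewrite (@Rint_itvoo_split 0 s t)//; first by ring.
exact: itg_itvoo_sub itf.
Qed.

Lemma primitive_continuous T F f : 0 <= T -> primitive T F f ->
  {within `[0, T], continuous F}.
Proof.
move=> T0 [itf h].
have c := parameterized_integral_continuous T0 (itg_itvcc itf).
have : {within `[0, T], continuous
   (fun t => F 0 + \int[leb]_(x in `[0, t]) f x)}.
  by move=> x; apply: cvgD; [exact: cvg_cst|exact: c].
apply: subspace_eq_continuous => x /set_mem /=.
rewrite in_itv /= => /andP[x0 xT].
change (F 0 + \int[leb]_(x1 in `[0, x]) f x1 = F x).
rewrite Rint_itvcc; last exact: itg_itvoo_sub itf.
by rewrite -h ?x0.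
Qed.

Lemma continuous_itvcc_bounded (a b : R) F : {within `[a, b], continuous F} ->
  exists2 M, 0 < M & forall t, a <= t <= b -> `|F t| <= M.
Proof.
move=> cF.
have /compact_bounded[M [_ hM]] := continuous_compact cF (@segment_compact R a b).
exists (`|M| + 1); first by rewrite ltr_wpDl.
move=> t tab; apply: (hM (`|M| + 1)) => /=.
  by rewrite (le_lt_trans (ler_norm _))// ltrDl.
by exists t => //=; rewrite in_itv.
Qed.

Lemma continuous_itvcc_measurable (a b : R) F :
  {within `[a, b], continuous F} -> measurable_fun `[a, b] F.
Proof. by move=> cF; exact: subspace_continuous_measurable_fun. Qed.

Lemma continuous_itvoo_measurable (a b : R) F :
  {within `[a, b], continuous F} -> measurable_fun `]a, b[ F.
Proof.
move=> /continuous_itvcc_measurable; apply: measurable_funS => //.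
exact: subset_itv_oo_cc.
Qed.

Lemma primitive_measurable T F f : primitive T F f -> measurable_fun `]0, T[ F.
Proof.
move=> pF; have [T0|T0] := leP 0 T.
  exact: continuous_itvoo_measurable (primitive_continuous T0 pF).
rewrite set_itv_ge ?bnd_simp -?leNgt ?ltW//; exact: measurable_fun_set0.
Qed.

Lemma primitive_bounded T F f : primitive T F f ->
  exists2 M, 0 < M & forall t, 0 <= t <= T -> `|F t| <= M.
Proof.
move=> pF; have [T0|T0] := leP 0 T.
  exact: continuous_itvcc_bounded (primitive_continuous T0 pF).
exists 1 => // t /andP[t0 tT].
by have := lt_le_trans T0 (le_trans t0 tT); rewrite ltxx.
Qed.

Lemma itgM_primitive T F f g : primitive T F f -> itg leb `]0, T[ g ->
  itg leb `]0, T[ (fun x => g x * F x).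
Proof.
move=> pF ig; have [M _ hM] := primitive_bounded pF.
apply: (itgM_bounded (M := M)) => //; first exact: primitive_measurable pF.
move=> x /=; rewrite in_itv /= => /andP[x0 xT].
by apply: hM; rewrite !ltW.
Qed.

Lemma primitive_itg T F f : primitive T F f -> itg leb `]0, T[ F.
Proof.
move=> pF; apply: (itg_eq _ _ (itgM_primitive (g := cst 1) pF _)) => //=.
  by move=> x _; rewrite mul1r.
exact: itg_cst_itvoo.
Qed.

Lemma primitive_eq T F G f g : primitive T F f ->
  (forall t, 0 <= t <= T -> G t = F t) ->
  (forall t, 0 < t < T -> g t = f t) -> primitive T G g.
Proof.
move=> [itf h] GF gf; split.
  by apply: itg_eq itf => // x /=; rewrite in_itv /= => /gf.
move=> t /[dup] tT /andP[t0 tT'].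
rewrite !GF ?lexx ?(le_trans t0)// h//; congr (_ + _).
apply: Rint_eq => x /=; rewrite in_itv /= => /andP[x0 xt].
by rewrite gf// x0 (lt_le_trans xt).
Qed.

Lemma primitiveD T F G f g : primitive T F f -> primitive T G g ->
  primitive T (fun x => F x + G x) (fun x => f x + g x).
Proof.
move=> [itf hf] [ig hg]; split; first exact: itgD.
move=> t /[dup] tT /andP[t0 tT']; rewrite hf// hg// RintegralD//.
- by ring.
- exact: itg_itvoo_sub itf.
- exact: itg_itvoo_sub ig.
Qed.

Lemma primitiveZ T k F f : primitive T F f ->
  primitive T (fun x => k * F x) (fun x => k * f x).
Proof.
move=> [itf hf]; split; first exact: itgZ.
move=> t /[dup] tT /andP[t0 tT']; rewrite hf// RintegralZl//.
- by ring.
- exact: itg_itvoo_sub itf.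
Qed.

Lemma continuous_itvcc_itg (a b : R) f : {within `[a, b], continuous f} ->
  itg leb `]a, b[ f.
Proof.
move=> cf; have : itg leb `[a, b] f; last apply: integrableS => //.
  by apply: continuous_compact_integrable => //; exact: segment_compact.
exact: subset_itv_oo_cc.
Qed.

Lemma Rint_derive F f (a b : R) : a <= b ->
  (forall x, is_derive x (1 : R) F (f x)) -> continuous f ->
  \int[leb]_(x in `]a, b[) f x = F b - F a.
Proof.
rewrite le_eqVlt => /predU1P[->|ab] dF cf; first by rewrite Rint_itvoo0 subrr.
have cF : continuous F.
  by move=> x; apply: differentiable_continuous; apply/derivable1_diffP.
rewrite -Rint_itvcc; last first.
  exact/continuous_itvcc_itg/continuous_subspaceT.
rewrite /Rintegral (@continuous_FTC2 _ f F)//.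
- exact: continuous_subspaceT.
- split.
  + by move=> x _.
  + exact/cvg_at_right_filter/cF.
  + exact/cvg_at_left_filter/cF.
- by move=> x _; rewrite derive1E; apply: derive_val.
Qed.

Lemma primitive_derive T F f :
  (forall x, is_derive x (1 : R) F (f x)) -> continuous f -> primitive T F f.
Proof.
move=> dF cf; split.
  exact/continuous_itvcc_itg/continuous_subspaceT.
by move=> t /andP[t0 _]; rewrite (@Rint_derive F)// addrC subrK.
Qed.

Lemma itg_prod (A B : set R) f g : measurable A -> measurable B ->
  itg leb A f -> itg leb B g ->
  itg (leb \x leb)%E (A `*` B) (fun p => f p.1 * g p.2).
Proof.
move=> mA mB itf ig.
have mf : measurable_fun (A `*` B) (fun p : R * R => f p.1).
  apply: (measurable_comp mA) (itg_measurable itf) _ => //.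
    by move=> _ /= [[x y] [? _] <-].
  by apply: measurable_funTS; exact: measurable_fst.
have mg : measurable_fun (A `*` B) (fun p : R * R => g p.2).
  apply: (measurable_comp mB) (itg_measurable ig) _ => //.
    by move=> _ /= [[x y] [_ ?] <-].
  by apply: measurable_funTS; exact: measurable_snd.
have [_ h] := @itg_rectP _ _ _ _ _ leb leb A B mA mB (fun x y => f x * g y)
  (measurable_funM mf mg).
apply: h.
have E x : (\int[leb]_(y in B) `|f x * g y|%:E =
    (`|f x| * \int[leb]_(y in B) `|g y|)%:E)%E.
  rewrite EFinM fin_Rint//; last exact: itg_norm.
  rewrite -integralZl//; last exact: itg_norm.
  by apply: eq_integral => y _; rewrite normrM EFinM.
under eq_integral do rewrite E.
apply: integrable_lty => //.
exact: (itgZr (mu := leb) (\int[leb]_(y in B) `|g y|) mA (itg_norm (mu := leb) mA itf)).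
Qed.

Lemma Rint_if_lt (t r : R) h : r <= t ->
  \int[leb]_(q in `]0, t[) (if q < r then h q else 0) =
  \int[leb]_(q in `]0, r[) h q.
Proof.
move=> rt.
rewrite (_ : `]0, r[%classic = `]0, t[ `&` `]-oo, r[); last first.
  apply/seteqP; split => x /=; rewrite !in_itv /=.
    by move=> /andP[-> xr]; rewrite xr (lt_le_trans xr).
  by move=> [/andP[-> _] ->].
rewrite Rintegral_mkcondr; apply: Rint_eq => x _.
rewrite patchE; case: ifPn => xr.
  by rewrite mem_set//= in_itv /=.
by rewrite memNset//= in_itv /=; exact/negP.
Qed.

Lemma Rint_if_gt (t q : R) h : 0 <= q ->
  \int[leb]_(r in `]0, t[) (if q < r then h r else 0) =
  \int[leb]_(r in `]q, t[) h r.
Proof.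
move=> rt.
rewrite (_ : `]q, t[%classic = `]0, t[ `&` `]q, +oo[); last first.
  apply/seteqP; split => x /=; rewrite !in_itv /= ?andbT.
    by move=> /andP[qx ->]; rewrite qx (le_lt_trans _ qx).
  by move=> [/andP[_ ->] ->].
rewrite Rintegral_mkcondr; apply: Rint_eq => x _.
rewrite patchE; case: ifPn => xr.
  by rewrite mem_set//= in_itv /= andbT.
by rewrite memNset//= in_itv /= andbT; exact/negP.
Qed.

(* Fubini on the triangle [q < r]. *)
Lemma Rint_product t f g : 0 <= t -> itg leb `]0, t[ f -> itg leb `]0, t[ g ->
  \int[leb]_(r in `]0, t[) (f r * \int[leb]_(q in `]0, r[) g q) +
  \int[leb]_(q in `]0, t[) (g q * \int[leb]_(r in `]0, q[) f r) =
  (\int[leb]_(r in `]0, t[) f r) * (\int[leb]_(q in `]0, t[) g q).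
Proof.
move=> t0 itf ig; set D := `]0, t[%classic.
pose k (r q : R) := if q < r then f r * g q else 0.
have mD : measurable D by exact: measurable_itv.
have ik : itg (leb \x leb)%E (D `*` D) (fun p => k p.1 p.2).
  have ifg := itg_prod mD mD itf ig.
  apply: (itg_le _ _ _ (itg_norm _ ifg)) => //.
  - exact: measurableX.
  - rewrite (_ : (fun p => _) = (fun p : R * R =>
        (if p.2 < p.1 then 1 else 0) * (f p.1 * g p.2))).
      apply: measurable_funM; last exact: itg_measurable ifg.
      apply: measurable_funTS; apply: measurable_fun_ifT => //.
      by apply: measurable_fun_ltr; [exact: measurable_snd|exact: measurable_fst].
    by apply/funext => -[r q]; rewrite /k /=; case: ifP; rewrite ?mul1r ?mul0r.
  - by move=> [r q] _; rewrite /k /=; case: ifP; rewrite ?normr0.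
  - exact: measurableX.
have := Rfubini (m1 := leb) (m2 := leb) mD mD ik.
have pf : primitive t (fun r => \int[leb]_(q in `]0, r[) f q) f.
  by split => // s _; rewrite Rint_itvoo0 add0r.
have pg : primitive t (fun r => \int[leb]_(q in `]0, r[) g q) g.
  by split => // s _; rewrite Rint_itvoo0 add0r.
rewrite (_ : \int[leb]_(x in D) \int[leb]_(y in D) k x y =
  \int[leb]_(r in D) (f r * \int[leb]_(q in `]0, r[) g q)); last first.
  apply: Rint_eq => r; rewrite /D /= in_itv /= => /andP[r0 rt].
  rewrite -(@Rint_if_lt t r g) ?(ltW rt)// -RintegralZl//; last first.
    by apply: itg_if => //; exact: measurable_fun_ltr.
  by apply: Rint_eq => q _; rewrite /k; case: ifP; rewrite ?mulr0.
rewrite (_ : \int[leb]_(y in D) \int[leb]_(x in D) k x y =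
  \int[leb]_(q in D) (g q * \int[leb]_(r in D) f r
    - g q * \int[leb]_(r in `]0, q[) f r)); last first.
  apply: Rint_eq => q; rewrite /D /= in_itv /= => /andP[q0 qt].
  rewrite -mulrBr (_ : _ - _ = \int[leb]_(r in `]q, t[) f r); last first.
    by rewrite (@Rint_itvoo_split 0 q t f (ltW q0) (ltW qt) itf) addrAC subrr add0r.
  rewrite -(@Rint_if_gt t q f) ?(ltW q0)// -RintegralZl//; last first.
    by apply: itg_if => //; exact: measurable_fun_ltr.
  by apply: Rint_eq => r _; rewrite /k; case: ifP; rewrite ?mulr0// mulrC.
rewrite RintegralB//; last 2 first.
- exact: itgZr.
- exact: itgM_primitive pf ig.
by move=> ->; rewrite RintegralZr// subrK mulrC.
Qed.

(** With each factor written as initial value plus integral, the product of the two integrals splits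
    over the two halves of the square, and these are the double integrals hidden in [f G + g F]. All
    energies below are differentiated through this rule. *)
Lemma primitiveM T F G f g : primitive T F f -> primitive T G g ->
  primitive T (fun x => F x * G x) (fun x => f x * G x + g x * F x).
Proof.
move=> pF pG; have [itf hf] := pF; have [ig hg] := pG.
split; first by apply: itgD => //; [exact: itgM_primitive pG itf|exact: itgM_primitive pF ig].
move=> t /[dup] tT /andP[t0 tT'].
have itf' : itg leb `]0, t[ f by exact: itg_itvoo_sub itf.
have ig' : itg leb `]0, t[ g by exact: itg_itvoo_sub ig.
have pf : primitive t (fun r => \int[leb]_(q in `]0, r[) f q) f.
  by split => // s _; rewrite Rint_itvoo0 add0r.
have pg : primitive t (fun r => \int[leb]_(q in `]0, r[) g q) g.
  by split => // s _; rewrite Rint_itvoo0 add0r.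
rewrite (hf t)// (hg t)// mulrDl !mulrDr -Rint_product//.
rewrite (_ : \int[leb]_(x in `]0, t[) (f x * G x + g x * F x) =
  \int[leb]_(x in `]0, t[) ((f x * G 0 + g x * F 0) +
    (f x * \int[leb]_(q in `]0, x[) g q + g x * \int[leb]_(q in `]0, x[) f q))).
  rewrite RintegralD//; last 2 first.
  - by apply: itgD => //; exact: itgZr.
  - by apply: itgD => //; [exact: itgM_primitive pg itf'|exact: itgM_primitive pf ig'].
  rewrite RintegralD//; [|exact: itgZr|exact: itgZr].
  rewrite RintegralD//; [|exact: itgM_primitive pg itf'|exact: itgM_primitive pf ig'].
  by rewrite !RintegralZr//; ring.
apply: Rint_eq => x /=; rewrite in_itv /= => /andP[x0 xt].
have xT : 0 <= x <= T by rewrite (ltW x0) (le_trans (ltW xt)).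
by rewrite (hf x)// (hg x)//; ring.
Qed.

Lemma primitiveX2 T F f : primitive T F f ->
  primitive T (fun x => F x ^+ 2) (fun x => 2 * f x * F x).
Proof.
by move=> pF; apply: (primitive_eq (primitiveM pF pF)) => x _; ring.
Qed.

End absolutely_continuous.

(** * Explicit test functions: smoothed indicators of intervals *)

Section bump.
Context {R : realType}.
Implicit Types (x y h : R).

(** A quadratic remainder reduces differentiability to a polynomial inequality: squares of positive
    parts satisfy it with [C = 1] after a case split on signs, affine functions with [C = 0]. *)
Lemma is_derive_quadratic (F : R -> R) (x df C : R) :
  (forall y, `|F y - F x - df * (y - x)| <= C * (y - x) ^+ 2) ->
  is_derive x (1 : R) F df.
Proof.
move=> hF.
have C0 : 0 <= C.
  by have := le_trans (normr_ge0 _) (hF (x + 1)); rewrite addrAC subrr add0r expr1n mulr1.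
have cv : h^-1 *: ((F \o shift x) (h *: (1 : R)) - F x) @[h --> 0^'] --> df.
  apply/cvgrPdist_le => e e0.
  near=> h.
  have h0 : h != 0 by near: h; exact: nbhs_dnbhs_neq.
  have := hF (h + x); rewrite addrK => hh.
  rewrite /= [h *: 1]mulr1.
  rewrite -(ler_pM2r (_ : 0 < `|h|)) ?normr_gt0//.
  rewrite -normrM mulrBl /GRing.scale /= mulrAC mulVf// mul1r distrC.
  apply: (le_trans hh); rewrite -(real_normK (num_real h)) expr2 mulrA.
  rewrite ler_wpM2r//.
  rewrite (@le_trans _ _ ((C + 1) * `|h|))// ?ler_wpM2r ?lerDl//.
  rewrite -ler_pdivlMl ?ltr_wpDl// mulrC.
  near: h; apply: dnbhs0_le; rewrite divr_gt0// ltr_wpDl//.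
apply: DeriveDef; last exact/cvg_lim.
by apply/cvg_ex; exists df.
Unshelve. all: by end_near. Qed.

Definition pos_part x : R := Num.max 0 x.

Lemma continuous_pos_part : continuous pos_part.
Proof. by move=> x; apply: continuous_max; [exact: cvg_cst|exact: cvg_id]. Qed.

Lemma is_derive_pos_part2 (c x : R) :
  is_derive x (1 : R) (fun y => pos_part (y - c) ^+ 2) (2 * pos_part (x - c)).
Proof.
apply: (@is_derive_quadratic _ _ _ 1) => y; rewrite /pos_part ler_norml mul1r.
rewrite (_ : y - x = (y - c) - (x - c)); last by ring.
move: (y - c) (x - c) => a b.
have := sqr_ge0 (a - b); have := sqr_ge0 a; have := sqr_ge0 b.
by case: (ltP 0 a) => a0; case: (ltP 0 b) => b0; move=> *; apply/andP; split; nra.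
Qed.

(* A C^1 step from 0 (for [x <= 0]) to 1 (for [h <= x]) with a hat function as
   derivative. *)
Definition step h x : R :=
  2 / h ^+ 2 * (pos_part x ^+ 2 - 2 * pos_part (x - h / 2) ^+ 2
                + pos_part (x - h) ^+ 2).

(** A second difference of positive parts with nodes 0, [h / 2], [h]: the tent of height [2 / h],
    hence of integral 1. *)
Definition hat h x : R :=
  4 / h ^+ 2 * (pos_part x - 2 * pos_part (x - h / 2) + pos_part (x - h)).

Lemma continuous_hat h : continuous (hat h).
Proof.
have c (a : R) : continuous (fun x => pos_part (x - a)).
  move=> x; apply: (@continuous_comp _ _ _ (fun x => x - a) pos_part).
    by apply: cvgB; [exact: cvg_id|exact: cvg_cst].
  exact: continuous_pos_part.
move=> x; apply: cvgM; first exact: cvg_cst.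
apply: cvgD; last exact: c.
apply: cvgB; first exact: continuous_pos_part.
by apply: cvgM; [exact: cvg_cst|exact: c].
Qed.

Lemma is_derive_step h x : 0 < h -> is_derive x (1 : R) (step h) (hat h x).
Proof.
move=> h0.
have d0 : is_derive x (1 : R) (fun y => pos_part y ^+ 2) (2 * pos_part x).
  have := is_derive_pos_part2 0 x; rewrite subr0.
  by rewrite (_ : (fun y => _) = (fun y => pos_part y ^+ 2))//; apply/funext => y; rewrite subr0.
have d1 := is_derive_pos_part2 (h / 2) x.
have d2 := is_derive_pos_part2 h x.
have -> : step h = (2 / h ^+ 2) \*: ((fun y => pos_part y ^+ 2)
  - 2 \*: (fun y => pos_part (y - h / 2) ^+ 2) + (fun y => pos_part (y - h) ^+ 2)).
  by [].
apply: is_derive_eq; rewrite /hat /GRing.scale /=.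
by field; rewrite gt_eqF.
Qed.

Lemma hat_ge0 h x : 0 < h -> 0 <= hat h x.
Proof.
move=> h0; apply: mulr_ge0; first by rewrite divr_ge0// exprn_ge0// ltW.
rewrite /pos_part.
by case: (ltP 0 x) => ?; case: (ltP 0 (x - h / 2)) => ?; case: (ltP 0 (x - h)) => ?; lra.
Qed.

Lemma hat_le0 h x : 0 < h -> x <= 0 -> hat h x = 0.
Proof.
move=> h0 x0; rewrite /hat /pos_part.
by rewrite !(max_idPl _); [ring|lra|lra|lra].
Qed.

Lemma hat_ge h x : 0 < h -> h <= x -> hat h x = 0.
Proof.
move=> h0 x0; rewrite /hat /pos_part.
by rewrite !(max_idPr _); [field; rewrite gt_eqF|lra|lra|lra].
Qed.

Lemma step_le0 h x : 0 < h -> x <= 0 -> step h x = 0.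
Proof.
move=> h0 x0; rewrite /step /pos_part.
by rewrite !(max_idPl _); [ring|lra|lra|lra].
Qed.

Lemma step_ge h x : 0 < h -> h <= x -> step h x = 1.
Proof.
move=> h0 x0; rewrite /step /pos_part.
by rewrite !(max_idPr _); [field; rewrite gt_eqF|lra|lra|lra].
Qed.

Lemma step_itv h x : 0 < h -> 0 <= step h x <= 1.
Proof.
move=> h0; have h2 : 0 < h ^+ 2 by rewrite exprn_gt0.
have -> : step h x = (2 * (pos_part x ^+ 2 - 2 * pos_part (x - h / 2) ^+ 2
                + pos_part (x - h) ^+ 2)) / h ^+ 2.
  by rewrite /step; field; rewrite gt_eqF.
rewrite ler_pdivlMr// ler_pdivrMr// mul0r mul1r /pos_part.
by case: (ltP 0 x) => ?; case: (ltP 0 (x - h / 2)) => ?; case: (ltP 0 (x - h)) => ?; nra.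
Qed.

(** A C^1 cutoff equal to 1 on [[s + 2 h, t - 2 h]] and to 0 outside [[s + h, t - h]], a compact
    subset of []s, t[]. As a sum of two steps rather than a product, it has a difference of two hats
    as derivative. The condition [s + 4 * h <= t] used below keeps the two ramps apart. *)
Definition plateau h s t x : R := step h (x - s - h) + step h (t - h - x) - 1.

Definition plateau' h s t x : R := hat h (x - s - h) - hat h (t - h - x).

Lemma is_derive_step_left h s x : 0 < h ->
  is_derive x (1 : R) (fun x => step h (x - s - h)) (hat h (x - s - h)).
Proof.
move=> h0.
have d : is_derive x (1 : R) (fun x => x - s - h) 1.
  apply: (@is_derive_quadratic _ _ _ 0) => y; rewrite mul0r.
  by rewrite (_ : y - s - h - (x - s - h) - 1 * (y - x) = 0) ?normr0//; ring.
have := @is_derive1_comp _ (step h) _ x _ _ (is_derive_step (x - s - h) h0) d.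
by rewrite mulr1.
Qed.

Lemma is_derive_step_right h t x : 0 < h ->
  is_derive x (1 : R) (fun x => - step h (t - h - x)) (hat h (t - h - x)).
Proof.
move=> h0.
have d : is_derive x (1 : R) (fun x => t - h - x) (- 1).
  apply: (@is_derive_quadratic _ _ _ 0) => y; rewrite mul0r.
  by rewrite (_ : t - h - y - (t - h - x) - -1 * (y - x) = 0) ?normr0//; ring.
have := @is_derive1_comp _ (step h) _ x _ _ (is_derive_step (t - h - x) h0) d.
by move=> /is_deriveN; rewrite mulrN1 opprK.
Qed.

Lemma is_derive_plateau h s t x : 0 < h ->
  is_derive x (1 : R) (plateau h s t) (plateau' h s t x).
Proof.
move=> h0.
have d1 := is_derive_step_left s x h0.
have d2 := is_derive_step_right t x h0.
have -> : plateau h s t = (fun x => step h (x - s - h)) -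
  (fun x => - step h (t - h - x)) + cst (- 1).
  by apply/funext => y; rewrite /plateau !fctE /cst opprK.
by have := is_deriveD (is_deriveB d1 d2) (is_derive_cst (- 1 : R) x (1 : R)); rewrite addr0.
Qed.

Lemma continuous_plateau' h s t : continuous (plateau' h s t).
Proof.
move=> x; apply: cvgB.
- apply: (@continuous_comp _ _ _ (fun x => x - s - h) (hat h)).
    by do 2 (apply: cvgB; last exact: cvg_cst); exact: cvg_id.
  exact: continuous_hat.
- apply: (@continuous_comp _ _ _ (fun x => t - h - x) (hat h)).
    by apply: cvgB; [exact: cvg_cst|exact: cvg_id].
  exact: continuous_hat.
Qed.

Lemma derive1_plateau h s t : 0 < h ->
  derive1 (plateau h s t) = plateau' h s t.
Proof.
move=> h0; apply/funext => x; rewrite derive1E.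
by have d := is_derive_plateau s t x h0; exact: derive_val.
Qed.

Lemma plateau_bounded h s t x : 0 < h -> `|plateau h s t x| <= 1.
Proof.
move=> h0; rewrite /plateau.
have := step_itv (x - s - h) h0; have := step_itv (t - h - x) h0.
by rewrite ler_norml; lra.
Qed.

Lemma plateau_out h s t x : 0 < h -> s + 4 * h <= t ->
  x \notin `[s + h, t - h] -> plateau h s t x = 0.
Proof.
move=> h0 st; rewrite in_itv /= negb_and -!ltNge => /orP[xs|xt]; rewrite /plateau.
- by rewrite step_le0 ?step_ge//; lra.
- by rewrite step_ge ?(@step_le0 _ (t - h - x))//; lra.
Qed.

Lemma plateau'_out h s t x : 0 < h -> s + 4 * h <= t ->
  x \notin `]s, t[ -> plateau' h s t x = 0.
Proof.
move=> h0 st; rewrite in_itv /= negb_and -!leNgt => /orP[xs|xt]; rewrite /plateau'.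
- by rewrite hat_le0 ?hat_ge//; lra.
- by rewrite hat_ge ?(@hat_le0 _ (t - h - x))//; lra.
Qed.

Lemma plateau_in h s t x : 0 < h -> s + 2 * h <= x -> x <= t - 2 * h ->
  plateau h s t x = 1.
Proof. by move=> h0 xs xt; rewrite /plateau !step_ge//; lra. Qed.

Lemma test_fun_plateau (I : set R) h s t : 0 < h -> s + 4 * h <= t ->
  `]s, t[ `<=` I -> test_fun I (plateau h s t).
Proof.
move=> h0 st sI; split.
- by move=> x; have d := is_derive_plateau s t x h0.
- by rewrite derive1_plateau//; exact: continuous_plateau'.
- exists (s + h), (t - h); split; last by move=> x; exact: plateau_out.
  move=> x /=; rewrite in_itv /= => /andP[xs xt]; apply: sI => /=.
  by rewrite in_itv /=; apply/andP; split; lra.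
Qed.

End bump.

(** * From weak derivatives to integral formulas *)

Section weak_derivative.
Context {R : realType}.
Local Notation leb := (@lebesgue_measure R).
Implicit Types (f g : R -> R).

Lemma Rint_out (I D : set R) f : measurable I -> measurable D -> D `<=` I ->
  (forall x, ~ D x -> f x = 0) ->
  \int[leb]_(x in I) f x = \int[leb]_(x in D) f x.
Proof.
move=> mI mD DI f0; rewrite -(setIidr DI) Rintegral_mkcondr.
apply: Rint_eq => x _; rewrite patchE; case: ifPn => // /negP xD.
by rewrite f0// => Dx; apply/xD/mem_set.
Qed.

Lemma Rint_hat_left h s t : 0 < h -> s + 4 * h <= t ->
  \int[leb]_(x in `]s, t[) hat h (x - s - h) = 1.
Proof.
move=> h0 st.
have d x := is_derive_step_left s x h0.
rewrite (Rint_derive _ d).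
- by rewrite step_ge ?step_le0//; lra.
- by lra.
- move=> x; apply: (@continuous_comp _ _ _ (fun x => x - s - h) (hat h)).
    by do 2 (apply: cvgB; last exact: cvg_cst); exact: cvg_id.
  exact: continuous_hat.
Qed.

Lemma Rint_hat_right h s t : 0 < h -> s + 4 * h <= t ->
  \int[leb]_(x in `]s, t[) hat h (t - h - x) = 1.
Proof.
move=> h0 st.
have d x := is_derive_step_right t x h0.
rewrite (Rint_derive _ d).
- by rewrite step_le0 ?step_ge//; lra.
- by lra.
- move=> x; apply: (@continuous_comp _ _ _ (fun x => t - h - x) (hat h)).
    by apply: cvgB; [exact: cvg_cst|exact: cvg_id].
  exact: continuous_hat.
Qed.

Lemma itg_continuous_mul (s t : R) f (k : R -> R) :
  {within `[s, t], continuous f} -> continuous k ->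
  itg leb `]s, t[ (fun x => f x * k x).
Proof.
move=> cf ck; apply: continuous_itvcc_itg => x.
apply: cvgM; first exact: cf.
exact: (continuous_subspaceT ck).
Qed.

(** Used with [k] one of the two hats of [plateau']: as [h] shrinks they concentrate at the ends of
    the interval and pick out the end values of [f]. *)
Lemma averaging (s t c e : R) f (k : R -> R) :
  {within `[s, t], continuous f} -> continuous k -> (forall x, 0 <= k x) ->
  \int[leb]_(x in `]s, t[) k x = 1 ->
  (forall x, s < x < t -> k x != 0 -> `|f x - c| <= e) ->
  `|\int[leb]_(x in `]s, t[) (f x * k x) - c| <= e.
Proof.
move=> cf ck k0 k1 fc.
have ik : itg leb `]s, t[ k by exact/continuous_itvcc_itg/continuous_subspaceT.
have ifk := itg_continuous_mul cf ck.
rewrite -[c in X in X <= _]mulr1 -k1 -RintegralZl// -RintegralB//; last exact: itgZ.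
rewrite -[e]mulr1 -k1 -RintegralZl//.
have ifc : itg leb `]s, t[ (fun x => f x * k x - c * k x).
  by apply: itgB => //; exact: itgZ.
apply: (le_trans (le_normr_Rintegral _ ifc)) => //.
apply: le_Rintegral => //; [exact: itg_norm|exact: itgZ|].
move=> x; rewrite /= in_itv /= => xst.
rewrite -mulrBl normrM (ger0_norm (k0 x)).
by have [->|kx] := eqVneq (k x) 0; rewrite ?mulr0// ler_wpM2r// fc.
Qed.

(** Testing with plateaus whose ramps shrink: the hats in the derivative act as approximate
    identities at [s] and [t], where [f] is continuous, and dominated convergence removes the cutoff
    from [g]. The set [I] is arbitrary because the lemma serves both for [x] in []0, 1[] and for
    time in []0, +oo[]; [s] and [t] may be ends of [I]. *)
Lemma weak_derivative_primitive (I : set R) (s t : R) f g :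
  measurable I -> `]s, t[ `<=` I -> s < t ->
  {within `[s, t], continuous f} -> itg leb `]s, t[ g ->
  weak_derivative I f g -> f t - f s = \int[leb]_(x in `]s, t[) g x.
Proof.
move=> mI stI st cf ig wd.
have m_itv : measurable (`]s, t[ : set R) by [].
(* The divisor 4 leaves room for both ramps already at [n = 0]. *)
pose h n : R := (t - s) / 4 / n.+1%:R.
have h0 n : 0 < h n by rewrite divr_gt0// divr_gt0// subr_gt0.
have h4 n : s + 4 * h n <= t.
  rewrite -lerBrDl /h mulrA (mulrC 4) divfK// ler_pdivrMr//.
  by rewrite ler_peMr ?subr_ge0 ?(ltW st)// ler1n.
have hcv : h n @[n --> \oo] --> (0 : R).
  rewrite -[X in _ --> X](mulr0 ((t - s) / 4)); apply: cvgM.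
    exact: cvg_cst.
  exact: cvg_harmonic.
have wdn n : \int[leb]_(x in `]s, t[) (f x * plateau' (h n) s t x) =
    - \int[leb]_(x in `]s, t[) (g x * plateau (h n) s t x).
  have := wd _ (test_fun_plateau (h0 n) (h4 n) stI).
  rewrite derive1_plateau// (@Rint_out I `]s, t[)//; last first.
    move=> x /negP xst; rewrite plateau'_out ?mulr0//.
  rewrite (@Rint_out I `]s, t[)// => x /negP xst.
  rewrite plateau_out ?mulr0//; apply: contra xst => /=.
  by rewrite !in_itv /= => /andP[xs xt]; have := h0 n => hn; apply/andP; split; lra.
have cvf : \int[leb]_(x in `]s, t[) (f x * plateau' (h n) s t x)
    @[n --> \oo] --> f s - f t.
  have [_ fs ft] := (continuous_within_itvP f st).1 cf.
  apply/cvgrPdist_le => e e0.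
  have e2 : 0 < e / 2 by rewrite divr_gt0.
  move/cvgrPdist_le : fs => /(_ _ e2)[/= d1 d10 hs].
  move/cvgrPdist_le : ft => /(_ _ e2)[/= d2 d20 ht].
  near=> n.
  have hn0 := h0 n; have hn4 := h4 n.
  (* The hats live on [[s + h, s + 2 h]] and [[t - 2 h, t - h]], so this places them where [f] is
     within [e / 2] of its end values. *)
  have hd : 2 * h n < Num.min d1 d2.
    rewrite -ltr_pdivlMl// -[X in X < _]gtr0_norm// -normrN -sub0r.
    near: n; move/cvgrPdist_lt : hcv; apply.
    by rewrite mulr_gt0// lt_min d10.
  move: hd; rewrite lt_min => /andP[hd1 hd2].
  have c1 : continuous (fun x => hat (h n) (x - s - h n)).
    move=> x; apply: (@continuous_comp _ _ _ (fun x => x - s - h n) (hat (h n))).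
      by do 2 (apply: cvgB; last exact: cvg_cst); exact: cvg_id.
    exact: continuous_hat.
  have c2 : continuous (fun x => hat (h n) (t - h n - x)).
    move=> x; apply: (@continuous_comp _ _ _ (fun x => t - h n - x) (hat (h n))).
      by apply: cvgB; [exact: cvg_cst|exact: cvg_id].
    exact: continuous_hat.
  have a1 := @averaging s t (f s) (e / 2) f _ cf c1 (fun x => hat_ge0 _ hn0)
    (Rint_hat_left hn0 hn4).
  have a2 := @averaging s t (f t) (e / 2) f _ cf c2 (fun x => hat_ge0 _ hn0)
    (Rint_hat_right hn0 hn4).
  rewrite (_ : \int[leb]_(x in `]s, t[) (f x * plateau' (h n) s t x) =
    \int[leb]_(x in `]s, t[) (f x * hat (h n) (x - s - h n)) -
    \int[leb]_(x in `]s, t[) (f x * hat (h n) (t - h n - x))); last first.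
    rewrite -RintegralB//; [|exact: itg_continuous_mul|exact: itg_continuous_mul].
    by apply: Rint_eq => x _; rewrite /plateau' mulrBr.
  move: a1 a2; set A1 := Rintegral _ _ _; set A2 := Rintegral _ _ _ => a1 a2.
  rewrite (_ : f s - f t - (A1 - A2) = (A2 - f t) - (A1 - f s)); last by ring.
  apply: (le_trans (ler_normB _ _)); rewrite (splitr e) addrC lerD//.
    apply: a1 => x /andP[sx xt] kx; rewrite distrC; apply: hs => //=.
    rewrite ltr0_norm ?subr_lt0// opprB (le_lt_trans _ hd1)// lerBlDl.
    rewrite leNgt; apply/negP => xh; move/eqP : kx; apply.
    by rewrite hat_ge//; lra.
  apply: a2 => x /andP[sx xt] kx; rewrite distrC; apply: ht => //=.
  rewrite gtr0_norm ?subr_gt0// (le_lt_trans _ hd2)//.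
  rewrite leNgt; apply/negP => xh; move/eqP : kx; apply.
  by rewrite hat_ge//; lra.
have cvg : \int[leb]_(x in `]s, t[) (g x * plateau (h n) s t x)
    @[n --> \oo] --> \int[leb]_(x in `]s, t[) g x.
  have cp n : continuous (plateau (h n) s t).
    move=> x; apply: differentiable_continuous; apply/derivable1_diffP.
    by have d := is_derive_plateau s t x (h0 n).
  have mgp n : measurable_fun `]s, t[ (fun x => g x * plateau (h n) s t x).
    apply: measurable_funM; first exact: itg_measurable ig.
    by apply: continuous_itvoo_measurable; apply: continuous_subspaceT => x; exact: cp.
  have igp n : itg leb `]s, t[ (fun x => g x * plateau (h n) s t x).
    apply: (itgM_bounded (M := 1)) => //.
      by apply: continuous_itvoo_measurable; apply: continuous_subspaceT => x; exact: cp.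
    by move=> x _; exact: plateau_bounded.
  apply: fine_cvg; rewrite fineK ?integrable_fin_num//.
  have := @dominated_cvg _ _ _ leb _ m_itv
    (fun n x => (g x * plateau (h n) s t x)%:E) (EFin \o g) (fun x => `|g x|%:E).
  apply => //.
  - by move=> n; exact: (measurable_int leb (igp n)).
  - move=> x; rewrite /= in_itv /= => /andP[sx xt].
    apply: cvg_near_cst; near=> n.
    have hd : 2 * h n < Num.min (x - s) (t - x).
      rewrite -ltr_pdivlMl// -[X in X < _]gtr0_norm// -normrN -sub0r.
      near: n; move/cvgrPdist_lt : hcv; apply.
      by rewrite mulr_gt0// lt_min !subr_gt0 sx.
    move: hd; rewrite lt_min => /andP[hd1 hd2].
    by rewrite plateau_in ?mulr1//; lra.
  - exact: itg_norm.
  - move=> n x _; rewrite /= lee_fin normrM ler_piMr// plateau_bounded//.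
have : f s - f t = - \int[leb]_(x in `]s, t[) g x.
  have e : (fun n => \int[leb]_(x in `]s, t[) (f x * plateau' (h n) s t x)) =
    (fun n => - \int[leb]_(x in `]s, t[) (g x * plateau (h n) s t x)).
    exact/funext.
  rewrite e in cvf.
  by apply: (cvg_unique _ cvf (cvgN cvg)).
by lra.
Unshelve. all: by end_near. Qed.

(** Lebesgue differentiation: the indefinite integral of the zero extension of [h] is constant
    inside []a, b[], so its derivative there is 0, and it equals [h] almost everywhere. *)
Lemma ae0_Rint_itv (a b : R) h : itg leb `]a, b[ h ->
  (forall s t, a < s -> s < t -> t < b -> \int[leb]_(x in `]s, t[) h x = 0) ->
  {ae leb, forall x, `]a, b[%classic x -> h x = 0}.
Proof.
move=> ih h0; set D := `]a, b[%classic.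
pose H := h \_ D.
have mD : measurable D by exact: measurable_itv.
have iH : itg leb setT H by exact: ((itg_restrict leb h mD).1 ih).
have iHy (y : R) : itg leb `]-oo, y] H by exact: integrableS iH.
have := FTC1Ny iHy (integrable_locally mD ih).
apply: filterS; first exact: (ae_filter_ringOfSetsType leb).
move=> x /= + Dx => -[dF].
rewrite {2}/H patchE mem_set// => <-.
rewrite derive1E (@near_eq_derive _ _ _ _ (cst (\int[leb]_(t in `]-oo, x]) H t))).
  exact: derive_cst.
move: Dx; rewrite /D /= in_itv /= => /andP[ax xb].
near=> y.
have ay : a < y by near: y; exact: lt_nbhsr.
have yb : y < b by near: y; exact: lt_nbhsl.
have key u v : a < u -> u < v -> v < b ->
    \int[leb]_(t in `]-oo, v]) H t = \int[leb]_(t in `]-oo, u]) H t.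
  move=> au uv vb; apply/eqP; rewrite -subr_eq0; apply/eqP.
  rewrite Rintegral_itvB// ?bnd_simp// ?(ltW uv)//.
  rewrite -Rintegral_itv_bndo_bndc; last exact: integrableS iH.
  rewrite -(h0 u v au uv vb); apply: Rint_eq => z /=; rewrite in_itv /= => /andP[uz zv].
  rewrite /H patchE mem_set// /D /= in_itv /= (lt_trans au uz) (lt_trans zv vb)//.
rewrite /cst; have [xy|yx|->//] := ltgtP x y; first exact: key.
by apply/esym/key.
Unshelve. all: by end_near. Qed.

End weak_derivative.

(** * Sobolev functions on the unit interval *)

Section unit_interval.
Context {R : realType}.
Local Notation leb := (@lebesgue_measure R).
Local Notation D01 := (`]0, 1[%classic : set R).
Implicit Types (f g v : R -> R).

Lemma measurable01 : measurable D01.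
Proof. exact: measurable_itv. Qed.
Hint Resolve measurable01 : core.

Lemma L2_measurable f : L2 f -> measurable_fun D01 f.
Proof. by case. Qed.

Lemma L2_itg_sq f : L2 f -> itg leb D01 (fun x => f x ^+ 2).
Proof.
move=> [mf f2]; apply: ge0_itg => //.
- exact: measurable_funX.
- by move=> x _; exact: sqr_ge0.
Qed.

Lemma L2_itg f : L2 f -> itg leb D01 f.
Proof.
move=> Lf; apply: itg_sq => //; last exact: L2_itg_sq.
- exact: lebesgue_itvoo_lty.
- exact: L2_measurable.
Qed.

Lemma L2_itgM f g : L2 f -> L2 g -> itg leb D01 (fun x => f x * g x).
Proof.
move=> Lf Lg; apply: itgM_sq => //; try exact: L2_itg_sq.
- exact: L2_measurable.
- exact: L2_measurable.
Qed.

Lemma L2norm_sq f : L2norm f ^+ 2 = \int[leb]_(x in D01) (f x ^+ 2).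
Proof. by rewrite /L2norm sqr_sqrtr// Rintegral_ge0// => x _; exact: sqr_ge0. Qed.

Lemma H1_L2 f f' : H1 f f' -> L2 f.
Proof. by case. Qed.

Lemma H1_L2' f f' : H1 f f' -> L2 f'.
Proof. by case. Qed.

(** Continuity on the closed interval, part of [H1], carries the integral formula up to the
    endpoints and so ties the traces to the weak derivative. *)
Lemma H1_primitive f f' : H1 f f' -> primitive 1 f f'.
Proof.
move=> [cf Lf Lf' wd]; have if' := L2_itg Lf'; split => // t /andP[t0 t1].
move: t0; rewrite le_eqVlt => /predU1P[<-|t0]; first by rewrite Rint_itvoo0 addr0.
apply/eqP; rewrite addrC -subr_eq; apply/eqP.
have sub : `]0, t[%classic `<=` D01.
  by move=> x /=; rewrite !in_itv /= => /andP[-> xt]; rewrite (lt_le_trans xt).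
apply: (weak_derivative_primitive measurable01) => //.
- apply: continuous_subspaceW cf => x /=; rewrite !in_itv /= => /andP[-> xt].
  exact: le_trans t1.
- exact: integrableS if'.
Qed.

Lemma H1_ae_unique f f' g' : H1 f f' -> H1 f g' ->
  {ae leb, forall x, D01 x -> f' x = g' x}.
Proof.
move=> Hf Hg.
have pf := H1_primitive Hf; have pg := H1_primitive Hg.
have [if' _] := pf; have [ig' _] := pg.
have : {ae leb, forall x, D01 x -> f' x - g' x = 0}.
  apply: ae0_Rint_itv; first exact: itgB.
  move=> s t s0 st t1; rewrite RintegralB//; last 2 first.
  - by apply: itg_itvoo_sub if'; exact: ltW.
  - by apply: itg_itvoo_sub ig'; exact: ltW.
  rewrite -(primitive_sub _ _ _ pf) ?(ltW s0) ?(ltW st) ?(ltW t1)//.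
  by rewrite -(primitive_sub _ _ _ pg) ?(ltW s0) ?(ltW st) ?(ltW t1)// subrr.
apply: filterS; first exact: (ae_filter_ringOfSetsType leb).
by move=> x /= + Dx => /(_ Dx)/eqP; rewrite subr_eq0 => /eqP.
Qed.

Lemma primitive1 f f' : primitive 1 f f' ->
  \int[leb]_(x in D01) f' x = f 1 - f 0.
Proof. by move=> pf; rewrite (primitive_sub _ _ _ pf). Qed.

Lemma Rint_parts f f' g g' : H1 f f' -> H1 g g' ->
  \int[leb]_(x in D01) (f x * g' x) =
  f 1 * g 1 - f 0 * g 0 - \int[leb]_(x in D01) (f' x * g x).
Proof.
move=> Hf Hg.
have := primitive1 (primitiveM (H1_primitive Hf) (H1_primitive Hg)).
rewrite RintegralD//.
- by move=> <-; rewrite addrAC subrr add0r; apply: Rint_eq => x _; rewrite mulrC.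
- exact: L2_itgM (H1_L2' Hf) (H1_L2 Hg).
- exact: L2_itgM (H1_L2' Hg) (H1_L2 Hf).
Qed.

Lemma primitive_affine T (a b : R) : primitive T (fun x => a * x + b) (cst a).
Proof.
apply: primitive_derive; last by move=> x; exact: cst_continuous.
move=> x; apply: (@is_derive_quadratic _ _ _ _ 0) => y.
by rewrite mul0r (_ : _ + _ - _ - _ = 0) ?normr0// /cst; ring.
Qed.

Lemma amgm (a b d : R) : 0 < d ->
  2 * (`|a| * `|b|) <= d * a ^+ 2 + d^-1 * b ^+ 2.
Proof.
move=> d0; have : 0 <= d^-1 * (d * `|a| - `|b|) ^+ 2.
  by rewrite mulr_ge0 ?sqr_ge0// invr_ge0 ltW.
rewrite (_ : d^-1 * (d * `|a| - `|b|) ^+ 2 = (d / d) * d * `|a| ^+ 2 -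
  (d / d) * (2 * (`|a| * `|b|)) + d^-1 * `|b| ^+ 2); last by ring.
by rewrite divff ?gt_eqF// !real_normK ?num_real// !mul1r; lra.
Qed.

(** The weight [2 x - 1] equals -1 and 1 at the ends, so the integral of [((2 x - 1) f^2)'] is
    [f(0)^2 + f(1)^2]; completing the square, this integrand is at least [f^2 - f'^2]. The unit
    constants are those that match the conditions on [alpha]. *)
Lemma poincare f f' : H1 f f' ->
  L2norm f ^+ 2 <= f 0 ^+ 2 + f 1 ^+ 2 + L2norm f' ^+ 2.
Proof.
move=> Hf; rewrite !L2norm_sq.
have pf := H1_primitive Hf.
have i1 := L2_itg_sq (H1_L2 Hf).
have i2 := L2_itg_sq (H1_L2' Hf).
have p := primitiveM (primitive_affine 1 2 (- 1)) (primitiveX2 pf).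
have := primitive1 p.
have : \int[leb]_(x in D01) (f x ^+ 2 - f' x ^+ 2) <=
  \int[leb]_(x in D01) (cst 2 x * f x ^+ 2 + 2 * f' x * f x * (2 * x + -1)).
  apply: le_Rintegral => //; [exact: itgB|by case: p|].
  move=> x; rewrite /= in_itv /= => /andP[x0 x1].
  rewrite /cst; have := sqr_ge0 (f x + (2 * x - 1) * f' x).
  have : 0 <= (1 - (2 * x - 1) ^+ 2) * f' x ^+ 2.
    by rewrite mulr_ge0 ?sqr_ge0//; nra.
  nra.
rewrite RintegralB// => h1 h2; move: h1; rewrite h2; lra.
Qed.

(** Integrates [((x + q) f^2)'] with [q = -1], which isolates [f(0)^2], and [q = 0], which isolates
    [f(1)^2]; the weight stays within 1 in absolute value. The parameter [d] makes the share of the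
    derivative as small as desired. *)
Lemma trace_ineq f f' (d : R) : 0 < d -> H1 f f' ->
  f 0 ^+ 2 <= (1 + d^-1) * L2norm f ^+ 2 + d * L2norm f' ^+ 2 /\
  f 1 ^+ 2 <= (1 + d^-1) * L2norm f ^+ 2 + d * L2norm f' ^+ 2.
Proof.
move=> d0 Hf; rewrite !L2norm_sq.
have pf := H1_primitive Hf.
have i1 := L2_itg_sq (H1_L2 Hf).
have i2 := L2_itg_sq (H1_L2' Hf).
have iR : itg leb D01 (fun x => (1 + d^-1) * f x ^+ 2 + d * f' x ^+ 2).
  by apply: itgD => //; exact: itgZ.
have e : \int[leb]_(x in D01) ((1 + d^-1) * f x ^+ 2 + d * f' x ^+ 2) =
    (1 + d^-1) * \int[leb]_(x in D01) (f x ^+ 2) +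
    d * \int[leb]_(x in D01) (f' x ^+ 2).
  by rewrite RintegralD//; [rewrite !RintegralZl|exact: itgZ|exact: itgZ].
have tr q : (forall x, 0 < x < 1 -> `|x + q| <= 1) ->
    (1 + q) * f 1 ^+ 2 - q * f 0 ^+ 2 <=
    (1 + d^-1) * \int[leb]_(x in D01) (f x ^+ 2) +
    d * \int[leb]_(x in D01) (f' x ^+ 2).
  move=> hq; have p := primitiveM (primitive_affine 1 1 q) (primitiveX2 pf).
  rewrite (_ : _ - _ = (1 * 1 + q) * f 1 ^+ 2 - (1 * 0 + q) * f 0 ^+ 2); last by ring.
  rewrite -(primitive1 p) -e.
  apply: le_Rintegral => //; first by case: p.
  move=> x; rewrite /= in_itv /= => /hq x1.
  have := amgm (f' x) ((x + q) * f x) d0; rewrite /cst exprMn.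
  have : d^-1 * ((x + q) ^+ 2 * f x ^+ 2) <= d^-1 * f x ^+ 2.
    rewrite ler_wpM2l ?invr_ge0 ?(ltW d0)// ler_piMl ?sqr_ge0//.
    by rewrite -real_normK ?num_real// expr_le1.
  have := ler_norm (f' x * ((x + q) * f x)); rewrite normrM.
  nra.
split.
- have := tr (-1); rewrite subrr mul0r sub0r mulN1r opprK; apply.
  by move=> x /andP[x0 x1]; rewrite ler_norml; lra.
- have := tr 0; rewrite addr0 mul1r mul0r subr0; apply.
  by move=> x /andP[x0 x1]; rewrite ler_norml; lra.
Qed.

(** The trace bound at 0 with [d = 1] contributes 2 and 1 to the constants, the integral of [2 f f']
    from 0 to [y] contributes 1 and 1. *)
Lemma H1_sup f f' : H1 f f' -> forall y, 0 < y < 1 ->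
  f y ^+ 2 <= 3 * L2norm f ^+ 2 + 2 * L2norm f' ^+ 2.
Proof.
move=> Hf y /andP[y0 y1].
have [] := trace_ineq ltr01 Hf; rewrite invr1 => h0 _.
suff : f y ^+ 2 - f 0 ^+ 2 <= L2norm f ^+ 2 + L2norm f' ^+ 2 by lra.
rewrite !L2norm_sq.
have pf := H1_primitive Hf.
have i1 := L2_itg_sq (H1_L2 Hf).
have i2 := L2_itg_sq (H1_L2' Hf).
have i3 := itgD (mu := leb) measurable01 i1 i2.
rewrite -RintegralD// (Rint_itvoo_split (ltW y0) (ltW y1) i3).
rewrite (primitive_sub (lexx 0) (ltW y0) (ltW y1) (primitiveX2 pf)).
rewrite -[X in X <= _]addr0 lerD//; last first.
  by apply: Rintegral_ge0 => x _; rewrite addr_ge0 ?sqr_ge0.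
have [i4 _] := primitiveX2 pf.
apply: le_Rintegral => //.
- by apply: itg_itvoo_sub i4 => //; exact: ltW.
- by apply: itg_itvoo_sub i3 => //; exact: ltW.
- by move=> x _; have := sqr_ge0 (f x - f' x); nra.
Qed.

Lemma H1_bounded f f' : H1 f f' ->
  exists2 M, 0 < M & forall x, 0 <= x <= 1 -> `|f x| <= M.
Proof. by move=> /H1_primitive/primitive_bounded. Qed.

Lemma L2M_H1 f g g' : L2 f -> H1 g g' -> L2 (fun x => g x * f x).
Proof.
move=> Lf Hg; have [M M0 hM] := H1_bounded Hg.
have mgf : measurable_fun D01 (fun x => g x * f x).
  apply: measurable_funM; last exact: L2_measurable.
  exact: L2_measurable (H1_L2 Hg).
split => //.
apply: integrable_lty => //.
apply: (itg_le (mu := leb) measurable01 (g := fun x => M ^+ 2 * f x ^+ 2)).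
- exact: measurable_funX.
- move=> x; rewrite /= in_itv /= => /andP[x0 x1].
  rewrite ger0_norm ?sqr_ge0// exprMn ler_wpM2r ?sqr_ge0//.
  by rewrite -[g x ^+ 2]real_normK ?num_real// lerXn2r ?nnegrE ?(ltW M0)// hM ?ltW.
- by apply: itgZ => //; exact: L2_itg_sq.
Qed.

(** * The equation at a fixed time, tested with [v] and [vxx] *)

Section multipliers.
Variables (mu nu b : R) (v vx vxx vt vxt vxxt : R -> R).
Hypotheses (Hv : H2 v vx vxx) (Hvt : H2 vt vxt vxxt).
Hypothesis pde : {ae leb, forall x, 0 < x < 1 ->
  vt x - mu * vxxt x - nu * vxx x + b * vx x + v x * vx x = 0}.

Local Notation I f := (\int[leb]_(x in D01) f x).

Let Lv : L2 v. Proof. by case: Hv => /H1_L2. Qed.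
Let Lvx : L2 vx. Proof. by case: Hv => /H1_L2'. Qed.
Let Lvxx : L2 vxx. Proof. by case: Hv => _ /H1_L2'. Qed.
Let Lvt : L2 vt. Proof. by case: Hvt => /H1_L2. Qed.
Let Lvxxt : L2 vxxt. Proof. by case: Hvt => _ /H1_L2'. Qed.

Lemma pde_tested g : L2 g ->
  I (fun x => vt x * g x) - mu * I (fun x => vxxt x * g x)
  - nu * I (fun x => vxx x * g x) + b * I (fun x => vx x * g x)
  + I (fun x => v x * vx x * g x) = 0.
Proof.
move=> Lg; have Lvvx : L2 (fun x => v x * vx x) by case: Hv => h _; exact: L2M_H1 h.
have i1 := L2_itgM Lvt Lg; have i2 := L2_itgM Lvxxt Lg.
have i3 := L2_itgM Lvxx Lg; have i4 := L2_itgM Lvx Lg.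
have i5 := L2_itgM Lvvx Lg.
have i2' := itgZ (mu := leb) mu measurable01 i2.
have i3' := itgZ (mu := leb) nu measurable01 i3.
have i4' := itgZ (mu := leb) b measurable01 i4.
have j1 := itgB (mu := leb) measurable01 i1 i2'.
have j2 := itgB (mu := leb) measurable01 j1 i3'.
have j3 := itgD (mu := leb) measurable01 j2 i4'.
have j4 := itgD (mu := leb) measurable01 j3 i5.
rewrite -!RintegralZl// -RintegralB// -RintegralB// -RintegralD// -RintegralD//.
apply: Rint_ae0 => //; first exact: itg_measurable j4.
apply: filterS pde; first exact: (ae_filter_ringOfSetsType leb).
move=> x /= + xD => /(_ _); move: xD; rewrite in_itv /= => xD /(_ xD) e.
by rewrite -[RHS](mul0r (g x)) -e; ring.
Qed.

(** Tested with [v]. All boundary terms are kept: the one in [vxt] will become a rate of [E1], the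
    others dissipation or cubic terms to be absorbed. *)
Lemma energy_identity :
  I (fun x => vt x * v x) + mu * I (fun x => vxt x * vx x)
  - mu * (vxt 1 * v 1 - vxt 0 * v 0)
  + nu * I (fun x => vx x ^+ 2) - nu * (vx 1 * v 1 - vx 0 * v 0)
  + b / 2 * (v 1 ^+ 2 - v 0 ^+ 2) + (v 1 ^+ 3 - v 0 ^+ 3) / 3 = 0.
Proof.
have [H1v H1vx] := Hv; have [H1vt H1vxt] := Hvt.
have := pde_tested Lv.
have -> : I (fun x => vxxt x * v x) =
    vxt 1 * v 1 - vxt 0 * v 0 - I (fun x => vxt x * vx x).
  have := Rint_parts H1v H1vxt.
  rewrite (_ : I (fun x => v x * vxxt x) = I (fun x => vxxt x * v x)); last first.
    by apply: Rint_eq => x _; rewrite mulrC.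
  rewrite (_ : I (fun x => vx x * vxt x) = I (fun x => vxt x * vx x)); last first.
    by apply: Rint_eq => x _; rewrite mulrC.
  by move=> ->; ring.
have -> : I (fun x => vxx x * v x) =
    vx 1 * v 1 - vx 0 * v 0 - I (fun x => vx x ^+ 2).
  have := Rint_parts H1v H1vx.
  rewrite (_ : I (fun x => v x * vxx x) = I (fun x => vxx x * v x)); last first.
    by apply: Rint_eq => x _; rewrite mulrC.
  rewrite (_ : I (fun x => vx x * vx x) = I (fun x => vx x ^+ 2)); last first.
    by apply: Rint_eq => x _; rewrite expr2.
  by move=> ->; ring.
have -> : I (fun x => vx x * v x) = (v 1 ^+ 2 - v 0 ^+ 2) / 2.
  have := Rint_parts H1v H1v.
  rewrite (_ : I (fun x => v x * vx x) = I (fun x => vx x * v x)); last first.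
    by apply: Rint_eq => x _; rewrite mulrC.
  by lra.
have -> : I (fun x => v x * vx x * v x) = (v 1 ^+ 3 - v 0 ^+ 3) / 3.
  (* The cube is differentiated as [v] times [v^2]. *)
  have p := primitiveM (H1_primitive H1v) (primitiveX2 (H1_primitive H1v)).
  have := primitive1 p.
  rewrite (_ : I (fun x => vx x * v x ^+ 2 + 2 * vx x * v x * v x) =
    I (fun x => 3 * (v x * vx x * v x))); last by apply: Rint_eq => x _; ring.
  rewrite RintegralZl//; first by move=> e; rewrite !exprS !expr0; lra.
  by apply: L2_itgM => //; exact: L2M_H1 H1v.
lra.
Qed.

(** Tested with [vxx]. Only [vt vxx] is integrated by parts; [vxxt vxx] is already a rate, and the
    convective terms on the right are left for Young's inequality. *)
Lemma second_energy_identity :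
  I (fun x => vxt x * vx x) - (vt 1 * vx 1 - vt 0 * vx 0)
  + mu * I (fun x => vxxt x * vxx x) + nu * I (fun x => vxx x ^+ 2)
  = b * I (fun x => vx x * vxx x) + I (fun x => v x * vx x * vxx x).
Proof.
have [H1v H1vx] := Hv; have [H1vt H1vxt] := Hvt.
have := pde_tested Lvxx.
have := Rint_parts H1vt H1vx.
rewrite (_ : I (fun x => vxx x * vxx x) = I (fun x => vxx x ^+ 2)); last first.
  by apply: Rint_eq => x _; rewrite expr2.
lra.
Qed.

End multipliers.

End unit_interval.

(** * Space-time functions and the integrated form of the weak time derivative *)

Section evolution.
Context {R : realType}.
Local Notation leb := (@lebesgue_measure R).
Local Notation leb2 := (leb \x leb)%E.
Local Notation D01 := (`]0, 1[%classic : set R).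
Local Notation Dt T := (`]0, T[%classic : set R).
Implicit Types (u ut : R -> R -> R) (T t : R).

Definition L2loc u := forall T,
  itg leb2 (Dt T `*` D01) (fun p => u p.1 p.2 ^+ 2).

(** Kept apart from [L2loc], which only yields measurability of the square. *)
Definition measurable_loc u := forall T,
  measurable_fun (Dt T `*` D01) (fun p : R * R => u p.1 p.2).

(** The integral equation in L^2(0,1), read pointwise; the exceptional null set of [x] may depend on
    [t]. *)
Definition evol u ut := forall t, 0 <= t ->
  {ae leb, forall x, D01 x -> u t x = u 0 x + \int[leb]_(r in Dt t) ut r x}.

Lemma measurableDt T : measurable (Dt T).
Proof. exact: measurable_itv. Qed.
Hint Resolve measurableDt : core.

Lemma measurableQ T :
  @measurable _ (measurableTypeR R * measurableTypeR R)%type (Dt T `*` D01).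
Proof. exact: measurableX. Qed.
Hint Resolve measurableQ : core.

Lemma jointly_measurable_loc u : jointly_measurable u -> measurable_loc u.
Proof.
move=> mu T; apply: measurable_funS mu.
- by apply: measurableX; exact: measurable_itv.
- by move=> [t x] /= [+ ?]; rewrite !in_itv /= andbT => /andP[].
Qed.

Lemma leb2_lty T : ((leb \x leb) (Dt T `*` D01) < +oo)%E.
Proof.
rewrite product_measure1E// ; first by rewrite lte_mul_pinfty// ?lebesgue_itvoo_lty// ge0_fin_numE// lebesgue_itvoo_lty.
Qed.

Lemma L2loc_itg T u : measurable_loc u -> L2loc u ->
  itg leb2 (Dt T `*` D01) (fun p => u p.1 p.2).
Proof. move=> mu Lu.
exact: (itg_sq (mu := leb2) (measurableQ T) (leb2_lty T) (mu T) (Lu T)). Qed.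

Lemma itg_Rint_fst (A B : set R) u : measurable A -> measurable B ->
  itg leb2 (A `*` B) (fun p => u p.1 p.2) ->
  itg leb B (fun x => \int[leb]_(r in A) u r x).
Proof.
move=> mA mB iu.
have h := itg_swap_rect (m1 := leb) (m2 := leb) mA mB (u := u) iu.
exact: (itg_Rint_rect (m1 := leb) (m2 := leb) mB mA (u := fun x r => u r x) h).
Qed.

Lemma itg_Rint_snd (A B : set R) u : measurable A -> measurable B ->
  itg leb2 (A `*` B) (fun p => u p.1 p.2) ->
  itg leb A (fun r => \int[leb]_(x in B) u r x).
Proof.
move=> mA mB iu.
exact: (itg_Rint_rect (m1 := leb) (m2 := leb) mA mB (u := u) iu).
Qed.

Lemma ae_itg_fst (A B : set R) u : measurable A -> measurable B ->
  itg leb2 (A `*` B) (fun p => u p.1 p.2) ->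
  {ae leb, forall x, B x -> itg leb A (fun r => u r x)}.
Proof.
move=> mA mB iu.
have h := itg_swap_rect (m1 := leb) (m2 := leb) mA mB (u := u) iu.
exact: (ae_itg_section (m1 := leb) (m2 := leb) mB mA (u := fun x r => u r x) h).
Qed.

Lemma measurable_snd_rect (A B : set R) (f : R -> R) :
  measurable A -> measurable B -> measurable_fun B f ->
  measurable_fun (A `*` B) (fun p : R * R => f p.2).
Proof.
move=> mA mB mf; apply: (measurable_comp mB) mf _ => //.
  by move=> _ /= [[x y] [_ ?] <-].
by apply: measurable_funTS; exact: measurable_snd.
Qed.

Lemma measurable_fst_rect (A B : set R) (f : R -> R) :
  measurable A -> measurable B -> measurable_fun A f ->
  measurable_fun (A `*` B) (fun p : R * R => f p.1).
Proof.
move=> mA mB mf; apply: (measurable_comp mA) mf _ => //.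
  by move=> _ /= [[x y] [? _] <-].
by apply: measurable_funTS; exact: measurable_fst.
Qed.

(** Membership in [L2] at almost every time gives the norm bound its meaning: [L2norm] takes the
    default value 0 on a function whose square has infinite integral. *)
Lemma L2locP u : measurable_loc u ->
  {ae leb, forall t, 0 < t -> L2 (u t)} ->
  (forall T, (\int[leb]_(s in Dt T) (L2norm (u s) ^+ 2)%:E < +oo)%E) ->
  L2loc u.
Proof.
move=> mu Lu fu T.
have mu2 : measurable_fun (Dt T `*` D01) (fun p : R * R => u p.1 p.2 ^+ 2).
  exact: measurable_funX.
apply/(@itg_rectP _ _ _ _ _ leb leb _ _ (measurableDt T) measurable01 (fun t x => u t x ^+ 2)) => //.
apply: le_lt_trans (fu T); rewrite le_eqVlt; apply/orP; left; apply/eqP.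
rewrite [LHS](_ : _ = \int[leb]_(s in Dt T) \int[leb]_(y in D01) (u s y ^+ 2)%:E)%E; last first.
  apply: eq_integral => s _; apply: eq_integral => y _.
  by rewrite ger0_norm ?sqr_ge0.
apply: ge0_ae_eq_integral => //.
- exact: (measurable_int_rect leb (measurableDt T) measurable01 mu2).
- apply/measurable_EFinP.
  have := measurable_Rint_rect leb (measurableDt T) measurable01 (u := fun t x => u t x ^+ 2) mu2.
  by apply: eq_measurable_fun => s _; rewrite L2norm_sq.
- by move=> s _; apply: integral_ge0 => y _; rewrite lee_fin sqr_ge0.
- by move=> s _; rewrite lee_fin sqr_ge0.
- apply: filterS Lu; first exact: (ae_filter_ringOfSetsType leb).
  move=> s /= + sT => /(_ _); move: sT; rewrite in_itv /= => /andP[s0 _] /(_ s0) Lus.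
  by rewrite L2norm_sq fin_Rint//; exact: L2_itg_sq.
Qed.

(** Nonnegativity of the variance: expand the integral of [(|f| - c)^2] with [c] the mean of [|f|],
    the interval having length 1. *)
Lemma Rint_norm_le_L2norm (f : R -> R) : L2 f ->
  \int[leb]_(x in D01) `|f x| <= L2norm f.
Proof.
move=> Lf; set c := Rintegral _ _ _.
have c0 : 0 <= c by apply: Rintegral_ge0.
rewrite -(@ler_sqr _ c) ?nnegrE ?sqrtr_ge0// L2norm_sq.
have if1 := itg_norm (mu := leb) measurable01 (L2_itg Lf).
have if2 := L2_itg_sq Lf.
have ic := itg_cst_itvoo 0 1 (c ^+ 2).
have : 0 <= \int[leb]_(x in D01) (f x ^+ 2 - 2 * c * `|f x| + cst (c ^+ 2) x).
  apply: Rintegral_ge0 => x _; rewrite -(real_normK (num_real (f x))) /cst.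
  by have := sqr_ge0 (`|f x| - c); nra.
have i1 := itgZ (mu := leb) (2 * c) measurable01 if1.
rewrite RintegralD//; last exact: itgB.
rewrite RintegralB// RintegralZl// -/c Rintegral_cst//.
have l1 : fine (leb D01) = 1.
  transitivity (fine (lebesgue_measure ([set` `]0, 1[] : set R))) => //.
  by rewrite lebesgue_measure_itv /= lte_fin ltr01 oppr0 addr0.
rewrite [fine _]l1 mulr1; lra.
Qed.

Lemma derive1_out (phi : R -> R) (a b : R) :
  (forall x, x \notin `[a, b] -> phi x = 0) ->
  forall x, x \notin `[a, b] -> derive1 phi x = 0.
Proof.
move=> out x xab; rewrite derive1E (@near_eq_derive _ _ _ _ (cst 0)).
  exact: derive_cst.
have op : open (~` `[a, b]%classic) by rewrite openC; exact: itv_closed.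
have : nbhs x (~` `[a, b]%classic) by apply: open_nbhs_nbhs; split => //; exact/negP.
by apply: filterS => y /= yab; rewrite /cst out//; exact/negP.
Qed.

Lemma test_fun_bounded (I : set R) (phi : R -> R) : test_fun I phi ->
  exists2 M, 0 < M & forall x, `|phi x| <= M /\ `|derive1 phi x| <= M.
Proof.
move=> [dphi cphi' [a [b [_ out]]]].
have cphi : continuous phi.
  by move=> x; apply: differentiable_continuous; apply/derivable1_diffP.
have out' := derive1_out out.
have [M M0 hM] := continuous_itvcc_bounded (continuous_subspaceT cphi : {within `[a, b], continuous phi}).
have [N N0 hN] := continuous_itvcc_bounded (continuous_subspaceT cphi' : {within `[a, b], continuous (derive1 phi)}).
exists (M + N); first exact: addr_gt0.
move=> x; have [xab|xab] := boolP (x \in `[a, b]).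
  move: (xab); rewrite in_itv /= => xab'; split.
    by rewrite (le_trans (hM _ xab'))// lerDl ltW.
  by rewrite (le_trans (hN _ xab'))// lerDr ltW.
by rewrite out// out'// normr0 ltW ?addr_gt0.
Qed.

Lemma L2B (f g : R -> R) : L2 f -> L2 g -> L2 (f \- g).
Proof.
move=> Lf Lg.
have m : measurable_fun D01 (f \- g).
  by apply: measurable_funB; exact: L2_measurable.
split => //; apply: integrable_lty => //.
have := itgD_sq (mu := leb) (g := fun x => - g x) measurable01 (L2_measurable Lf).
apply.
- by apply: measurableT_comp => //; exact: L2_measurable.
- exact: L2_itg_sq.
- by apply: itg_eq (L2_itg_sq Lg) => // x _; rewrite sqrrN.
Qed.

Lemma L2B_primitive_dist (f g : R -> R) (y z : R) : 0 <= y -> y <= z -> z <= 1 ->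
  L2 f -> L2 g ->
  `|\int[leb]_(x in `]y, z[) f x - \int[leb]_(x in `]y, z[) g x| <=
  L2norm (f \- g).
Proof.
move=> y0 yz z1 Lf Lg; have Lfg := L2B Lf Lg.
have sub (h : R -> R) : itg leb D01 h -> itg leb `]y, z[ h.
  exact: itg_itvoo_sub.
have ifg := L2_itg Lfg.
rewrite -RintegralB//; [|exact: sub (L2_itg Lf)|exact: sub (L2_itg Lg)].
apply: le_trans (Rint_norm_le_L2norm Lfg).
have inorm := itg_norm (mu := leb) measurable01 ifg.
apply: (le_trans (le_normr_Rintegral _ (sub _ ifg))) => //.
rewrite (Rint_itvoo_split y0 (le_trans yz z1) inorm).
rewrite (Rint_itvoo_split yz z1); last by apply: itg_itvoo_sub inorm.
rewrite addrCA lerDl addr_ge0//; exact: Rintegral_ge0.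
Qed.

Lemma itg_rect_sub T u (B : set R) : measurable B -> B `<=` D01 ->
  measurable_loc u -> L2loc u ->
  itg leb2 (Dt T `*` B) (fun p => u p.1 p.2).
Proof.
move=> mB B01 mu Lu.
have mQ : @measurable _ (measurableTypeR R * measurableTypeR R)%type (Dt T `*` B).
  exact: measurableX.
apply: (integrableS (measurableQ T) mQ _ (L2loc_itg T mu Lu)).
by move=> [t x] /= [? /B01].
Qed.

Lemma Rfubini_time_test T u (B : set R) (phi : R -> R) (N : R) :
  measurable B -> B `<=` D01 -> measurable_loc u -> L2loc u ->
  measurable_fun (Dt T) phi -> (forall x, `|phi x| <= N) ->
  \int[leb]_(r in Dt T) ((\int[leb]_(x in B) u r x) * phi r) =
  \int[leb]_(x in B) \int[leb]_(r in Dt T) (u r x * phi r).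
Proof.
move=> mB B01 mu Lu mphi hN.
have mQ : @measurable _ (measurableTypeR R * measurableTypeR R)%type (Dt T `*` B).
  exact: measurableX.
have iu := itg_rect_sub T mB B01 mu Lu.
have iup : itg leb2 (Dt T `*` B) (fun p => u p.1 p.2 * phi p.1).
  apply: (itgM_bounded (mu := leb2) (M := N) mQ) => //.
  exact: measurable_fst_rect.
rewrite -(Rfubini (m1 := leb) (m2 := leb) (measurableDt T) mB (u := fun r x => u r x * phi r) iup).
apply: eq_Rint_ae => //.
- apply: measurable_funM => //.
  exact: itg_measurable (itg_Rint_rect (m1 := leb) (m2 := leb) (measurableDt T) mB iu).
- exact: itg_measurable (itg_Rint_rect (m1 := leb) (m2 := leb) (measurableDt T) mB (u := fun r x => u r x * phi r) iup).
have := ae_itg_section (m1 := leb) (m2 := leb) (measurableDt T) mB iu.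
apply: filterS.
by move=> r /= + rT => /(_ rT) ir; rewrite RintegralZr.
Qed.

(* A weak time derivative, tested on an interval in [x], becomes the weak
   derivative of a continuous scalar function of time. *)
Lemma weak_time_derivative_evol u ut : measurable_loc u -> measurable_loc ut ->
  L2loc u -> L2loc ut -> (forall t, 0 <= t -> L2 (u t)) ->
  L2_continuous u -> weak_time_derivative u ut -> evol u ut.
Proof.
move=> mu mut Lu Lut L2u cu wd t t0.
move: t0; rewrite le_eqVlt => /predU1P[<-|t0].
  by apply: aeW => x _; rewrite Rint_itvoo0 addr0.
have key y z : 0 < y -> y < z -> z < 1 ->
    \int[leb]_(x in `]y, z[) u t x - \int[leb]_(x in `]y, z[) u 0 x =
    \int[leb]_(r in Dt t) \int[leb]_(x in `]y, z[) ut r x.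
  move=> y0 yz z1.
  have mB : measurable (`]y, z[%classic : set R) by exact: measurable_itv.
  have B01 : `]y, z[ `<=` D01.
    by apply: subset_itv; rewrite bnd_simp ltW.
  apply: (@weak_derivative_primitive _ `]0, +oo[%classic 0 t
    (fun s => \int[leb]_(x in `]y, z[) u s x)
    (fun r => \int[leb]_(x in `]y, z[) ut r x)) => //.
  - by move=> x /=; rewrite !in_itv /= => /andP[->].
  - apply/subspace_continuousP => s; rewrite /= in_itv /= => /andP[s0 st].
    apply/cvgrPdist_le => e e0; rewrite near_withinE.
    have := cu s s0; move/cvgrPdist_le => /(_ e e0); rewrite near_withinE.
    apply: filterS => r /= + rt; move: rt; rewrite in_itv /= => /andP[r0 _] /(_ r0).
    rewrite sub0r normrN ger0_norm ?sqrtr_ge0//; apply: le_trans.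
    by rewrite distrC L2B_primitive_dist ?(ltW y0) ?(ltW yz) ?(ltW z1)//; exact: L2u.
  - apply: (itg_Rint_rect (m1 := leb) (m2 := leb) (measurableDt t) mB).
    exact: itg_rect_sub.
  - move=> phi tphi; have [M M0 hM] := test_fun_bounded tphi.
    have [dphi cphi' [a [b [sub out]]]] := tphi.
    have cphi : continuous phi.
      by move=> x; apply: differentiable_continuous; apply/derivable1_diffP.
    have out' := derive1_out out.
    (* The support [[a, b]] of [phi] lies in []0, T[], so the half-line can be replaced by a bounded
       time interval, on which [u] and [ut] are integrable and Fubini applies. *)
    pose T := `|b| + 1.
    have outT x : ~ Dt T x -> x \notin `[a, b].
      move=> xT; apply/negP => xab; apply: xT.
      have /= := sub _ xab; rewrite /T in_itv /= andbT => x0.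
      rewrite in_itv /= x0 /=.
      move: xab; rewrite in_itv /= => /andP[_ xb].
      by rewrite (le_lt_trans xb)// (le_lt_trans (ler_norm b))// ltrDl.
    have DT : Dt T `<=` `]0, +oo[.
      by move=> x /=; rewrite !in_itv /= andbT => /andP[].
    have mI : measurable (`]0, +oo[%classic : set R) by exact: measurable_itv.
    have mc (f : R -> R) : continuous f -> measurable_fun (Dt T) f.
      by move=> cf; apply: measurable_funTS; exact: continuous_measurable_fun.
    rewrite (Rint_out mI (measurableDt T) DT); last first.
      by move=> x /outT xab; rewrite out' ?mulr0.
    rewrite (Rint_out mI (measurableDt T) DT); last first.
      by move=> x /outT xab; rewrite out ?mulr0.
    rewrite (Rfubini_time_test (N := M) mB B01 mu Lu (mc _ cphi')); last first.
      by move=> x; have [] := hM x.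
    rewrite (Rfubini_time_test (N := M) mB B01 mut Lut (mc _ cphi)); last first.
      by move=> x; have [] := hM x.
    have iF v (f : R -> R) : measurable_loc v -> L2loc v -> continuous f ->
        (forall x, `|f x| <= M) ->
        itg leb `]y, z[ (fun x => \int[leb]_(r in Dt T) (v r x * f r)).
      move=> mv Lv cf hf.
      have mQ : @measurable _ (measurableTypeR R * measurableTypeR R)%type (Dt T `*` `]y, z[).
        exact: measurableX.
      have iv : itg leb2 (Dt T `*` `]y, z[) (fun p => v p.1 p.2 * f p.1).
        apply: (itgM_bounded (mu := leb2) (M := M) mQ) => //.
          by apply: measurable_fst_rect => //; exact: mc.
        exact: itg_rect_sub.
      exact: (itg_Rint_fst (u := fun r x => v r x * f r) _ _ iv).
    have i1 := iF u _ mu Lu cphi' (fun x => (hM x).2).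
    have i2 := iF ut _ mut Lut cphi (fun x => (hM x).1).
    rewrite -mulN1r -RintegralZl//.
    apply: eq_Rint_ae => //.
    + exact: itg_measurable i1.
    + by apply: measurable_funM => //; exact: itg_measurable i2.
    + have := wd _ tphi; apply: filterS; first exact: (ae_filter_ringOfSetsType leb).
      move=> x /= + xyz; move: (B01 _ xyz); rewrite /= in_itv /= => x01 /(_ x01).
      rewrite (Rint_out mI (measurableDt T) DT); last first.
        by move=> r /outT rab; rewrite out' ?mulr0.
      rewrite (Rint_out mI (measurableDt T) DT); last first.
        by move=> r /outT rab; rewrite out ?mulr0.
      by rewrite mulN1r.
have iV : itg leb D01 (fun x => \int[leb]_(r in Dt t) ut r x).
  exact: itg_Rint_fst (L2loc_itg t mut Lut).
have iu s : 0 <= s -> itg leb D01 (u s) by move=> s0; exact/L2_itg/L2u.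
have : {ae leb, forall x, D01 x ->
    u t x - u 0 x - \int[leb]_(r in Dt t) ut r x = 0}.
  apply: ae0_Rint_itv.
    by apply: itgB => //; apply: itgB => //; apply: iu => //; exact: ltW.
  move=> y z y0 yz z1.
  have sub (h : R -> R) : itg leb D01 h -> itg leb `]y, z[ h.
    by apply: itg_itvoo_sub; exact: ltW.
  have B01 : `]y, z[ `<=` D01.
    by apply: subset_itv; rewrite bnd_simp ltW.
  rewrite RintegralB//; [|by apply: itgB => //; apply/sub/iu => //; exact: ltW|exact: sub].
  rewrite RintegralB//; [|by apply/sub/iu; exact: ltW|exact/sub/iu].
  rewrite key//; apply/eqP; rewrite subr_eq0; apply/eqP.
  apply: Rfubini => //.
  exact: itg_rect_sub.
apply: filterS; first exact: (ae_filter_ringOfSetsType leb).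
by move=> x /= + Dx => /(_ Dx)/eqP; rewrite subr_eq0 subr_eq addrC => /eqP ->.
Qed.

End evolution.

(** * Evolution of spatial derivatives, traces and energies *)

Section evolution_calculus.
Context {R : realType}.
Local Notation leb := (@lebesgue_measure R).
Local Notation leb2 := (leb \x leb)%E.
Local Notation D01 := (`]0, 1[%classic : set R).
Local Notation Dt T := (`]0, T[%classic : set R).
Implicit Types (u ut ux uxt : R -> R -> R) (T t : R).
Hint Resolve measurable01 measurableDt : core.

Lemma itg_rect_weight T u (psi : R -> R) (M : R) :
  measurable_loc u -> L2loc u ->
  measurable_fun D01 psi -> (forall x, D01 x -> `|psi x| <= M) ->
  itg leb2 (Dt T `*` D01) (fun p => u p.1 p.2 * psi p.2).
Proof.
move=> mu Lu mpsi hM.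
apply: (itgM_bounded (mu := leb2) (M := M) (measurableQ T)).
- exact: measurable_snd_rect.
- by move=> [t x] [/= _ ?]; exact: hM.
- exact: L2loc_itg.
Qed.

(** The weight need not vanish at the boundary: besides derivatives of test functions, it will be
    [1] and [x + q], which produce traces. *)
Lemma evol_pairing u ut (psi : R -> R) (M : R) t :
  measurable_loc ut -> L2loc ut -> (forall t, 0 <= t -> L2 (u t)) ->
  evol u ut -> measurable_fun D01 psi -> (forall x, D01 x -> `|psi x| <= M) ->
  0 <= t ->
  \int[leb]_(x in D01) (u t x * psi x) - \int[leb]_(x in D01) (u 0 x * psi x) =
  \int[leb]_(r in Dt t) \int[leb]_(x in D01) (ut r x * psi x).
Proof.
move=> mut Lut L2u eu mpsi hM t0.
have iup := itg_rect_weight t mut Lut mpsi hM.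
have i1 s : 0 <= s -> itg leb D01 (fun x => u s x * psi x).
  move=> s0; apply: (itgM_bounded (mu := leb) (M := M)) => //.
  exact/L2_itg/L2u.
rewrite (Rfubini (m1 := leb) (m2 := leb) (measurableDt t) measurable01 (u := fun r x => ut r x * psi x) iup).
rewrite -RintegralB//; [|exact: i1|exact: i1].
apply: eq_Rint_ae => //.
- by apply: (itg_measurable (mu := leb)); apply: itgB => //; exact: i1.
- by apply: (itg_measurable (mu := leb)); exact: (itg_Rint_fst (u := fun r x => ut r x * psi x) _ _ iup).
have h1 := eu t t0.
have h2 := ae_itg_fst (measurableDt t) measurable01 (L2loc_itg t mut Lut).
apply: filterS2 h1 h2; first exact: (ae_filter_ringOfSetsType leb).
move=> x e1 i2 Dx; rewrite (e1 Dx) RintegralZr//; last exact: i2.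
by ring.
Qed.

(** The defect [h] of the formula for [ux] is a weak derivative of the zero function: against a test
    function, integration by parts in [x] moves everything to [u], whose evolution is known. Hence
    [h] integrates to 0 on every subinterval. *)
Lemma evol_spatial_derivative u ut ux uxt :
  measurable_loc ut -> measurable_loc uxt -> L2loc ut -> L2loc uxt ->
  (forall t, 0 <= t -> H1 (u t) (ux t)) ->
  {ae leb, forall t, 0 < t -> H1 (ut t) (uxt t)} ->
  evol u ut -> evol ux uxt.
Proof.
move=> mut muxt Lut Luxt Hu Hut eu t t0.
have L2u s : 0 <= s -> L2 (u s) by move=> /Hu/H1_L2.
have iux s : 0 <= s -> itg leb D01 (ux s) by move=> /Hu/H1_L2'/L2_itg.
have iV : itg leb D01 (fun x => \int[leb]_(r in Dt t) uxt r x).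
  exact: itg_Rint_fst (L2loc_itg t muxt Luxt).
pose h x := ux t x - ux 0 x - \int[leb]_(r in Dt t) uxt r x.
have ih : itg leb D01 h.
  by apply: itgB => //; apply: itgB => //; exact: iux.
have wd : weak_derivative D01 (cst 0) h.
  move=> phi tphi; have [M M0 hM] := test_fun_bounded tphi.
  have [dphi cphi' _] := tphi.
  have cphi : continuous phi.
    by move=> x; apply: differentiable_continuous; apply/derivable1_diffP.
  have mphi : measurable_fun D01 phi.
    by apply: measurable_funTS; exact: continuous_measurable_fun.
  have mphi' : measurable_fun D01 (derive1 phi).
    by apply: measurable_funTS; exact: continuous_measurable_fun.
  have hM1 x : D01 x -> `|phi x| <= M by move=> _; have [] := hM x.
  have hM2 x : D01 x -> `|derive1 phi x| <= M by move=> _; have [] := hM x.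
  have iphi (f : R -> R) : itg leb D01 f -> itg leb D01 (fun x => f x * phi x).
    by apply: (itgM_bounded (mu := leb) (M := M)).
  have -> : \int[leb]_(x in D01) (cst 0 x * derive1 phi x) = 0.
    by rewrite /Rintegral integral0_eq// => x _; rewrite /cst mul0r.
  rewrite (_ : \int[leb]_(x in D01) (h x * phi x) =
      \int[leb]_(x in D01) (ux t x * phi x) - \int[leb]_(x in D01) (ux 0 x * phi x)
      - \int[leb]_(x in D01) ((\int[leb]_(r in Dt t) uxt r x) * phi x)); last first.
    have i1 := iphi _ (iux t t0); have i2 := iphi _ (iux 0 (lexx 0)).
    rewrite -RintegralB// -RintegralB//; last 2 first.
    - exact: itgB.
    - exact: iphi.
    by apply: Rint_eq => x _; rewrite /h; ring.
  have iup := itg_rect_weight t muxt Luxt mphi hM1.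
  have iup' := itg_rect_weight t mut Lut mphi' hM2.
  rewrite (_ : \int[leb]_(x in D01) ((\int[leb]_(r in Dt t) uxt r x) * phi x) =
    \int[leb]_(x in D01) \int[leb]_(r in Dt t) (uxt r x * phi x)); last first.
    apply: eq_Rint_ae => //.
    - by apply: (itg_measurable (mu := leb)); exact: iphi.
    - by apply: (itg_measurable (mu := leb)); exact: (itg_Rint_fst (u := fun r x => uxt r x * phi x) _ _ iup).
    have := ae_itg_fst (measurableDt t) measurable01 (L2loc_itg t muxt Luxt).
    apply: filterS; first exact: (ae_filter_ringOfSetsType leb).
    by move=> x /= + Dx => /(_ Dx) ix; rewrite RintegralZr.
  rewrite -(Rfubini (m1 := leb) (m2 := leb) (measurableDt t) measurable01 (u := fun r x => uxt r x * phi x) iup).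
  rewrite (_ : \int[leb]_(r in Dt t) \int[leb]_(x in D01) (uxt r x * phi x) =
    \int[leb]_(r in Dt t) (-1 * \int[leb]_(x in D01) (ut r x * derive1 phi x))); last first.
    have j1 := itg_Rint_snd (measurableDt t) measurable01 (u := fun r x => uxt r x * phi x) iup.
    have j2 := itg_Rint_snd (measurableDt t) measurable01 (u := fun r x => ut r x * derive1 phi x) iup'.
    apply: eq_Rint_ae => //.
    - exact: itg_measurable j1.
    - by apply: measurable_funM => //; exact: itg_measurable j2.
    apply: filterS Hut; first exact: (ae_filter_ringOfSetsType leb).
    move=> r /= + rt; move: rt; rewrite in_itv /= => /andP[r0 _] /(_ r0)[_ _ _ wdr].
    by rewrite (wdr _ tphi) mulN1r opprK.
  have j2 := itg_Rint_snd (measurableDt t) measurable01 (u := fun r x => ut r x * derive1 phi x) iup'.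
  rewrite RintegralZl//.
  rewrite -(evol_pairing mut Lut L2u eu mphi' hM2 t0).
  have [_ _ _ /(_ _ tphi) e1] := Hu t t0.
  have [_ _ _ /(_ _ tphi) e2] := Hu 0 (lexx 0).
  by rewrite e1 e2; ring.
have : {ae leb, forall x, D01 x -> h x = 0}.
  apply: ae0_Rint_itv => // y z y0 yz z1.
  have sub : `]y, z[ `<=` D01.
    by apply: subset_itv; rewrite bnd_simp ltW.
  rewrite -(@weak_derivative_primitive _ _ y z (cst 0) h measurable01 sub yz _ _ wd).
  - by rewrite subrr.
  - by apply: continuous_subspaceT => x; exact: cvg_cst.
  - exact: integrableS ih.
apply: filterS; first exact: (ae_filter_ringOfSetsType leb).
by move=> x /= + Dx => /(_ Dx)/eqP; rewrite /h subr_eq0 subr_eq addrC => /eqP ->.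
Qed.

(* [tr (-1)] and [tr 0] are the traces at 0 and 1 of an H^1 function, written as
   functionals continuous for the L^2 norms of the function and its derivative. *)
Definition tr (q : R) (f f' : R -> R) : R :=
  \int[leb]_(x in D01) (f x * 1) + \int[leb]_(x in D01) (f' x * (x + q)).

Lemma measurable_shift (q : R) : measurable_fun D01 (fun x => x + q).
Proof. by apply: measurable_funD. Qed.

Lemma H1_trace (q : R) (f f' : R -> R) : H1 f f' ->
  tr q f f' = (1 + q) * f 1 - q * f 0.
Proof.
move=> Hf; have p := primitiveM (primitive_affine 1 1 q) (H1_primitive Hf).
rewrite (_ : _ - _ = (1 * 1 + q) * f 1 - (1 * 0 + q) * f 0); last by ring.
rewrite -(primitive1 p) /tr -RintegralD//.
- by apply: Rint_eq => x _; rewrite /cst; ring.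
- by apply: itgZr => //; exact/L2_itg/(H1_L2 Hf).
- apply: (itgM_bounded (mu := leb) (M := 1 + `|q|)) => //.
  + exact: measurable_shift.
  + move=> x; rewrite /= in_itv /= => /andP[x0 x1].
    by rewrite (le_trans (ler_normD _ _))// lerD2r ger0_norm ltW.
  + exact/L2_itg/(H1_L2' Hf).
Qed.

(** [evol] holds only for almost every [x] and says nothing at the endpoints; [tr] sees the
    functions only through integrals, which do evolve. *)
Lemma evol_trace q T u ut ux uxt :
  measurable_loc ut -> measurable_loc uxt -> L2loc ut -> L2loc uxt ->
  (forall t, 0 <= t -> H1 (u t) (ux t)) ->
  evol u ut -> evol ux uxt ->
  primitive T (fun t => (1 + q) * u t 1 - q * u t 0)
    (fun r => tr q (ut r) (uxt r)).
Proof.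
move=> mut muxt Lut Luxt Hu eu eux.
have hq x : D01 x -> `|x + q| <= 1 + `|q|.
  rewrite /= in_itv /= => /andP[x0 x1].
  by rewrite (le_trans (ler_normD _ _))// lerD2r ger0_norm ltW.
have h1 x : D01 x -> `|1 : R| <= 1 by rewrite normr1.
have m1 : measurable_fun D01 (fun=> 1 : R) by exact: measurable_cst.
have i1 S := itg_Rint_snd (measurableDt S) measurable01 (u := fun r x => ut r x * 1)
  (itg_rect_weight S mut Lut m1 h1).
have i2 S := itg_Rint_snd (measurableDt S) measurable01 (u := fun r x => uxt r x * (x + q))
  (itg_rect_weight S muxt Luxt (measurable_shift q) hq).
split; first exact: itgD.
move=> t /andP[t0 _].
rewrite -(H1_trace q (Hu t t0)) -(H1_trace q (Hu 0 (lexx 0))) /tr RintegralD//.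
have L2u s : 0 <= s -> L2 (u s) by move=> /Hu/H1_L2.
have L2ux s : 0 <= s -> L2 (ux s) by move=> /Hu/H1_L2'.
rewrite -(evol_pairing mut Lut L2u eu m1 h1 t0).
rewrite -(evol_pairing muxt Luxt L2ux eux (measurable_shift q) hq t0).
ring.
Qed.

(** The moving domain []0, r[] is replaced by the fixed []0, t[] and the indicator of [q < r], so
    this is a partial integral of a measurable function of three variables. *)
Lemma measurable_time_integral t ut : measurable_loc ut ->
  measurable_fun (Dt t `*` D01)
    (fun p : R * R => \int[leb]_(q in Dt p.1) ut q p.2).
Proof.
move=> mut.
pose A := Dt t `*` D01.
pose k (p : R * R) (q : R) : R := (if q < p.1 then 1 else 0) * ut q p.2.
have mA : @measurable _ (measurableTypeR R * measurableTypeR R)%type A.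
  exact: measurableX.
have mk : @measurable_fun _ _ ((measurableTypeR R * measurableTypeR R) * measurableTypeR R)%type R
   (A `*` Dt t) (fun z => k z.1 z.2).
  apply: measurable_funM.
    apply: measurable_funTS; apply: measurable_fun_ifT => //.
    apply: measurable_fun_ltr; first exact: measurable_snd.
    by apply: measurableT_comp; [exact: measurable_fst|exact: measurable_fst].
  apply: (measurable_comp (F := Dt t `*` D01) (f := fun p : R * R => ut p.1 p.2)
    (g := fun z : (R * R) * R => (z.2, z.1.2))) => //.
  - by move=> _ /= [[[r x] q] [[/= ? ?] ?] <-].
  - apply: measurable_funTS; apply/measurable_fun_pairP; split => /=.
      exact: measurable_snd.
    exact: (measurableT_comp measurable_snd measurable_fst).
have := measurable_Rint_rect leb mA (measurableDt t) (u := k) mk.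
apply: eq_measurable_fun => -[r x] /set_mem[/=]; rewrite in_itv /= => /andP[r0 rt] _.
rewrite -(Rint_if_lt (fun q => ut q x) (ltW rt)).
by apply: Rint_eq => q _; rewrite /k /=; case: ifP; rewrite ?mul1r ?mul0r.
Qed.

Lemma measurable_section u r : measurable_loc u -> 0 < r ->
  measurable_fun D01 (u r).
Proof.
move=> mu r0.
apply: (measurable_comp (F := Dt (r + 1) `*` D01) (f := fun p : R * R => u p.1 p.2)
    (g := fun x : R => (r, x))) => //.
- exact: measurableX.
- move=> _ /= [x x01 <-]; split => //=.
  by rewrite in_itv /= r0 ltrDl ltr01.
- apply: measurable_funTS; exact: measurable_pair1.
Qed.

(** The null sets of [evol] depend on time, so [u] itself cannot be differentiated in time at fixed
    [x]. It is replaced by [U], which for almost every [x] is an exact primitive of [ut] in time and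
    at every time equals [u] almost everywhere. The rule for squares at fixed [x], then Fubini, give
    the result. *)
Lemma evol_energy T u ut : measurable_loc u -> measurable_loc ut ->
  L2loc u -> L2loc ut -> (forall t, 0 <= t -> L2 (u t)) -> evol u ut ->
  primitive T (fun t => \int[leb]_(x in D01) (u t x ^+ 2))
    (fun r => \int[leb]_(x in D01) (2 * ut r x * u r x)).
Proof.
move=> mu mut Lu Lut L2u eu.
have ik S : itg leb2 (Dt S `*` D01) (fun p => 2 * ut p.1 p.2 * u p.1 p.2).
  have := itgZ (mu := leb2) 2 (measurableQ S) (itgM_sq (mu := leb2) (measurableQ S) (mut S) (mu S) (Lut S) (Lu S)).
  by apply: (itg_eq (mu := leb2) (measurableQ S)) => p _; rewrite mulrA.
split; first exact: (itg_Rint_snd (u := fun r x => 2 * ut r x * u r x) _ _ (ik T)).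
move=> t /andP[t0 _].
pose U r x := u 0 x + \int[leb]_(q in Dt r) ut q x.
have mU : measurable_fun (Dt t `*` D01) (fun p : R * R => U p.1 p.2).
  apply: measurable_funD; last exact: measurable_time_integral.
  by apply: (measurable_snd_rect (f := u 0)) => //; exact: L2_measurable (L2u 0 (lexx 0)).
have mUr r : 0 <= r -> measurable_fun D01 (U r).
  move=> r0; apply: measurable_funD; first exact: L2_measurable (L2u 0 (lexx 0)).
  by apply: (itg_measurable (mu := leb)); exact: itg_Rint_fst (L2loc_itg r mut Lut).
have Uu r : 0 <= r -> {ae leb, forall x, D01 x -> U r x = u r x}.
  move=> r0; have := eu r r0; apply: filterS; first exact: (ae_filter_ringOfSetsType leb).
  by move=> x /= + Dx => /(_ Dx) ->.
(* By Tonelli, square integrability of [u] passes to [U]: the inner integrals coincide at each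
   time. *)
have U2 : itg leb2 (Dt t `*` D01) (fun p => U p.1 p.2 ^+ 2).
  have mU2 : measurable_fun (Dt t `*` D01) (fun p : R * R => U p.1 p.2 ^+ 2).
    exact: measurable_funX.
  apply/(@itg_rectP _ _ _ _ _ leb leb _ _ (measurableDt t) measurable01 (fun r x => U r x ^+ 2)) => //.
  have mu2 : measurable_fun (Dt t `*` D01) (fun p : R * R => u p.1 p.2 ^+ 2).
    by apply: measurable_funX; exact: mu.
  have [/(_ (Lu t)) + _] := @itg_rectP _ _ _ _ _ leb leb _ _ (measurableDt t) measurable01 (fun r x => u r x ^+ 2) mu2.
  apply: le_lt_trans; rewrite le_eqVlt; apply/orP; left; apply/eqP.
  apply: eq_integral => r /set_mem; rewrite /= in_itv /= => /andP[/ltW r0 _].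
  apply: ge0_ae_eq_integral => //.
  - by apply/measurable_EFinP; apply: measurableT_comp => //; apply: measurable_funX; exact: mUr.
  - by apply/measurable_EFinP; apply: measurableT_comp => //; apply: measurable_funX; exact: L2_measurable (L2u r r0).
  - have := Uu r r0; apply: filterS; first exact: (ae_filter_ringOfSetsType leb).
    by move=> x /= + Dx => /(_ Dx) ->.
have iK : itg leb2 (Dt t `*` D01) (fun p => 2 * ut p.1 p.2 * U p.1 p.2).
  have := itgZ (mu := leb2) 2 (measurableQ t) (itgM_sq (mu := leb2) (measurableQ t) (mut t) mU (Lut t) U2).
  by apply: (itg_eq (mu := leb2) (measurableQ t)) => p _; rewrite mulrA.
have ru r : 0 <= r -> itg leb D01 (fun x => u r x ^+ 2) by move=> r0; exact/L2_itg_sq/L2u.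
apply/eqP; rewrite addrC -subr_eq; apply/eqP.
rewrite -RintegralB//; [|exact: ru|exact: ru].
transitivity (\int[leb]_(r in Dt t) \int[leb]_(x in D01) (2 * ut r x * U r x)); last first.
  apply: Rint_eq => r; rewrite /= in_itv /= => /andP[r0 _].
  have mutr : measurable_fun D01 (fun x => 2 * ut r x).
    by apply: measurable_funM => //; exact: measurable_section.
  apply: eq_Rint_ae => //.
  - by apply: measurable_funM => //; exact: mUr (ltW r0).
  - by apply: measurable_funM => //; exact: L2_measurable (L2u r (ltW r0)).
  - have := Uu r (ltW r0); apply: filterS; first exact: (ae_filter_ringOfSetsType leb).
    by move=> x /= + Dx => /(_ Dx) ->.
rewrite (Rfubini (m1 := leb) (m2 := leb) (measurableDt t) measurable01 (u := fun r x => 2 * ut r x * U r x) iK).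
apply: eq_Rint_ae => //.
- by apply: (itg_measurable (mu := leb)); apply: itgB => //; exact: ru.
- by apply: (itg_measurable (mu := leb)); exact: (itg_Rint_fst (u := fun r x => 2 * ut r x * U r x) _ _ iK).
have h1 := Uu t t0.
have h2 := ae_itg_fst (measurableDt t) measurable01 (L2loc_itg t mut Lut).
apply: filterS2 h1 h2; first exact: (ae_filter_ringOfSetsType leb).
move=> x e1 i2 Dx.
have p : primitive t (fun r => U r x) (fun r => ut r x).
  split; first exact: i2.
  by move=> s _; rewrite /U Rint_itvoo0 addr0.
rewrite -(primitive_sub (lexx 0) t0 (lexx t) (primitiveX2 p)).
by rewrite e1// /U Rint_itvoo0 addr0.
Qed.

End evolution_calculus.

Lemma L2Z {R : realType} (k : R) (f : R -> R) : L2 f -> L2 (fun x => k * f x).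
Proof.
move=> Lf; split; first by apply: measurable_funM => //; exact: L2_measurable.
apply: integrable_lty; first exact: measurable01.
have := itgZ (mu := lebesgue_measure) (k ^+ 2) measurable01 (L2_itg_sq Lf).
by apply: itg_eq; [exact: measurable01|move=> x _; rewrite exprMn].
Qed.

(** * Energy inequalities at a fixed time *)

Section rates.
Context {R : realType}.
Local Notation leb := (@lebesgue_measure R).
Local Notation D01 := (`]0, 1[%classic : set R).
Hint Resolve measurable01 : core.
Variables (mu nu wd c0 c1 alpha : R).
Hypotheses (mu_gt0 : 0 < mu) (nu_gt0 : 0 < nu) (wd_ge0 : 0 <= wd)
  (c0_gt0 : 0 < c0) (c1_gt0 : 0 < c1).
Hypotheses (alpha_ge0 : 0 <= alpha) (alpha_le : alpha <= alpha_max mu nu wd c0 c1).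

Lemma alpha_max_bounds :
  [/\ 2 * alpha * (mu + 1) <= nu, 4 * alpha * mu <= nu,
   2 * alpha * (nu + (1 + c0 + wd) * mu) <= nu * (1 + c0 + wd) &
   2 * alpha * (nu + (1 + c1 + wd) * mu) <= nu * (1 + c1 + wd)].
Proof.
have a0 : 0 < 1 + c0 + wd by rewrite ltr_wpDr// addr_gt0.
have a1 : 0 < 1 + c1 + wd by rewrite ltr_wpDr// addr_gt0.
have m1 : 0 < mu + 1 by rewrite addr_gt0.
have m2 : 0 < 2 * mu + nu by rewrite addr_gt0// mulr_gt0.
have m3 : 0 < nu + (1 + c0 + wd) * mu by rewrite addr_gt0// mulr_gt0.
have m4 : 0 < nu + (1 + c1 + wd) * mu by rewrite addr_gt0// mulr_gt0.
have : 2 * alpha <= 2 * alpha_max mu nu wd c0 c1 by rewrite ler_wpM2l.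
rewrite /alpha_max mulrA divff ?mul1r// !le_min => /and4P[h1 h2 h3 h4].
rewrite ler_pdivlMr// in h1; rewrite ler_pdivlMr// in h2.
rewrite ler_pdivlMr// in h3; rewrite ler_pdivlMr// in h4.
(* The second entry of the minimum gives [2 alpha (2 mu + nu) <= nu], from which [2 alpha nu] is
   dropped. *)
split => //; have : 0 <= alpha * nu by rewrite mulr_ge0// ltW.
nra.
Qed.

Section fixed_time.
Variables (v vx vxx vt vxt vxxt : R -> R).
Hypotheses (Hv : H2 v vx vxx) (Hvt : H2 vt vxt vxxt).
Hypothesis pde : {ae leb, forall x, 0 < x < 1 ->
  vt x - mu * vxxt x - nu * vxx x + (1 + wd) * vx x + v x * vx x = 0}.
Hypothesis feedback0 :
  vx 0 = nu^-1 * ((c0 + 1 + wd) * v 0 + 2 / (9 * c0) * v 0 ^+ 3).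
Hypothesis feedback1 :
  vx 1 = - nu^-1 * ((c1 + 1 + wd) * v 1 + 2 / (9 * c1) * v 1 ^+ 3).
Hypothesis feedback_t0 :
  vxt 0 = nu^-1 * ((c0 + 1 + wd) * vt 0 + 2 / (9 * c0) * (3 * v 0 ^+ 2 * vt 0)).
Hypothesis feedback_t1 :
  vxt 1 = - nu^-1 * ((c1 + 1 + wd) * vt 1 + 2 / (9 * c1) * (3 * v 1 ^+ 2 * vt 1)).

(** The time derivative of [E1] when the boundary values [y0], [y1] move with velocities [g0], [g1].
    The velocities are arguments because they will be supplied as values of [tr]. *)
Definition E1_rate (y0 y1 g0 g1 : R) : R :=
  2 * (c0 + 1 + wd) * y0 * g0 + 4 / (3 * c0) * y0 ^+ 3 * g0 +
  (2 * (c1 + 1 + wd) * y1 * g1 + 4 / (3 * c1) * y1 ^+ 3 * g1).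

Definition E2_rate (y0 y1 g0 g1 : R) : R :=
  2 * (c0 + 1 + wd) * y0 * g0 + 4 / (9 * c0) * y0 ^+ 3 * g0 +
  (2 * (c1 + 1 + wd) * y1 * g1 + 4 / (9 * c1) * y1 ^+ 3 * g1).

(* [c y^2 + y^4 / (9 c) - 2/3 |y|^3 = (3 c |y| - y^2)^2 / (9 c)] *)
Lemma cubic_absorption (c y : R) : 0 < c ->
  2 / 3 * `|y ^+ 3| <= c * y ^+ 2 + y ^+ 4 / (9 * c).
Proof.
move=> c0'; have c9 : 0 < 9 * c by lra.
have -> : c * y ^+ 2 + y ^+ 4 / (9 * c) = (9 * c ^+ 2 * y ^+ 2 + y ^+ 4) / (9 * c).
  by field; rewrite gt_eqF.
rewrite ler_pdivlMr// normrX.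
rewrite (_ : y ^+ 4 = `|y| ^+ 4); last by rewrite -normrX ger0_norm// exprn_even_ge0.
rewrite -[y ^+ 2]real_normK ?num_real//.
have := sqr_ge0 (3 * c * `|y| - `|y| ^+ 2).
by set z := `|y|; rewrite !exprS !expr0; lra.
Qed.

(** At the end 0 the balance closes exactly: the feedback gives
    [- 2 (c0 + 1 + wd) v^2 - 4 v^4 / (9 c0)], convection gives back [(1 + wd) v^2] and [2/3 v^3],
    and absorbing the cubic costs [c0 v^2 + v^4 / (9 c0)], which leaves the [c0] part of [- E1]. At
    the end 1 the quadratic convection term has the favourable sign. *)
Lemma first_energy_rate :
  2 * \int[leb]_(x in D01) (vt x * v x)
  + mu * (2 * \int[leb]_(x in D01) (vxt x * vx x))
  + mu / nu * E1_rate (v 0) (v 1) (vt 0) (vt 1) <=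
  - (2 * nu * L2norm vx ^+ 2) - E1 wd c0 c1 v.
Proof.
have := energy_identity Hv Hvt pde.
rewrite feedback0 feedback1 feedback_t0 feedback_t1 L2norm_sq.
set A := Rintegral _ _ _; set B := Rintegral _ _ _; set N := Rintegral _ _ _.
have := cubic_absorption (v 0) c0_gt0; have := cubic_absorption (v 1) c1_gt0.
have := ler_norm (v 0 ^+ 3); have := ler_norm (- v 1 ^+ 3); rewrite normrN.
move=> n1 n0 q1 q0 e.
have {e} -> : 2 * A + mu * (2 * B) + mu / nu * E1_rate (v 0) (v 1) (vt 0) (vt 1)
   = - (2 * nu * N) - 2 * ((c0 + 1 + wd) * v 0 ^+ 2 + 2 / (9 * c0) * v 0 ^+ 4)
     - 2 * ((c1 + 1 + wd) * v 1 ^+ 2 + 2 / (9 * c1) * v 1 ^+ 4)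
     - (1 + wd) * (v 1 ^+ 2 - v 0 ^+ 2) - 2 / 3 * (v 1 ^+ 3 - v 0 ^+ 3).
  rewrite /E1_rate -[LHS]subr0 -[X in _ - X = _](mulr0 2) -[X in _ - 2 * X = _]e.
  by field; rewrite !gt_eqF.
have e0 : 1 / (3 * c0) * v 0 ^+ 4 = 3 * (v 0 ^+ 4 / (9 * c0)) by field; rewrite gt_eqF.
have e1 : 1 / (3 * c1) * v 1 ^+ 4 = 3 * (v 1 ^+ 4 / (9 * c1)) by field; rewrite gt_eqF.
have f0 : 2 / (9 * c0) * v 0 ^+ 4 = 2 * (v 0 ^+ 4 / (9 * c0)) by ring.
have f1 : 2 / (9 * c1) * v 1 ^+ 4 = 2 * (v 1 ^+ 4 / (9 * c1)) by ring.
have -> : E1 wd c0 c1 v = (c0 + 1 + wd) * v 0 ^+ 2 + 3 * (v 0 ^+ 4 / (9 * c0))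
   + ((c1 + 1 + wd) * v 1 ^+ 2 + 3 * (v 1 ^+ 4 / (9 * c1))).
  by rewrite -e0 -e1 /E1; ring.
rewrite f0 f1.
have := mulr_ge0 wd_ge0 (sqr_ge0 (v 0)); have := mulr_ge0 wd_ge0 (sqr_ge0 (v 1)).
have := sqr_ge0 (v 0); have := sqr_ge0 (v 1).
nra.
Qed.

(** Half of the dissipation [2 nu |vx|^2] is kept. The other half pays for
    [2 alpha (mu + 1) |vx|^2], where the 1 comes from Poincare's inequality; the quadratic part of
    [E1] pays for the traces in that inequality and for its own multiple [2 alpha mu / nu], and the
    quartic part for its own multiple. *)
Lemma first_energy_decay :
  2 * alpha * (L2norm v ^+ 2 + mu * L2norm vx ^+ 2 + mu / nu * E1 wd c0 c1 v)
  + (2 * \int[leb]_(x in D01) (vt x * v x)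
     + mu * (2 * \int[leb]_(x in D01) (vxt x * vx x))
     + mu / nu * E1_rate (v 0) (v 1) (vt 0) (vt 1)) <=
  - (nu * L2norm vx ^+ 2).
Proof.
have r := first_energy_rate; have [A1 A2 A3 A4] := alpha_max_bounds.
have p := poincare Hv.1.
set r' := (_ + _ * E1_rate _ _ _ _) in r *.
apply: (@le_trans _ _ (2 * alpha * (L2norm v ^+ 2 + mu * L2norm vx ^+ 2 +
  mu / nu * E1 wd c0 c1 v) + (- (2 * nu * L2norm vx ^+ 2) - E1 wd c0 c1 v))).
  by rewrite lerD2l.
move=> {r r'}.
set n0 := L2norm v ^+ 2 in p *; set n1 := L2norm vx ^+ 2 in p *.
have n1_ge0 : 0 <= n1 by exact: sqr_ge0.
have -> : E1 wd c0 c1 v = (c0 + 1 + wd) * v 0 ^+ 2 + 1 / (3 * c0) * v 0 ^+ 4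
   + ((c1 + 1 + wd) * v 1 ^+ 2 + 1 / (3 * c1) * v 1 ^+ 4) by rewrite /E1; ring.
set y0 := v 0 ^+ 2 in p *; set y1 := v 1 ^+ 2 in p *.
set z0 := 1 / (3 * c0) * v 0 ^+ 4; set z1 := 1 / (3 * c1) * v 1 ^+ 4.
have y0_ge0 : 0 <= y0 by exact: sqr_ge0.
have y1_ge0 : 0 <= y1 by exact: sqr_ge0.
have z0_ge0 : 0 <= z0 by rewrite mulr_ge0 ?exprn_even_ge0// divr_ge0// mulr_ge0// ltW.
have z1_ge0 : 0 <= z1 by rewrite mulr_ge0 ?exprn_even_ge0// divr_ge0// mulr_ge0// ltW.
have nun : nu != 0 by rewrite gt_eqF.
have h1 : 2 * alpha * n0 <= 2 * alpha * (y0 + y1 + n1).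
  by rewrite ler_wpM2l// mulr_ge0.
have h2 : 2 * alpha * (mu + 1) * n1 <= nu * n1 by rewrite ler_wpM2r.
have k c : 2 * alpha * (nu + (1 + c + wd) * mu) <= nu * (1 + c + wd) ->
    2 * alpha * (1 + mu / nu * (c + 1 + wd)) <= c + 1 + wd.
  move=> h; rewrite -(ler_pM2r nu_gt0).
  rewrite (_ : _ * nu = 2 * alpha * (nu + (1 + c + wd) * mu)); last by field.
  by rewrite (le_trans h)//; lra.
have h3 : 2 * alpha * (1 + mu / nu * (c0 + 1 + wd)) * y0 <= (c0 + 1 + wd) * y0.
  by rewrite ler_wpM2r//; exact: k.
have h4 : 2 * alpha * (1 + mu / nu * (c1 + 1 + wd)) * y1 <= (c1 + 1 + wd) * y1.
  by rewrite ler_wpM2r//; exact: k.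
have a2 : 2 * alpha * (mu / nu) <= 1.
  rewrite -(ler_pM2r nu_gt0) (_ : _ * nu = 2 * alpha * mu); last by field.
  by have := mulr_ge0 alpha_ge0 (ltW mu_gt0); lra.
have h5 : 2 * alpha * (mu / nu) * z0 <= 1 * z0 by rewrite ler_wpM2r.
have h6 : 2 * alpha * (mu / nu) * z1 <= 1 * z1 by rewrite ler_wpM2r.
set m := mu / nu in h3 h4 h5 h6 *.
rewrite (_ : _ + _ = 2 * alpha * n0 + 2 * alpha * mu * n1
  + 2 * alpha * m * (c0 + 1 + wd) * y0 + 2 * alpha * m * (c1 + 1 + wd) * y1
  + 2 * alpha * m * z0 + 2 * alpha * m * z1
  - 2 * nu * n1 - (c0 + 1 + wd) * y0 - (c1 + 1 + wd) * y1 - z0 - z1); last by ring.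
lra.
Qed.

(** The feedback makes the boundary terms exactly the rate of [E2 / nu], so no boundary dissipation
    remains to balance [2 alpha E2 / nu]. *)
Lemma second_energy_rate :
  2 * \int[leb]_(x in D01) (vxt x * vx x)
  + mu * (2 * \int[leb]_(x in D01) (vxxt x * vxx x))
  + nu^-1 * E2_rate (v 0) (v 1) (vt 0) (vt 1) =
  - (2 * nu * L2norm vxx ^+ 2)
  + 2 * (1 + wd) * \int[leb]_(x in D01) (vx x * vxx x)
  + 2 * \int[leb]_(x in D01) (v x * vx x * vxx x).
Proof.
have := second_energy_identity Hv Hvt pde.
rewrite feedback0 feedback1 L2norm_sq.
set A := Rintegral _ _ _; set B := Rintegral _ _ _; set N := Rintegral _ _ _.
set X := Rintegral _ _ _; set Y := Rintegral _ _ _ => e.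
rewrite /E2_rate; apply/eqP; rewrite -subr_eq0; apply/eqP.
transitivity (2 * ((A - (vt 1 * (- nu^-1 * ((c1 + 1 + wd) * v 1 + 2 / (9 * c1) * v 1 ^+ 3)) -
   vt 0 * (nu^-1 * ((c0 + 1 + wd) * v 0 + 2 / (9 * c0) * v 0 ^+ 3)))
   + mu * B + nu * N) - ((1 + wd) * X + Y))).
  by field; rewrite !gt_eqF.
by rewrite e subrr mulr0.
Qed.

(** With [a = c + 1 + wd] and [k = 1 / (9 c)], the square of [a y + 2 k y^3] exceeds
    [a (a + k y^2) y^2] by nonnegative terms only. *)
Lemma E2_trace (c y p : R) : 0 < c -> p = nu^-1 * ((c + 1 + wd) * y + 2 / (9 * c) * y ^+ 3) ->
  ((c + 1 + wd) + 1 / (9 * c) * y ^+ 2) * y ^+ 2 <= nu ^+ 2 / (c + 1 + wd) * p ^+ 2.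
Proof.
move=> c_gt0 ->; have a0 : 0 < c + 1 + wd by rewrite ltr_wpDr// addr_gt0.
have nun : nu != 0 by rewrite gt_eqF.
set X := _ * y + _.
rewrite (_ : nu ^+ 2 / (c + 1 + wd) * (nu^-1 * X) ^+ 2 = X ^+ 2 / (c + 1 + wd)); last first.
  by field; rewrite nun gt_eqF.
rewrite {}/X.
rewrite ler_pdivlMr//.
have : 0 <= (c + 1 + wd) * (y ^+ 4 / (9 * c)).
  by rewrite mulr_ge0 ?(ltW a0)// divr_ge0 ?exprn_even_ge0// mulr_ge0// ltW.
have := sqr_ge0 (2 / (9 * c) * y ^+ 3).
rewrite div1r; set a := c + 1 + wd; set k := (9 * c)^-1 => h1 h2.
rewrite (_ : (a * y + 2 * k * y ^+ 3) ^+ 2 = (a + k * y ^+ 2) * y ^+ 2 * a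
   + 3 * (a * (y ^+ 4 * k)) + (2 * k * y ^+ 3) ^+ 2); last by ring.
by lra.
Qed.

(* [2 alpha E2 / nu] is at most [kappa] times a bound for the squared traces of
   [vx]; the weight of [|vxx|^2] in that bound makes its share at most
   [nu / 4 |vxx|^2]. *)
Definition kappa : R := 2 * alpha * nu * ((c0 + 1 + wd)^-1 + (c1 + 1 + wd)^-1).

Definition trace_weight : R := nu / (4 * (kappa + 1)).

(** The coefficients of [|vx|^2] from, in order, [2 alpha G], the trace bound for [E2], and Young's
    inequality with weight [nu / 8] for the linear and the nonlinear convective term. *)
Definition source (M : R) : R :=
  2 * alpha + kappa * (1 + trace_weight^-1) + 8 / nu * ((1 + wd) ^+ 2 + M).

Let a0_gt0 : 0 < c0 + 1 + wd. Proof. by rewrite ltr_wpDr// addr_gt0. Qed.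
Let a1_gt0 : 0 < c1 + 1 + wd. Proof. by rewrite ltr_wpDr// addr_gt0. Qed.

Lemma kappa_ge0 : 0 <= kappa.
Proof.
by rewrite /kappa mulr_ge0 ?mulr_ge0 ?addr_ge0 ?invr_ge0 ?(ltW a0_gt0) ?(ltW a1_gt0) ?(ltW nu_gt0).
Qed.

Lemma trace_weight_gt0 : 0 < trace_weight.
Proof. by rewrite divr_gt0// mulr_gt0// ltr_wpDl// kappa_ge0. Qed.

(** Of the dissipation [2 nu |vxx|^2], at most [nu] goes to [2 alpha mu |vxx|^2], [nu / 4] to the
    traces and [nu / 8] to each convective term, leaving [nu / 2]. *)
Lemma second_energy_decay (M : R) : (forall x, 0 < x < 1 -> v x ^+ 2 <= M) ->
  2 * alpha * (L2norm vx ^+ 2 + mu * L2norm vxx ^+ 2 + nu^-1 * E2 wd c0 c1 v)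
  + (2 * \int[leb]_(x in D01) (vxt x * vx x)
     + mu * (2 * \int[leb]_(x in D01) (vxxt x * vxx x))
     + nu^-1 * E2_rate (v 0) (v 1) (vt 0) (vt 1)) <=
  - (nu / 2 * L2norm vxx ^+ 2) + source M * L2norm vx ^+ 2.
Proof.
move=> vM; have [H1v H1vx] := Hv.
have [A1 _ _ _] := alpha_max_bounds.
have [t0 t1] := trace_ineq trace_weight_gt0 H1vx.
rewrite second_energy_rate.
have e20 := E2_trace c0_gt0 feedback0.
have e21 : ((c1 + 1 + wd) + 1 / (9 * c1) * v 1 ^+ 2) * v 1 ^+ 2 <=
    nu ^+ 2 / (c1 + 1 + wd) * vx 1 ^+ 2.
  by rewrite -(sqrrN (vx 1)); apply: E2_trace => //; rewrite feedback1 mulNr opprK.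
have Lx := H1_L2' H1v; have Lxx := H1_L2' H1vx.
have Lv := L2M_H1 Lx H1v.
have d8 : 0 < nu / 8 by rewrite divr_gt0.
have i1 := L2_itg_sq Lx; have i2 := L2_itg_sq Lxx.
have bound (f : R -> R) (k : R) : L2 f -> (forall x, 0 < x < 1 -> f x ^+ 2 <= k * vx x ^+ 2) ->
    2 * \int[leb]_(x in D01) (f x * vxx x) <=
    nu / 8 * L2norm vxx ^+ 2 + 8 / nu * k * L2norm vx ^+ 2.
  move=> Lf fk; rewrite !L2norm_sq -!RintegralZl//; last exact: L2_itgM.
  rewrite -RintegralD//; [|exact: itgZ|exact: itgZ].
  apply: le_Rintegral => //.
  - by apply: itgZ => //; exact: L2_itgM.
  - by apply: itgD => //; exact: itgZ.
  move=> x; rewrite /= in_itv /= => x01.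
  have := amgm (vxx x) (f x) d8; rewrite invf_div.
  have : 8 / nu * f x ^+ 2 <= 8 / nu * (k * vx x ^+ 2).
    by rewrite ler_wpM2l ?fk// divr_ge0// ltW.
  have := ler_norm (f x * vxx x); rewrite normrM; lra.
have b1 := bound (fun x => v x * vx x) M Lv.
have {}b1 : 2 * \int[leb]_(x in D01) (v x * vx x * vxx x) <=
    nu / 8 * L2norm vxx ^+ 2 + 8 / nu * M * L2norm vx ^+ 2.
  by apply: b1 => x x01; rewrite exprMn ler_wpM2r ?sqr_ge0// vM.
have b2 : 2 * \int[leb]_(x in D01) ((1 + wd) * vx x * vxx x) <=
    nu / 8 * L2norm vxx ^+ 2 + 8 / nu * (1 + wd) ^+ 2 * L2norm vx ^+ 2.
  apply: (bound (fun x => (1 + wd) * vx x)).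
    exact: L2Z.
  by move=> x _; rewrite exprMn.
have {}b2 : 2 * (1 + wd) * \int[leb]_(x in D01) (vx x * vxx x) <=
    nu / 8 * L2norm vxx ^+ 2 + 8 / nu * (1 + wd) ^+ 2 * L2norm vx ^+ 2.
  apply: le_trans b2; rewrite -mulrA -RintegralZl//; last exact: L2_itgM.
  rewrite le_eqVlt; apply/orP; left; apply/eqP; congr (2 * _).
  by apply: Rint_eq => x _; rewrite mulrA.
set n1 := L2norm vx ^+ 2 in t0 t1 b1 b2 *; set n2 := L2norm vxx ^+ 2 in t0 t1 b1 b2 *.
have n1_ge0 : 0 <= n1 by exact: sqr_ge0.
have n2_ge0 : 0 <= n2 by exact: sqr_ge0.
set S := (1 + trace_weight^-1) * n1 + trace_weight * n2 in t0 t1.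
have e : 2 * alpha * (nu^-1 * E2 wd c0 c1 v) <= kappa * S.
  apply: (@le_trans _ _ (2 * alpha * (nu^-1 * (nu ^+ 2 / (c0 + 1 + wd) * S +
      nu ^+ 2 / (c1 + 1 + wd) * S)))).
    rewrite ler_wpM2l ?mulr_ge0// ler_wpM2l ?invr_ge0 ?(ltW nu_gt0)// lerD//.
      by apply: (le_trans e20); rewrite ler_wpM2l// divr_ge0 ?sqr_ge0 ?(ltW a0_gt0).
    by apply: (le_trans e21); rewrite ler_wpM2l// divr_ge0 ?sqr_ge0 ?(ltW a1_gt0).
  rewrite le_eqVlt; apply/orP; left; apply/eqP; rewrite /kappa.
  by field; rewrite !gt_eqF.
have kd : kappa * trace_weight * n2 <= nu / 4 * n2.
  rewrite ler_wpM2r// /trace_weight.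
  have k1 : 0 < kappa + 1 by rewrite ltr_wpDl// kappa_ge0.
  rewrite (_ : kappa * _ = (nu / 4) * (kappa / (kappa + 1))); last first.
    by field; rewrite gt_eqF.
  rewrite ler_piMr ?divr_ge0 ?(ltW nu_gt0)// ler_pdivrMr// mul1r lerDl ler01//.
have am : 2 * alpha * mu * n2 <= nu * n2.
  by rewrite ler_wpM2r// (le_trans _ A1)// ler_wpM2l ?mulr_ge0// lerDl.
rewrite /source -/n1; rewrite /S in e; lra.
Qed.

End fixed_time.
End rates.

(** * Scalar functions of time *)

Section time_functions.
Context {R : realType}.
Local Notation leb := (@lebesgue_measure R).
Local Notation D01 := (`]0, 1[%classic : set R).
Local Notation Dt T := (`]0, T[%classic : set R).
Implicit Types (F G f g B : R -> R) (T t k : R).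
Hint Resolve measurable01 measurableDt : core.

(** A null set contains no interval []m, m + 1[]. Any horizon [T] thus lies below a time at which
    the almost everywhere bound holds, and integrals up to [T] are finite. *)
Lemma ae_exists_gt (P : R -> Prop) : {ae leb, forall t, 0 < t -> P t} ->
  forall T, exists t, [/\ T < t, 0 < t & P t].
Proof.
move=> [A [mA A0 sub]] T; apply: contrapT => nex.
pose m := Num.max T 0.
have mA' : `]m, m + 1[ `<=` A.
  move=> t /=; rewrite in_itv /= gt_max => /andP[/andP[Tt t0] _].
  by apply: sub => /= h; apply: nex; exists t; split => //; exact: h.
have : (lebesgue_measure ([set` `]m, (m + 1)%R[] : set R) <= leb A)%E.
  by apply: le_measure => //; rewrite inE //; exact: measurable_itv.
rewrite A0 lebesgue_measure_itv /= lte_fin ltrDl ltr01.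
by rewrite -EFinB lee_fin addrAC subrr add0r ler10.
Qed.

(** Used to differentiate an identity between absolutely continuous functions, such as a feedback
    law. *)
Lemma primitive_ae_unique T F G f g : primitive T F f -> primitive T G g ->
  (forall t, 0 < t < T -> F t = G t) ->
  {ae leb, forall t, Dt T t -> f t = g t}.
Proof.
move=> pF pG FG; have [itf _] := pF; have [ig _] := pG.
have : {ae leb, forall t, Dt T t -> f t - g t = 0}.
  apply: ae0_Rint_itv; first exact: itgB.
  move=> s t s0 st tT.
  rewrite RintegralB//; last 2 first.
  - by apply: itg_itvoo_sub itf; exact: ltW.
  - by apply: itg_itvoo_sub ig; exact: ltW.
  rewrite -(primitive_sub (ltW s0) (ltW st) (ltW tT) pF).
  rewrite -(primitive_sub (ltW s0) (ltW st) (ltW tT) pG).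
  by rewrite !FG ?subrr// ?s0 ?tT ?(lt_trans st)// (lt_trans s0).
apply: filterS; first exact: (ae_filter_ringOfSetsType leb).
by move=> x /= + Dx => /(_ Dx)/eqP; rewrite subr_eq0 => /eqP.
Qed.

Lemma primitive_expR T k :
  primitive T (fun t => expR (k * t)) (fun t => k * expR (k * t)).
Proof.
have d x : is_derive x (1 : R) (fun t => k * t) k.
  apply: (@is_derive_quadratic _ _ _ _ 0) => y.
  by rewrite mul0r (_ : _ - _ - _ = 0) ?normr0//; ring.
apply: primitive_derive.
  move=> x; have := @is_derive1_comp _ expR (fun t => k * t) x _ _ (is_derive_expR (k * x)) (d x).
  by rewrite mulrC.
move=> x; apply: cvgM; first exact: cvg_cst.
apply: (@continuous_comp _ _ _ (fun t => k * t) expR); last exact: continuous_expR.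
by apply: cvgM; [exact: cvg_cst|exact: cvg_id].
Qed.

Lemma itg_expR_mul T k B : itg leb (Dt T) B ->
  itg leb (Dt T) (fun s => expR (k * s) * B s).
Proof.
move=> iB; have := itgM_primitive (primitive_expR T k) iB.
by apply: itg_eq => // s _; rewrite mulrC.
Qed.

(* Integrated form of [(e^(k t) F)' <= e^(k t) B]. *)
Lemma primitive_expR_le T k F f B : 0 <= T -> primitive T F f ->
  itg leb (Dt T) B ->
  {ae leb, forall s, Dt T s -> k * F s + f s <= B s} ->
  expR (k * T) * F T - F 0 <= \int[leb]_(s in Dt T) (expR (k * s) * B s).
Proof.
move=> T0 pF iB le_B; have p := primitiveM (primitive_expR T k) pF.
have := primitive_sub (lexx 0) T0 (lexx T) p.
rewrite mulr0 expR0 mul1r => ->; apply: le_Rint_ae => //.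
- by case: p.
- exact: itg_expR_mul.
apply: filterS le_B; first exact: (ae_filter_ringOfSetsType leb).
move=> s /= + Ds => /(_ Ds) h.
rewrite (_ : _ + _ = expR (k * s) * (k * F s + f s)); last by ring.
by rewrite ler_wpM2l// expR_ge0.
Qed.

Lemma primitive_quartic T F f (a b : R) : primitive T F f ->
  primitive T (fun t => (a + b * F t ^+ 2) * F t ^+ 2)
    (fun t => 2 * a * F t * f t + 4 * b * F t ^+ 3 * f t).
Proof.
move=> pF; have p2 := primitiveX2 pF; have p4 := primitiveX2 p2.
by apply: (primitive_eq (primitiveD (primitiveZ a p2) (primitiveZ b p4))) => t _; ring.
Qed.

Lemma primitive_cubic T F f (a b : R) : primitive T F f ->
  primitive T (fun t => a * F t + b * F t ^+ 3)
    (fun t => a * f t + b * (3 * F t ^+ 2 * f t)).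
Proof.
move=> pF; have p3 := primitiveM (primitiveX2 pF) pF.
by apply: (primitive_eq (primitiveD (primitiveZ a pF) (primitiveZ b p3))) => t _; ring.
Qed.

Lemma measurable_L2norm_sq (u : R -> R -> R) T : measurable_loc u ->
  measurable_fun (Dt T) (fun s => L2norm (u s) ^+ 2).
Proof.
move=> mu.
have mu2 : measurable_fun (Dt T `*` D01) (fun p : R * R => u p.1 p.2 ^+ 2).
  by apply: measurable_funX; exact: mu.
have := measurable_Rint_rect leb (measurableDt T) measurable01 (u := fun t x => u t x ^+ 2) mu2.
by apply: eq_measurable_fun => s _; rewrite L2norm_sq.
Qed.

Lemma L2loc_bounded (u : R -> R -> R) (K : R) : measurable_loc u ->
  {ae leb, forall t, 0 < t -> L2 (u t)} ->
  {ae leb, forall t, 0 < t -> L2norm (u t) ^+ 2 <= K} -> L2loc u.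
Proof.
move=> mu Lu hK; apply: L2locP => // T.
have m := measurable_L2norm_sq (T := T) mu.
apply: (@le_lt_trans _ _ (\int[leb]_(s in Dt T) (`|K|)%:E)%E).
  apply: ae_ge0_le_integral => //.
  - by move=> s _; rewrite lee_fin sqr_ge0.
  - exact/measurable_EFinP.
  - apply: filterS hK; first exact: (ae_filter_ringOfSetsType leb).
    move=> s /= + Ds => /(_ _); move: Ds; rewrite in_itv /= => /andP[s0 _] /(_ s0) h.
    by rewrite lee_fin (le_trans h)// ler_norm.
by apply: integrable_lty => //; exact: (itg_cst_itvoo 0 T `|K|).
Qed.

End time_functions.

(** * Regularity of the closed-loop solution in time *)

Section closed_loop.
Context {R : realType}.
Local Notation leb := (@lebesgue_measure R).
Local Notation D01 := (`]0, 1[%classic : set R).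
Local Notation Dt T := (`]0, T[%classic : set R).
Hint Resolve measurable01 measurableDt : core.
Variables (mu nu wd c0 c1 alpha : R).
Hypotheses (mu_gt0 : 0 < mu) (nu_gt0 : 0 < nu) (wd_ge0 : 0 <= wd)
  (c0_gt0 : 0 < c0) (c1_gt0 : 0 < c1).
Hypotheses (alpha_ge0 : 0 <= alpha) (alpha_le : alpha <= alpha_max mu nu wd c0 c1).
Variables (w0 : R -> R) (w wx wxx wt wxt wxxt : R -> R -> R).
Hypothesis w_sol : closed_loop_solution mu nu wd c0 c1 w0 w wx wxx wt wxt wxxt.

Lemma sol_measurable_loc :
  [/\ measurable_loc w, measurable_loc wx & measurable_loc wxx] /\
  [/\ measurable_loc wt, measurable_loc wxt & measurable_loc wxxt].
Proof.
have [[? ? ?] [? ? ?]] := sol_measurable w_sol.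
by split; split; exact: jointly_measurable_loc.
Qed.

Lemma sol_H1 t : 0 <= t -> H1 (w t) (wx t).
Proof. by move=> /(sol_space w_sol)[]. Qed.

Lemma sol_H1x t : 0 <= t -> H1 (wx t) (wxx t).
Proof. by move=> /(sol_space w_sol)[]. Qed.

Lemma sol_time_H1 : {ae leb, forall t, 0 < t -> H1 (wt t) (wxt t)}.
Proof.
apply: filterS (sol_time_space w_sol); first exact: (ae_filter_ringOfSetsType leb).
by move=> t /= + t0 => /(_ t0)[].
Qed.

Lemma sol_time_H1x : {ae leb, forall t, 0 < t -> H1 (wxt t) (wxxt t)}.
Proof.
apply: filterS (sol_time_space w_sol); first exact: (ae_filter_ringOfSetsType leb).
by move=> t /= + t0 => /(_ t0)[].
Qed.

(** Every summand of the extended inequality [sol_bound] is nonnegative, so each is bounded and the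
    time integral is finite. That [K] does not depend on [t] is what makes the source coefficient a
    constant. *)
Lemma sol_uniform_bound : exists2 K, 0 <= K & {ae leb, forall t, 0 < t ->
  [/\ L2norm (w t) ^+ 2 + L2norm (wx t) ^+ 2 <= K, L2norm (wxx t) ^+ 2 <= K,
    L2norm (wt t) ^+ 2 <= K, L2norm (wxt t) ^+ 2 <= K / mu &
    (\int[leb]_(s in Dt t) (L2norm (wxxt s) ^+ 2)%:E < +oo)%E]}.
Proof.
have [_ [mt mxt mxxt]] := sol_measurable_loc.
have [K hK] := sol_bound w_sol; exists `|K| => //.
apply: filterS hK; first exact: (ae_filter_ringOfSetsType leb).
move=> t /= + t0 => /(_ t0).
set X := (L2norm (w t) ^+ 2 + _ + _ + _ + _)%R.
set J := (\int[leb]_(s in `[0%R, t]) _)%E => h.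
pose f s := L2norm (wt s) ^+ 2 + L2norm (wxt s) ^+ 2 + mu * L2norm (wxxt s) ^+ 2.
have f0 s : 0 <= f s.
  apply: addr_ge0; first by apply: addr_ge0; exact: sqr_ge0.
  by apply: mulr_ge0; [exact: ltW|exact: sqr_ge0].
have J0 : (0 <= J)%E.
  by apply: integral_ge0 => s _; rewrite lee_fin f0.
have XK : X <= `|K|.
  rewrite -lee_fin (@le_trans _ _ K%:E)//; last by rewrite lee_fin ler_norm.
  by apply: le_trans h; rewrite leeDl.
have JK : (J < +oo)%E.
  rewrite ltey; apply/negP => /eqP Joo; move: h; rewrite Joo addey//.
have [s1 s2 s3 s4 s5] : [/\ 0 <= L2norm (w t) ^+ 2, 0 <= L2norm (wx t) ^+ 2,
  0 <= L2norm (wxx t) ^+ 2, 0 <= L2norm (wt t) ^+ 2 & 0 <= mu * L2norm (wxt t) ^+ 2].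
  by split; try exact: sqr_ge0; apply: mulr_ge0; [exact: ltW|exact: sqr_ge0].
split; rewrite ?ler_pdivlMr//; [rewrite /X in XK; lra..| |].
- by rewrite mulrC; rewrite /X in XK; lra.
have m1 := measurable_L2norm_sq (T := t) mt; have m2 := measurable_L2norm_sq (T := t) mxt.
have m3 := measurable_L2norm_sq (T := t) mxxt.
have mf : measurable_fun (Dt t) f.
  by apply: measurable_funD; [exact: measurable_funD|exact: measurable_funM].
have : (\int[leb]_(s in Dt t) (f s)%:E < +oo)%E.
  apply: le_lt_trans JK; apply: ge0_subset_integral => //.
  - apply/measurable_EFinP; exact: measurable_fun_itv_cc mf.
  - by move=> s _; rewrite lee_fin f0.
  - exact: subset_itv_oo_cc.
move=> foo; have itf : itg leb (Dt t) f by exact: ge0_itg.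
apply: integrable_lty => //.
apply: (itg_le _ _ _ (itgZ mu^-1 _ itf)) => //.
move=> s _; rewrite ger0_norm ?sqr_ge0// -ler_pdivrMl ?invr_gt0// invrK.
by rewrite lerDr addr_ge0// sqr_ge0.
Qed.

Lemma sol_L2loc : [/\ L2loc w, L2loc wx & L2loc wxx] /\
  [/\ L2loc wt, L2loc wxt & L2loc wxxt].
Proof.
have [[m mx mxx] [mt mxt mxxt]] := sol_measurable_loc.
have [K K0 hK] := sol_uniform_bound.
have aeL (u u' : R -> R -> R) : (forall t, 0 <= t -> H1 (u t) (u' t)) ->
    {ae leb, forall t, 0 < t -> L2 (u t) /\ L2 (u' t)}.
  move=> Hu; apply: aeW => t /ltW /Hu h.
  by split; [exact: H1_L2 h|exact: H1_L2' h].
have Ft := ae_filter_ringOfSetsType leb.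
have L1 := aeL _ _ sol_H1; have L2 := aeL _ _ sol_H1x.
split; split.
- apply: (@L2loc_bounded _ _ K) => //.
    by apply: filterS L1 => t /= + t0 => /(_ t0)[].
  apply: filterS hK => t /= + t0 => /(_ t0)[h _ _ _ _].
  by rewrite (le_trans _ h)// lerDl sqr_ge0.
- apply: (@L2loc_bounded _ _ K) => //.
    by apply: filterS L1 => t /= + t0 => /(_ t0)[].
  apply: filterS hK => t /= + t0 => /(_ t0)[h _ _ _ _].
  by rewrite (le_trans _ h)// lerDr sqr_ge0.
- apply: (@L2loc_bounded _ _ K) => //.
    by apply: filterS L2 => t /= + t0 => /(_ t0)[].
  by apply: filterS hK => t /= + t0 => /(_ t0)[].
- apply: (@L2loc_bounded _ _ K) => //.
    by apply: filterS sol_time_H1 => t /= + t0 => /(_ t0)/H1_L2.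
  by apply: filterS hK => t /= + t0 => /(_ t0)[].
- apply: (@L2loc_bounded _ _ (K / mu)) => //.
    by apply: filterS sol_time_H1 => t /= + t0 => /(_ t0)/H1_L2'.
  by apply: filterS hK => t /= + t0 => /(_ t0)[].
- apply: L2locP => //.
    by apply: filterS sol_time_H1x => t /= + t0 => /(_ t0)/H1_L2'.
  move=> T; have [t [Tt _ [_ _ _ _]]] := ae_exists_gt hK T.
  apply: le_lt_trans; apply: ge0_subset_integral => //.
  + by apply/measurable_EFinP; exact: measurable_L2norm_sq.
  + by move=> s _; rewrite lee_fin sqr_ge0.
  + by apply: subset_itvl; rewrite bnd_simp ltW.
Qed.

(** Only [w] is assumed to have a weak time derivative; the formulas for [wx] and [wxx] follow by
    differentiating twice in [x]. *)
Lemma sol_evol : [/\ evol w wt, evol wx wxt & evol wxx wxxt].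
Proof.
have [[m mx mxx] [mt mxt mxxt]] := sol_measurable_loc.
have [[l lx lxx] [lt lxt lxxt]] := sol_L2loc.
have e0 : evol w wt.
  apply: weak_time_derivative_evol => //.
  - by move=> t /sol_H1/H1_L2.
  - exact: sol_continuous w_sol.
  - exact: sol_time w_sol.
have e1 : evol wx wxt.
  exact: (evol_spatial_derivative mt mxt lt lxt sol_H1 sol_time_H1 e0).
split => //.
exact: (evol_spatial_derivative mxt mxxt lxt lxxt sol_H1x sol_time_H1x e1).
Qed.

Lemma trN1 (f f' : R -> R) : H1 f f' -> tr (-1) f f' = f 0.
Proof. by move=> /H1_trace ->; ring. Qed.

Lemma tr0 (f f' : R -> R) : H1 f f' -> tr 0 f f' = f 1.
Proof. by move=> /H1_trace ->; ring. Qed.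

Lemma sol_traces T :
  [/\ primitive T (fun t => w t 0) (fun r => tr (-1) (wt r) (wxt r)),
    primitive T (fun t => w t 1) (fun r => tr 0 (wt r) (wxt r)),
    primitive T (fun t => wx t 0) (fun r => tr (-1) (wxt r) (wxxt r)) &
    primitive T (fun t => wx t 1) (fun r => tr 0 (wxt r) (wxxt r))].
Proof.
have [[m mx mxx] [mt mxt mxxt]] := sol_measurable_loc.
have [[l lx lxx] [lt lxt lxxt]] := sol_L2loc.
have [e0 e1 e2] := sol_evol.
have p q := evol_trace q T mt mxt lt lxt sol_H1 e0 e1.
have px q := evol_trace q T mxt mxxt lxt lxxt sol_H1x e1 e2.
split.
- by apply: (primitive_eq (p (-1))) => // t _; ring.
- by apply: (primitive_eq (p 0)) => // t _; ring.
- by apply: (primitive_eq (px (-1))) => // t _; ring.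
- by apply: (primitive_eq (px 0)) => // t _; ring.
Qed.

(** Both sides of a feedback law are absolutely continuous in time, so their densities agree almost
    everywhere; at almost every time [wt] and [wxt] are in [H1], and the [tr] densities become point
    values. *)
Lemma sol_feedback_rate T : {ae leb, forall t, Dt T t ->
  wxt t 0 = nu^-1 * ((c0 + 1 + wd) * wt t 0 + 2 / (9 * c0) * (3 * w t 0 ^+ 2 * wt t 0)) /\
  wxt t 1 = - nu^-1 * ((c1 + 1 + wd) * wt t 1 + 2 / (9 * c1) * (3 * w t 1 ^+ 2 * wt t 1))}.
Proof.
have [p0 p1 px0 px1] := sol_traces T.
have Ft := ae_filter_ringOfSetsType leb.
have a0 := primitive_ae_unique px0
  (primitiveZ nu^-1 (primitive_cubic (c0 + 1 + wd) (2 / (9 * c0)) p0)) _.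
have a1 := primitive_ae_unique px1
  (primitiveZ (- nu^-1) (primitive_cubic (c1 + 1 + wd) (2 / (9 * c1)) p1)) _.
have {}a0 := a0 (fun t tT => sol_feedback0 w_sol (proj1 (andP tT))).
have {}a1 := a1 (fun t tT => sol_feedback1 w_sol (proj1 (andP tT))).
have h := sol_time_H1; have hx := sol_time_H1x.
apply: filterS (filterI (filterI a0 a1) (filterI h hx)) => t /= [[b0 b1] [k kx]] tT.
have t0 : 0 < t by move: tT; rewrite in_itv /= => /andP[].
have {}k := k t0; have {}kx := kx t0.
by have := b0 tT; have := b1 tT; rewrite !(trN1 k) !(tr0 k) (trN1 kx) (tr0 kx).
Qed.

End closed_loop.

(** * Integration in time and the weighted bound *)

Section decay.
Context {R : realType}.
Local Notation leb := (@lebesgue_measure R).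
Local Notation D01 := (`]0, 1[%classic : set R).
Local Notation Dt T := (`]0, T[%classic : set R).
Hint Resolve measurable01 measurableDt : core.

Lemma Rint_2M (f g : R -> R) : L2 f -> L2 g ->
  \int[leb]_(x in D01) (2 * f x * g x) = 2 * \int[leb]_(x in D01) (f x * g x).
Proof.
move=> Lf Lg; rewrite -RintegralZl//; last exact: L2_itgM.
by apply: Rint_eq => x _; rewrite mulrA.
Qed.

Lemma L2norm_ae_eq (f g : R -> R) : L2 f -> L2 g ->
  {ae leb, forall x, D01 x -> f x = g x} -> L2norm f = L2norm g.
Proof.
move=> Lf Lg fg; rewrite /L2norm; congr (Num.sqrt _).
have mf := L2_measurable Lf; have mg := L2_measurable Lg.
apply: eq_Rint_ae => //; try exact: measurable_funX.
apply: filterS fg; first exact: (ae_filter_ringOfSetsType leb).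
by move=> x /= fg Dx; rewrite fg.
Qed.

Lemma H1_derivative_eq (f f1 f' f1' : R -> R) : H1 f f' -> H1 f1 f1' ->
  (forall x, 0 <= x <= 1 -> f x = f1 x) ->
  {ae leb, forall x, D01 x -> f' x = f1' x}.
Proof.
move=> /H1_primitive p /H1_primitive p1 e; apply: (primitive_ae_unique p p1).
by move=> t /andP[t0 t1]; rewrite e// !ltW.
Qed.

(** Needed for the second derivatives of the initial data: [wx 0] and [w0x] agree only almost
    everywhere, and the weak formulation does not see null sets. *)
Lemma H1_ae_weak (f g g' g1' : R -> R) : H1 f g' -> H1 g g1' ->
  {ae leb, forall x, D01 x -> f x = g x} ->
  {ae leb, forall x, D01 x -> g' x = g1' x}.
Proof.
move=> Hf Hg fg; apply: (H1_ae_unique Hf).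
have [cf Lf Lg' _] := Hf; have [_ Lg Lg1' wd] := Hg.
split => // phi tphi; rewrite -wd//.
have [dphi cphi _] := tphi.
apply: eq_Rint_ae => //.
- by apply: measurable_funM; [exact: L2_measurable|apply: measurable_funTS; exact: continuous_measurable_fun].
- by apply: measurable_funM; [exact: L2_measurable|apply: measurable_funTS; exact: continuous_measurable_fun].
apply: filterS fg; first exact: (ae_filter_ringOfSetsType leb).
by move=> x /= fg Dx; rewrite fg.
Qed.

Variables (mu nu wd c0 c1 alpha : R).
Hypotheses (mu_gt0 : 0 < mu) (nu_gt0 : 0 < nu) (wd_ge0 : 0 <= wd)
  (c0_gt0 : 0 < c0) (c1_gt0 : 0 < c1).
Hypotheses (alpha_ge0 : 0 <= alpha) (alpha_le : alpha <= alpha_max mu nu wd c0 c1).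
Variables (w0 w0x w0xx : R -> R) (w wx wxx wt wxt wxxt : R -> R -> R).
Hypothesis w0_H2 : H2 w0 w0x w0xx.
Hypothesis w_sol : closed_loop_solution mu nu wd c0 c1 w0 w wx wxx wt wxt wxxt.

Lemma sol_initial_norms : L2norm (wx 0) = L2norm w0x /\ L2norm (wxx 0) = L2norm w0xx.
Proof.
have [H0 H0x] := w0_H2; have [H H'] := sol_space w_sol (lexx 0).
have e := H1_derivative_eq H H0 (sol_init w_sol).
split; first exact: (L2norm_ae_eq (H1_L2' H) (H1_L2' H0)).
exact: (L2norm_ae_eq (H1_L2' H') (H1_L2' H0x) (H1_ae_weak H' H0x e)).
Qed.

Lemma sol_norm_primitives T :
  [/\ primitive T (fun t => L2norm (w t) ^+ 2)
        (fun r => \int[leb]_(x in D01) (2 * wt r x * w r x)),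
    primitive T (fun t => L2norm (wx t) ^+ 2)
        (fun r => \int[leb]_(x in D01) (2 * wxt r x * wx r x)) &
    primitive T (fun t => L2norm (wxx t) ^+ 2)
        (fun r => \int[leb]_(x in D01) (2 * wxxt r x * wxx r x))].
Proof.
have [[m mx mxx] [mt mxt mxxt]] := sol_measurable_loc w_sol.
have [[l lx lxx] [lt lxt lxxt]] := sol_L2loc mu_gt0 w_sol.
have [e ex exx] := sol_evol mu_gt0 w_sol.
have H := sol_H1 w_sol; have Hx := sol_H1x w_sol.
split.
- apply: (primitive_eq (evol_energy T m mt l lt _ e)) => // t.
    by move=> /H/H1_L2.
  by rewrite L2norm_sq.
- apply: (primitive_eq (evol_energy T mx mxt lx lxt _ ex)) => // t.
    by move=> /Hx/H1_L2.
  by rewrite L2norm_sq.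
- apply: (primitive_eq (evol_energy T mxx mxxt lxx lxxt _ exx)) => // t.
    by move=> /Hx/H1_L2'.
  by rewrite L2norm_sq.
Qed.

Local Notation F t := (L2norm (w t) ^+ 2 + mu * L2norm (wx t) ^+ 2 + mu / nu * E1 wd c0 c1 (w t))
  (only parsing).
Local Notation G t := (L2norm (wx t) ^+ 2 + mu * L2norm (wxx t) ^+ 2 + nu^-1 * E2 wd c0 c1 (w t))
  (only parsing).

Lemma sol_integrated_decay : exists2 S, 0 <= S & forall T, 0 <= T ->
  expR (2 * alpha * T) * F T - F 0 <=
    \int[leb]_(s in Dt T) (expR (2 * alpha * s) * (- nu * L2norm (wx s) ^+ 2)) /\
  expR (2 * alpha * T) * G T - G 0 <=
    \int[leb]_(s in Dt T) (expR (2 * alpha * s) *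
      (- (nu / 2) * L2norm (wxx s) ^+ 2 + S * L2norm (wx s) ^+ 2)).
Proof.
have [K K0 hK] := sol_uniform_bound mu_gt0 w_sol.
(* By [H1_sup], [w^2] is at most [3 |w|^2 + 2 |wx|^2], hence at most [3 K]. *)
exists (source nu wd c0 c1 alpha (3 * K)).
  have k0 := kappa_ge0 nu_gt0 wd_ge0 c0_gt0 c1_gt0 alpha_ge0.
  have t0 := trace_weight_gt0 nu_gt0 wd_ge0 c0_gt0 c1_gt0 alpha_ge0.
  have s0 : 0 <= (1 + wd) ^+ 2 + 3 * K by rewrite addr_ge0 ?sqr_ge0// mulr_ge0.
  have n0 : 0 <= 8 / nu by rewrite divr_ge0// ltW.
  by rewrite /source !addr_ge0// mulr_ge0// addr_ge0// invr_ge0 ltW.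
move=> T T0.
have [p px pxx] := sol_norm_primitives T.
have [q0 q1 _ _] := sol_traces mu_gt0 w_sol T.
(* The velocities at the ends are written with [tr], the densities for which the boundary values are
   known to be primitives; they equal [wt s 0] and [wt s 1] at almost every [s]. *)
pose f s := \int[leb]_(x in D01) (2 * wt s x * w s x)
  + mu * \int[leb]_(x in D01) (2 * wxt s x * wx s x)
  + mu / nu * E1_rate wd c0 c1 (w s 0) (w s 1) (tr (-1) (wt s) (wxt s)) (tr 0 (wt s) (wxt s)).
pose g s := \int[leb]_(x in D01) (2 * wxt s x * wx s x)
  + mu * \int[leb]_(x in D01) (2 * wxxt s x * wxx s x)
  + nu^-1 * E2_rate wd c0 c1 (w s 0) (w s 1) (tr (-1) (wt s) (wxt s)) (tr 0 (wt s) (wxt s)).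
have decay : {ae leb, forall s, Dt T s ->
  2 * alpha * F s + f s <= - nu * L2norm (wx s) ^+ 2 /\
  2 * alpha * G s + g s <= - (nu / 2) * L2norm (wxx s) ^+ 2 +
    source nu wd c0 c1 alpha (3 * K) * L2norm (wx s) ^+ 2}.
  have Ft := ae_filter_ringOfSetsType leb.
  apply: filterS (filterI (filterI (sol_time_space w_sol) (sol_eq w_sol))
    (filterI hK (sol_feedback_rate mu_gt0 w_sol T))) => s /= [[h1 h2] [h3 h4]] Ds.
  have s0 : 0 < s by move: Ds; rewrite in_itv /= => /andP[].
  have {}h1 := h1 s0; have {}h2 := h2 s0; have [h5 _ _ _ _] := h3 s0.
  have [f0 f1] := h4 Ds.
  have H := sol_space w_sol (ltW s0); have [Ht Htx] := h1; have [Hw Hwx] := H.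
  rewrite /f /g (trN1 Ht) (tr0 Ht) (Rint_2M (H1_L2 Ht) (H1_L2 Hw)).
  rewrite (Rint_2M (H1_L2 Htx) (H1_L2 Hwx)) (Rint_2M (H1_L2' Htx) (H1_L2' Hwx)).
  split.
    rewrite mulNr.
    exact: (first_energy_decay mu_gt0 nu_gt0 wd_ge0 c0_gt0 c1_gt0 alpha_ge0 alpha_le H h1
      h2 (sol_feedback0 w_sol s0) (sol_feedback1 w_sol s0) f0 f1).
  rewrite mulNr.
  apply: (second_energy_decay mu_gt0 nu_gt0 wd_ge0 c0_gt0 c1_gt0 alpha_ge0 alpha_le H h1
      h2 (sol_feedback0 w_sol s0) (sol_feedback1 w_sol s0)).
  move=> x x01; apply: (le_trans (H1_sup Hw x01)).
  by have := sqr_ge0 (L2norm (w s)); have := sqr_ge0 (L2norm (wx s)); lra.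
have ix := primitive_itg px; have ixx := primitive_itg pxx.
have iS : itg leb (Dt T) (fun s => - (nu / 2) * L2norm (wxx s) ^+ 2 +
    source nu wd c0 c1 alpha (3 * K) * L2norm (wx s) ^+ 2).
  by apply: itgD => //; exact: itgZ.
have pF : primitive T (fun t => F t) f.
  have r0 := primitive_quartic (c0 + 1 + wd) (1 / (3 * c0)) q0.
  have r1 := primitive_quartic (c1 + 1 + wd) (1 / (3 * c1)) q1.
  apply: (primitive_eq (primitiveD (primitiveD p (primitiveZ mu px))
     (primitiveZ (mu / nu) (primitiveD r0 r1)))) => // t _.
  by rewrite /f /E1_rate; field; rewrite !gt_eqF.
have pG : primitive T (fun t => G t) g.
  have r0 := primitive_quartic (c0 + 1 + wd) (1 / (9 * c0)) q0.
  have r1 := primitive_quartic (c1 + 1 + wd) (1 / (9 * c1)) q1.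
  apply: (primitive_eq (primitiveD (primitiveD px (primitiveZ mu pxx))
     (primitiveZ nu^-1 (primitiveD r0 r1)))) => // t _.
  by rewrite /g /E2_rate; field; rewrite !gt_eqF.
have Ft := ae_filter_ringOfSetsType leb.
split.
  apply: (primitive_expR_le T0 pF); first exact: itgZ.
  by apply: filterS decay => s /= + Ds => /(_ Ds)[].
apply: (primitive_expR_le T0 pG iS).
by apply: filterS decay => s /= + Ds => /(_ Ds)[].
Qed.

Let a0_gt0 : 0 < c0 + 1 + wd. Proof. by rewrite ltr_wpDr// addr_gt0. Qed.
Let a1_gt0 : 0 < c1 + 1 + wd. Proof. by rewrite ltr_wpDr// addr_gt0. Qed.

Lemma quartic_ge0 (a b y : R) : 0 <= a -> 0 <= b -> 0 <= (a + b * y ^+ 2) * y ^+ 2.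
Proof. by move=> a0 b0; rewrite mulr_ge0 ?sqr_ge0// addr_ge0// mulr_ge0 ?sqr_ge0. Qed.

Lemma E2_ge0 (v : R -> R) : 0 <= E2 wd c0 c1 v.
Proof.
by rewrite /E2 addr_ge0// quartic_ge0 ?(ltW a0_gt0) ?(ltW a1_gt0)//
  divr_ge0// mulr_ge0// ltW.
Qed.

Lemma E2_le_E1 (v : R -> R) : E2 wd c0 c1 v <= E1 wd c0 c1 v.
Proof.
have h c y : 0 < c -> (c + 1 + wd + 1 / (9 * c) * y ^+ 2) * y ^+ 2 <=
    (c + 1 + wd + 1 / (3 * c) * y ^+ 2) * y ^+ 2.
  move=> c_gt0; rewrite ler_wpM2r ?sqr_ge0// lerD2l ler_wpM2r ?sqr_ge0//.
  by rewrite ler_pM2l// lef_pV2 ?posrE ?mulr_gt0// ler_pM2r// ler_nat.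
by rewrite lerD// h.
Qed.

Lemma traces_le_E1 (v : R -> R) :
  v 0 ^+ 2 + v 1 ^+ 2 <= ((c0 + 1 + wd)^-1 + (c1 + 1 + wd)^-1) * E1 wd c0 c1 v.
Proof.
have h c y : 0 < c -> (c + 1 + wd) * y ^+ 2 <=
    (c + 1 + wd + 1 / (3 * c) * y ^+ 2) * y ^+ 2.
  move=> c_gt0; rewrite ler_wpM2r ?sqr_ge0// lerDl mulr_ge0 ?sqr_ge0//.
  by rewrite divr_ge0// mulr_ge0// ltW.
have h0 := h c0 (v 0) c0_gt0; have h1 := h c1 (v 1) c1_gt0.
have p0 := mulr_ge0 (ltW a0_gt0) (sqr_ge0 (v 0)).
have p1 := mulr_ge0 (ltW a1_gt0) (sqr_ge0 (v 1)).
rewrite mulrDl lerD// mulrC ler_pdivlMr// /E1; lra.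
Qed.

(** The bracket on the right contains no [|w|^2]. Poincare's inequality bounds it by the traces,
    which [E1] controls with the first summand of the constant, and by [|wx|^2], which gives the 1;
    [mu |wx|^2] and [mu / nu E1] each cost [mu]. *)
Lemma initial_energy_le : F 0 <= ((((c0 + 1 + wd)^-1 + (c1 + 1 + wd)^-1) * nu) + 1 + 2 * mu) *
  (L2norm (wx 0) ^+ 2 + mu * L2norm (wxx 0) ^+ 2 + nu^-1 * E1 wd c0 c1 (w 0)).
Proof.
have p := poincare (sol_H1 w_sol (lexx 0)); have t := traces_le_E1 (w 0).
have E0 : 0 <= nu^-1 * E1 wd c0 c1 (w 0).
  by rewrite mulr_ge0 ?invr_ge0 ?(ltW nu_gt0)// (le_trans (E2_ge0 _) (E2_le_E1 _)).
have A0 : 0 <= ((c0 + 1 + wd)^-1 + (c1 + 1 + wd)^-1) * nu.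
  by rewrite mulr_ge0 ?addr_ge0 ?invr_ge0 ?(ltW nu_gt0) ?(ltW a0_gt0) ?(ltW a1_gt0).
have eE : E1 wd c0 c1 (w 0) = nu * (nu^-1 * E1 wd c0 c1 (w 0)) by field; rewrite gt_eqF.
have em : mu / nu * E1 wd c0 c1 (w 0) = mu * (nu^-1 * E1 wd c0 c1 (w 0)) by ring.
rewrite eE mulrA in t; rewrite em.
set e := nu^-1 * _ in E0 t *; set A := _ * nu in A0 t *.
have n1 := sqr_ge0 (L2norm (wx 0)); have n2 := sqr_ge0 (L2norm (wxx 0)).
set N1 := L2norm (wx 0) ^+ 2 in p n1 *; set N2 := L2norm (wxx 0) ^+ 2 in n2 *.
have := mulr_ge0 A0 n1; have := mulr_ge0 A0 (mulr_ge0 (ltW mu_gt0) n2).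
have := mulr_ge0 (ltW mu_gt0) n1; have := mulr_ge0 (ltW mu_gt0) n2.
have := mulr_ge0 (ltW mu_gt0) (mulr_ge0 (ltW mu_gt0) n2).
have := mulr_ge0 (ltW mu_gt0) E0.
lra.
Qed.

Lemma sol_weighted_bound : exists2 C1, 0 <= C1 & forall T, 0 <= T ->
  expR (2 * alpha * T) * G T
  + nu / 2 * \int[leb]_(s in Dt T) (expR (2 * alpha * s) * L2norm (wxx s) ^+ 2) <=
  (1 + C1) * (L2norm (wx 0) ^+ 2 + mu * L2norm (wxx 0) ^+ 2 + nu^-1 * E1 wd c0 c1 (w 0)).
Proof.
have [S S0 h] := sol_integrated_decay; have F0 := initial_energy_le.
set D := (_ + _ + nu^-1 * _) in F0 *; set C3 := (_ + 1 + _) in F0.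
(* Dropping the nonnegative final energy [F T], the first estimate gives [nu J1 <= F 0 <= C3 D], so
   the source [S J1] is at most [S / nu * C3 * D]. *)
exists (S / nu * C3).
  rewrite mulr_ge0 ?divr_ge0 ?(ltW nu_gt0)// /C3.
  by rewrite !addr_ge0 ?mulr_ge0 ?addr_ge0 ?invr_ge0 ?(ltW nu_gt0) ?(ltW a0_gt0) ?(ltW a1_gt0) ?(ltW mu_gt0).
move=> T T0; have [hF hG] := h T T0.
have [p px pxx] := sol_norm_primitives T.
have ix := itg_expR_mul (2 * alpha) (primitive_itg px).
have ixx := itg_expR_mul (2 * alpha) (primitive_itg pxx).
move: hF hG.
under Rint_eq do rewrite mulrCA.
rewrite RintegralZl//.
rewrite (_ : \int[leb]_(s in Dt T) (expR (2 * alpha * s) * (_ + _)) =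
  \int[leb]_(s in Dt T) (- (nu / 2) * (expR (2 * alpha * s) * L2norm (wxx s) ^+ 2)
    + S * (expR (2 * alpha * s) * L2norm (wx s) ^+ 2))); last first.
  by apply: Rint_eq => s _; ring.
rewrite RintegralD//; [|exact: itgZ|exact: itgZ].
rewrite !RintegralZl//.
set J1 := Rintegral _ _ _; set J2 := Rintegral _ _ _ => hF hG.
have FT : 0 <= expR (2 * alpha * T) * F T.
  rewrite mulr_ge0 ?expR_ge0// !addr_ge0 ?sqr_ge0// pmulr_rge0 ?sqr_ge0 ?divr_gt0//.
  exact: le_trans (E2_ge0 _) (E2_le_E1 _).
have GD : G 0 <= D by rewrite lerD2l ler_wpM2l ?E2_le_E1 ?invr_ge0 ?(ltW nu_gt0).
have nJ : nu * J1 <= C3 * D by lra.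
have SJ : S * J1 <= S / nu * C3 * D.
  by rewrite -!mulrA ler_wpM2l// mulrA -(ler_pM2l nu_gt0) !mulrA divff ?gt_eqF// mul1r.
lra.
Qed.

End decay.

Theorem lemma2p2 (R : realType) (mu nu wd c0 c1 alpha : R)
    (mu_gt0 : 0 < mu) (nu_gt0 : 0 < nu) (wd_ge0 : 0 <= wd)
    (c0_gt0 : 0 < c0) (c1_gt0 : 0 < c1)
    (alpha_ge0 : 0 <= alpha) (alpha_le : alpha <= alpha_max mu nu wd c0 c1)
    (w0 w0x w0xx : R -> R) (w0_H2 : H2 w0 w0x w0xx)
    (w wx wxx wt wxt wxxt : R -> R -> R)
    (w_sol : closed_loop_solution mu nu wd c0 c1 w0 w wx wxx wt wxt wxxt) :
  exists2 C : R, 0 < C & forall t : R, 0 < t ->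
    L2norm (wx t) ^+ 2 + mu * L2norm (wxx t) ^+ 2
      + nu^-1 * E2 wd c0 c1 (w t)
      + beta mu nu wd c0 c1 alpha * expR (- (2 * alpha * t))
        * \int[lebesgue_measure]_(s in `[0, t])
            (expR (2 * alpha * s) * L2norm (wxx s) ^+ 2)
    <= C * expR (- (2 * alpha * t))
       * (L2norm w0x ^+ 2 + mu * L2norm w0xx ^+ 2
          + nu^-1 * E1 wd c0 c1 (w 0))
       * expR C.
Proof.
have [C1 C10 h] := sol_weighted_bound mu_gt0 nu_gt0 wd_ge0 c0_gt0 c1_gt0 alpha_ge0 alpha_le w_sol.
have [<- <-] := sol_initial_norms w0_H2 w_sol.
set b := beta _ _ _ _ _ _; set D := (L2norm (wx 0) ^+ 2 + _ + _) in h *.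
have b1 : 0 <= 2 * `|b| / nu by rewrite divr_ge0 ?mulr_ge0 ?(ltW nu_gt0).
(* The weighted bound controls [nu / 2 J], while the claim has [b J], at most [2 |b| / nu] times
   that; the two contributions add up to this constant. *)
exists ((1 + 2 * `|b| / nu) * (1 + C1)); first by rewrite mulr_gt0// ltr_pwDl.
move=> t t0; have {h} := h t (ltW t0).
have [_ _ pxx] := sol_norm_primitives mu_gt0 w_sol t.
have ixx := itg_expR_mul (2 * alpha) (primitive_itg pxx).
rewrite Rint_itvcc//; set J := Rintegral _ _ _ => h.
have J0 : 0 <= J by apply: Rintegral_ge0 => s _; rewrite mulr_ge0 ?expR_ge0 ?sqr_ge0.
set G := (L2norm (wx t) ^+ 2 + _ + nu^-1 * _) in h *.
have Gt : 0 <= expR (2 * alpha * t) * G.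
  rewrite mulr_ge0 ?expR_ge0// /G !addr_ge0 ?sqr_ge0// pmulr_rge0 ?sqr_ge0 ?invr_gt0//.
  exact: (E2_ge0 wd_ge0 c0_gt0 c1_gt0).
set X := (1 + C1) * D in h.
have X0 : 0 <= X by apply: le_trans h; rewrite addr_ge0// mulr_ge0// divr_ge0// ltW.
have bJ : b * J <= 2 * `|b| / nu * X.
  apply: (@le_trans _ _ (`|b| * J)); first by rewrite ler_wpM2r// ler_norm.
  have bX : `|b| * (nu / 2 * J) <= `|b| * X by rewrite ler_wpM2l//; lra.
  rewrite (_ : `|b| * J = 2 / nu * (`|b| * (nu / 2 * J))); last first.
    by field; rewrite gt_eqF.
  rewrite (_ : 2 * `|b| / nu * X = 2 / nu * (`|b| * X)); last by ring.
  by rewrite ler_wpM2l// divr_ge0// ltW.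
have e1 : expR (- (2 * alpha * t)) * expR (2 * alpha * t) = 1.
  by rewrite -expRD addNr expR0.
set C := (1 + _) * (1 + C1).
have C0 : 0 <= C by rewrite mulr_ge0// addr_ge0.
have CD : C * D = (1 + 2 * `|b| / nu) * X by rewrite /X mulrA.
apply: (@le_trans _ _ (expR (- (2 * alpha * t)) * (C * D))).
  rewrite (_ : G + _ = expR (- (2 * alpha * t)) * (expR (2 * alpha * t) * G + b * J));
    last by rewrite mulrDr mulrA e1 mul1r mulrCA mulrA.
  rewrite ler_wpM2l ?expR_ge0// CD.
  have := mulr_ge0 (divr_ge0 (ltW nu_gt0) (ler0n R 2)) J0; lra.
(* The remaining factor [expR C] is at least 1 because [C] is nonnegative. *)
rewrite -[X in X <= _]mulr1 (_ : C * _ * D = expR (- (2 * alpha * t)) * (C * D)); last by ring.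
rewrite ler_wpM2l//; last by rewrite -expR0 ler_expR.
by rewrite mulr_ge0 ?expR_ge0// CD mulr_ge0// addr_ge0.
Qed.
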